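(* Let $R$ be a generalized Golod ring and let $M$, $N$ be finitely generated $R$-modules such that $\operatorname{Tor}^R_i(M,N)=0$ for all $i\gg 0$. Then $\{\operatorname{curv}_R M,\ \operatorname{curv}_R N\}\cap\{0,1\}\neq\emptyset$.
   Context: All rings are commutative Noetherian local rings with $1\neq 0$, and all modules are finitely generated. Let $R$ be a local ring with maximal ideal $\mathfrak m$ and residue field $k=R/\mathfrak m$. Curvature: for a finitely generated $R$-module $M$ put $\beta^R_n(M)=\dim_k\operatorname{Tor}^R_n(k,M)$ and $\operatorname{curv}_R M=\limsup_{n\to\infty}(\beta^R_n(M))^{1/n}$. Acyclic closure: the acyclic closure $R\langle X\rangle$ of $k$ over $R$ is the DG $R$-algebra resolution of $k$ obtained from $R$ by Tate's process of killing cycles in a minimal way: one adjoins exterior variables in odd degrees and divided power variables in even degrees, the degree $1$ variables being mapped by the differential onto a minimal generating set of $\mathfrak m$, and, for $n\ge 1$, the degree $n+1$ variables being mapped to cycles whose classes form a minimal generating set of $H_n(R\langle X_{\le n}\rangle)$. Here $R\langle X_{\le n}\rangle$ is the DG subalgebra generated by the variables of degree at most $n$. Trivial Massey operation: let $U$ be such a DG algebra with augmentation $U\to k$, and set $\overline a=(-1)^{d+1}a$ for $a\in U_d$ (extended additively). $U$ admits a trivial Massey operation if to each finite sequence $v_1,\dots,v_n$ ($n\ge 1$) of elements of $\widetilde H(U)=\ker(H(U)\to k)$ one can assign an element $\gamma(v_1,\dots,v_n)\in\ker(U\to k)$ such that (i) $\gamma(v)$ is a cycle representing the homology class $v$ for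 each $v\in\widetilde H(U)$, and (ii) $d\gamma(v_1,\dots,v_n)=\sum_{j=1}^{n-1}\overline{\gamma(v_1,\dots,v_j)}\,\gamma(v_{j+1},\dots,v_n)$. Generalized Golod ring: $R$ is generalized Golod (of level $\le q$, where $q\geq 1$) if $R\langle X_{\le q}\rangle$ admits a trivial Massey operation; $R$ is generalized Golod if this holds for some $q$. *)

(* Defs.v *)
From HB Require Import structures.
From mathcomp Require Import all_boot all_order all_algebra.
From mathcomp Require Import all_classical all_reals all_analysis.

Set Implicit Arguments.
Unset Strict Implicit.
Unset Printing Implicit Defensive.

Import Order.TTheory GRing.Theory Num.Theory.
Local Open Scope classical_set_scope.
Local Open Scope ring_scope.

Section LocalRings.
Variable R : comNzRingType.

Definition is_ideal (I : set R) : Prop :=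
  [/\ I 0, forall x y, I x -> I y -> I (x + y) & forall a x, I x -> I (a * x)].

Definition noetherian : Prop := forall I : set R, is_ideal I ->
  exists r (g : 'I_r -> R), I = [set x | exists c, x = \sum_i c i * g i].

Definition is_maximal_ideal (I : set R) : Prop :=
  [/\ is_ideal I, ~ I 1 &
      forall J, is_ideal J -> ~ J 1 -> I `<=` J -> J = I].

Definition local_ring (m : set R) : Prop :=
  is_maximal_ideal m /\ forall J, is_maximal_ideal J -> J = m.

(* [pi] exhibits the field [k] as the quotient [R / m]. *)
Definition residue_map (m : set R) (k : fieldType) (pi : {rmorphism R -> k}) :
    Prop :=
  (forall y, exists x, pi x = y) /\ (forall x, pi x = 0 <-> m x).

Definition finitely_generated (M : lmodType R) : Prop :=
  exists r (g : 'I_r -> M), forall x, exists c, x = \sum_i c i *: g i.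

End LocalRings.

Section Resolutions.
Variable R : comNzRingType.

(* A complex  ... -> R^(rk 1) -> R^(rk 0) -> 0  of finite free modules; the
   elements are row vectors, [dmx n] acts by multiplication on the right. *)
Record free_complex := FreeComplex {
  rk : nat -> nat;
  dmx : forall n, 'M[R]_(rk n.+1, rk n) }.

Definition free_resolution (M : lmodType R) (F : free_complex) : Prop :=
  exists e : 'I_(rk F 0%N) -> M,
  [/\ forall x, exists v : 'rV[R]_(rk F 0%N), x = \sum_i v 0 i *: e i,
      forall v : 'rV[R]_(rk F 0%N), \sum_i v 0 i *: e i = 0 <->
        exists w : 'rV_(rk F 1%N), v = w *m dmx F 0%N
    & forall n (v : 'rV[R]_(rk F n.+1)), v *m dmx F n = 0 <->
        exists w : 'rV_(rk F n.+2), v = w *m dmx F n.+1].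

Definition zero_complex : free_complex :=
  @FreeComplex (fun=> 0%N) (fun=> 0).

(* A chosen resolution by finite free modules. One exists for finitely generated
   modules over a noetherian ring, see [free_resolution_exists] below; for
   other modules the value is irrelevant. *)
Definition resolution (M : lmodType R) : free_complex :=
  match pselect (exists F, free_resolution M F) with
  | left h => projT1 (cid h)
  | right _ => zero_complex
  end.

Definition out_mx (F : free_complex) (n : nat) : 'M[R]_(rk F n, rk F n.-1) :=
  match n with 0 => 0 | n'.+1 => dmx F n' end.

(* The map [A (x) N : N^p -> N^q]. *)
Definition tensor_map (N : lmodType R) p q (A : 'M[R]_(p, q)) (x : 'I_p -> N) :
    'I_q -> N :=
  fun j => \sum_i A i j *: x i.

(* Tor_n(M, N) = H_n(F (x) N) is zero, for F the resolution of M. *)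
Definition Tor_eq0 (M N : lmodType R) (n : nat) : Prop :=
  let F := resolution M in
  forall x : 'I_(rk F n) -> N,
    tensor_map (out_mx F n) x = (fun=> 0) ->
    exists y : 'I_(rk F n.+1) -> N, x = tensor_map (dmx F n) y.

(* dim_k Tor_n(k, M) = dim_k H_n(k (x) F) = dim_k Ker - dim_k Im, where
   k is an R-algebra through [pi]. *)
Definition betti (k : fieldType) (pi : {rmorphism R -> k}) (M : lmodType R)
    (n : nat) : nat :=
  let F := resolution M in
  (\rank (kermx (map_mx pi (out_mx F n))) - \rank (map_mx pi (dmx F n)))%N.

Definition curv (RT : realType) (k : fieldType) (pi : {rmorphism R -> k})
    (M : lmodType R) : \bar RT :=
  limn_esup (fun n => (((betti pi M n)%:R : RT) `^ (n%:R^-1))%:E).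

End Resolutions.

Section FreeResolutionExists.
Variable R : comNzRingType.
Hypothesis noethR : noetherian R.

Lemma row_submodule_fg n (P : set 'rV[R]_n) :
  P 0 -> (forall u v, P u -> P v -> P (u + v)) ->
  (forall a u, P u -> P (a *: u)) ->
  exists p (A : 'M[R]_(p, n)), forall v, P v <-> exists w, v = w *m A.
Proof.
elim: n P => [|n IHn] P P0 PD PZ.
  exists 0%N, 0 => v; split=> [_|_]; first by exists 0; apply/rowP=> -[].
  by rewrite (_ : v = 0) //; apply/rowP=> -[].
pose I := [set a : R | exists2 v : 'rV_n.+1, P v & v 0 ord0 = a].
have [|r [g Ig]] := noethR (I := I).
- split; first by exists 0; rewrite // mxE.
    by move=> x y [u Pu <-] [v Pv <-]; exists (u + v); rewrite ?mxE //; apply: PD.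
  by move=> a x [u Pu <-]; exists (a *: u); rewrite ?mxE //; apply: PZ.
have Psum s (c : 'I_s -> R) (u : 'I_s -> 'rV_n.+1) :
    (forall i, P (u i)) -> P (\sum_i c i *: u i).
  by move=> Pu; elim/big_ind: _ => // i _; apply/PZ/Pu.
have /choice [u /all_and2[Pu ug]] i : exists v, P v /\ v 0 ord0 = g i.
  have: I (g i).
    rewrite Ig /=; exists (fun j => (j == i)%:R); rewrite (bigD1 i) //= eqxx mul1r.
    by rewrite big1 ?addr0 // => j /negPf->; rewrite mul0r.
  by case=> v ? ?; exists v.
pose cons0 (w : 'rV[R]_n) : 'rV[R]_n.+1 := @row_mx R 1 1 n 0 w.
have cons0D v w : cons0 v + cons0 w = cons0 (v + w).
  by apply/rowP=> j; rewrite !mxE; case: fintype.split => i; rewrite !mxE ?addr0.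
have cons0Z a v : a *: cons0 v = cons0 (a *: v).
  by apply/rowP=> j; rewrite !mxE; case: fintype.split => i; rewrite !mxE ?mulr0.
have [|||p [A PA]] := IHn [set w | P (cons0 w)].
- by rewrite /= /cons0 row_mx0.
- by move=> v w /= Pv Pw; rewrite -cons0D; apply: PD.
- by move=> a v /= Pv; rewrite -cons0Z; apply: PZ.
have cons0M w : w *m @row_mx R p 1 n 0 A = cons0 (w *m A).
  have: w *m @row_mx R p 1 n 0 A = @row_mx R 1 1 n (w *m 0) (w *m A).
    exact: mul_mx_row.
  by rewrite mulmx0.
exists (r + p)%N, (col_mx (\matrix_i u i) (@row_mx R p 1 n 0 A)) => v; split.
  move=> Pv; have: I (v 0 ord0) by exists v.
  rewrite Ig => -[c vc].
  pose v1 := v - \sum_i c i *: u i.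
  have Pv1 : P v1.
    by apply: PD => //; rewrite -scaleN1r; apply/PZ/Psum.
  have v1E : v1 = cons0 (@rsubmx R 1 1 n v1).
    apply: etrans (esym (@hsubmxK R 1 1 n v1)) _; rewrite /cons0.
    congr (@row_mx R 1 1 n _ _); apply/rowP=> j.
    rewrite !mxE (_ : lshift n j = ord0); last by apply/val_inj; rewrite /= ord1.
    rewrite vc summxE -sumrB big1 // => i _.
    by rewrite mxE ug subrr.
  have /PA [w wE] : P (cons0 (@rsubmx R 1 1 n v1)) by rewrite -v1E.
  exists (row_mx (\row_i c i) w); rewrite mul_row_col cons0M -wE -v1E.
  rewrite mulmx_sum_row; under eq_bigr do rewrite mxE rowK.
  by rewrite /v1 addrC subrK.
case=> w ->; rewrite -[w]hsubmxK mul_row_col cons0M; apply: PD.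
  by rewrite mulmx_sum_row; under eq_bigr do rewrite rowK; apply: Psum.
by apply/PA; exists (rsubmx w).
Qed.

Lemma row_kernel_fg p n (A : 'M[R]_(p, n)) :
  exists q (B : 'M[R]_(q, p)), forall v : 'rV_p,
    v *m A = 0 <-> exists w, v = w *m B.
Proof.
apply: (@row_submodule_fg p [set v | v *m A = 0]) => /=.
- by rewrite mul0mx.
- by move=> u v u0 v0; rewrite mulmxDl u0 v0 addr0.
- by move=> a u u0; rewrite -scalemxAl u0 scaler0.
Qed.

Record res_state := ResState {
  src : nat; tgt : nat; mat : 'M[R]_(src, tgt) }.

Lemma free_resolution_exists (M : lmodType R) :
  finitely_generated M -> exists F, free_resolution M F.
Proof.
case=> r [g gM].
have nxtE (s : res_state) : exists t : {q & 'M[R]_(q, src s)},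
    forall v : 'rV_(src s), v *m mat s = 0 <-> exists w, v = w *m projT2 t.
  by have [q [B BP]] := row_kernel_fg (mat s); exists (existT _ q B).
pose nxt s := projT1 (cid (nxtE s)); have nxtP s := projT2 (cid (nxtE s)).
have [||| q [B BP]] := @row_submodule_fg r [set v | \sum_i v 0 i *: g i = 0].
- by rewrite /= big1 // => i _; rewrite mxE scale0r.
- move=> u v /= u0 v0; under eq_bigr do rewrite mxE scalerDl.
  by rewrite big_split /= u0 v0 addr0.
- move=> a u /= u0; under eq_bigr do rewrite mxE -scalerA.
  by rewrite -scaler_sumr u0 scaler0.
pose st n := iter n (fun s => ResState (projT2 (nxt s))) (ResState B).
exists (@FreeComplex R (fun n => tgt (st n)) (fun n => mat (st n))), g; split.
- move=> x; have [c ->] := gM x; exists (\row_i c i).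
  by apply: eq_bigr => i _; rewrite mxE.
- exact: BP.
- by move=> n v; apply: nxtP.
Qed.

End FreeResolutionExists.

Section TateAlgebras.
Variable R : comNzRingType.

(* Exponents of monomials in a family of variables with [nvar n] variables of
   degree [n]. *)
Definition expo (nvar : nat -> nat) := forall n, 'I_(nvar n) -> nat.

(* Exponents of the normal monomials in the variables of degree at most [q]. *)
Definition normal_expo nvar (q : nat) (al : expo nvar) : Prop :=
  (forall n i, (q < n)%N -> al n i = 0%N) /\
  (forall n i, odd n -> (al n i <= 1)%N).

Definition expo_deg nvar (q : nat) (al : expo nvar) : nat :=
  (\sum_(n < q.+1) \sum_(i < nvar n) n * al n i)%N.

Section Monomials.
Variables (A : algType R) (nvar : nat -> nat).
Variable dp : forall n, 'I_(nvar n) -> nat -> A.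

Definition monomial (q : nat) (al : expo nvar) : A :=
  \prod_(n < q.+1) \prod_(i < nvar n) dp i (al n i).

(* R<X_{<= q}>, the span of the normal monomials in X_{<= q} *)
Definition span_le (q : nat) : set A :=
  [set a | exists r (al : 'I_r -> expo nvar) (c : 'I_r -> R),
    (forall i, normal_expo q (al i)) /\ a = \sum_i c i *: monomial q (al i)].

(* the component of degree [n] *)
Definition homog (n : nat) : set A :=
  [set a | exists q r (al : 'I_r -> expo nvar) (c : 'I_r -> R),
    (forall i, normal_expo q (al i) /\ expo_deg q (al i) = n) /\
    a = \sum_i c i *: monomial q (al i)].

End Monomials.

(* DG R-algebras of the form R<X>: as a graded algebra it is the tensor product
   of the exterior algebra on the variables of odd degree and the divided power
   algebra on those of even degree; [dp i j] is the j-th divided power of the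
   i-th variable of degree n. The algebra structure is determined by the
   commutation and multiplication rules for the [dp i j] together with the fact
   that the normal monomials form a basis. *)
Record tate_algebra := TateAlgebra {
  car :> algType R;
  nvar : nat -> nat;
  dp : forall n, 'I_(nvar n) -> nat -> car;
  dif : {linear car -> car};
  nvar0 : nvar 0%N = 0%N;
  dp0 : forall n (i : 'I_(nvar n)), dp i 0%N = 1;
  dpM : forall n (i : 'I_(nvar n)) a b,
    dp i a * dp i b = dp i (a + b)%N *+ 'C(a + b, a);
  dp_odd : forall n (i : 'I_(nvar n)) a, odd n -> (1 < a)%N -> dp i a = 0;
  dpC : forall n (i : 'I_(nvar n)) n' (i' : 'I_(nvar n')) a b,
    dp i a * dp i' b = (-1) ^+ (n * a * (n' * b))%N * (dp i' b * dp i a);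
  monomial_span : forall a, exists q, span_le dp q a;
  monomial_free : forall q r (al : 'I_r -> expo nvar) (c : 'I_r -> R),
    injective al -> (forall i, normal_expo q (al i)) ->
    \sum_i c i *: monomial dp q (al i) = 0 -> forall i, c i = 0;
  dif_homog0 : forall a, homog dp 0%N a -> dif a = 0;
  dif_homogS : forall n a, homog dp n.+1 a -> homog dp n (dif a);
  difK : forall a, dif (dif a) = 0;
  leibniz : forall n a b, homog dp n a ->
    dif (a * b) = dif a * b + (-1) ^+ n * (a * dif b);
  dif_dp : forall n (i : 'I_(nvar n)) a, ~~ odd n ->
    dif (dp i a.+1) = dif (dp i 1%N) * dp i a }.

Definition stage (A : tate_algebra) (q : nat) : set A := span_le (@dp A) q.

(* the classes of z_0, ..., z_(r-1) form a minimal generating set of Z / B *)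
Definition minimal_generators (V : lmodType R) (Z B : set V) r
    (z : 'I_r -> V) : Prop :=
  [/\ forall i, Z (z i),
      forall a, Z a -> exists c, B (a - \sum_i c i *: z i)
    & forall i0, ~ forall a, Z a -> exists c,
        B (a - \sum_(i | i != i0) c i *: z i)].

Definition is_acyclic_closure (m : set R) (A : tate_algebra) : Prop :=
  minimal_generators [set r%:A | r in m] [set 0 : A]
    (fun i : 'I_(nvar A 1%N) => dif A (dp i 1%N)) /\
  forall n, (0 < n)%N ->
    minimal_generators
      [set z : A | [/\ stage n z, homog (@dp A) n z & dif A z = 0]]
      [set dif A w | w in [set w : A | stage n w /\ homog (@dp A) n.+1 w]]
      (fun i : 'I_(nvar A n.+1) => dif A (dp i 1%N)).

Definition homog_decomp (A : tate_algebra) (a : A) (l : nat) (f : nat -> A) :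
    Prop :=
  (forall n, homog (@dp A) n (f n)) /\ a = \sum_(n < l) f n.

(* The additive map with value (-1)^(n+1) a on elements [a] of degree n. *)
Definition bar (A : tate_algebra) (a : A) : A :=
  xget 0 [set b | exists l f, homog_decomp a l f /\
                              b = \sum_(n < l) (-1) ^+ n.+1 * f n].

Section Massey.
Variables (k : fieldType) (pi : {rmorphism R -> k}).

(* The augmentation R<X> -> k: [pi] in degree 0, zero in positive degrees. *)
Definition aug (A : tate_algebra) (a : A) : k :=
  xget 0 [set c | exists l f r,
    [/\ homog_decomp a l.+1 f, f 0%N = r%:A & c = pi r]].

(* the class in H(R<X_{<= q}>) of a cycle z *)
Definition hclass (A : tate_algebra) (q : nat) (z : A) : set A :=
  [set z + dif A w | w in @stage A q].

(* Ker (H(U) -> k) for U = R<X_{<= q}> *)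
Definition reduced_homology (A : tate_algebra) (q : nat) : set (set A) :=
  [set hclass q z | z in
    [set z : A | [/\ stage q z, dif A z = 0 & aug z = 0]]].

Definition trivial_massey (A : tate_algebra) (q : nat) : Prop :=
  exists ga : seq {v : set A | reduced_homology q v} -> A,
  [/\ forall s, (0 < size s)%N -> stage q (ga s) /\ aug (ga s) = 0,
      forall v, dif A (ga [:: v]) = 0 /\ sval v (ga [:: v])
    & forall s, (0 < size s)%N ->
        dif A (ga s) =
        \sum_(1 <= j < size s) bar (ga (take j s)) * ga (drop j s)].

Definition generalized_golod_level (m : set R) (q : nat) : Prop :=
  exists A : tate_algebra, is_acyclic_closure m A /\ trivial_massey A q.

Definition generalized_golod (m : set R) : Prop :=
  exists2 q, (1 <= q)%N & generalized_golod_level m q.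

End Massey.
End TateAlgebras.

(* Main.v *)
Require Import Defs.
From HB Require Import structures.
From mathcomp Require Import all_boot all_order all_algebra.
From mathcomp Require Import all_classical all_reals all_analysis.
From mathcomp Require Import zify ring lra.

Set Implicit Arguments.
Unset Strict Implicit.
Unset Printing Implicit Defensive.

Import Order.TTheory GRing.Theory Num.Theory.
Local Open Scope classical_set_scope.
Local Open Scope ring_scope.

(* Let U = R<X_{<= q}>, let Ut be the kernel of its augmentation to k, and let K be
   the Koszul complex on the variables of degree 1.

   Since U has a trivial Massey operation, the bar-type complex U (x) T(H(Ut)[1]),
   with differential given by the operation, is a resolution of k. Comparing it
   with R<X>, one obtains a quasi-isomorphism from a direct sum of shifts of R<X>,
   with v_n copies in degree n, onto Ut. Let F be a complex of finite free modules
   with dim H_n(F (x) k) = b_n. Then 0 -> Ut -> U -> k -> 0 shows that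
   b_{n+1} - sum_j v_j b_{n-j} is bounded by the dimensions of H(F (x) U) in degrees
   n and n + 1. If H_n(F) = 0 for n >> 0, then H(F (x) K) has finite length, and U is
   filtered by shifts of K, polynomially many in each degree; so these dimensions
   grow polynomially.

   This applies to the resolutions of M and of N and, by the vanishing of Tor, to
   their tensor product, whose sequence is the convolution of the two sequences of
   Betti numbers. So b, c and b * c all satisfy a = w * a + (subexponential) with the
   same weight w >= 0. If W(1) <= 1, then b is subexponential. Otherwise
   W(rho) = 1 for some rho < 1, and (1 - W) B, (1 - W) C and (1 - W) B C converge
   beyond rho, where 1 - W has a simple zero. If neither b nor c is subexponential,
   then B and C have poles at rho, so B C has a double pole, which is impossible. *)

(** * Linear algebra over the residue field *)

(** The weight depends on $R$ alone: $w_{n+1} = v_n$ is the dimension of $H_n$ of Ut. Hence the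
    three sequences share it, although one of them is the convolution of the other two.

    Two obstacles shape the algebra. A trivial Massey operation is a bare function on homology
    classes: it is not additive and its values need not be homogeneous. So it is evaluated on words
    in a basis of homology, and its values are projected to single degrees. Moreover the maximal
    ideal kills the homology of the complexes, not the complexes themselves. So dimensions are
    measured on cycles modulo boundaries, from below by independent families and from above by
    matrices of relations; exact sequences turn into inequalities by multiplying such matrices.

    No complex analysis is used for the poles: all sequences are nonnegative, and bounds on partial
    sums of the sequences rescaled by powers of rho do the same work.

    The vanishing of Tor enters only as exactness of F (x) G in high degrees, F and G being the
    resolutions of M and N, while the convolution is Künneth's formula for F (x) G (x) k. *)

Section LinearFunctions.
Variables (R : pzRingType) (U V W : lmodType R).

Lemma lin0 (f : U -> V) : linear f -> f 0 = 0.
Proof. by move=> fL; have := fL (-1) 0 0; rewrite scaler0 addr0 scaleN1r addNr. Qed.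

Lemma linD (f : U -> V) x y : linear f -> f (x + y) = f x + f y.
Proof. by move=> fL; have := fL 1 x y; rewrite !scale1r. Qed.

Lemma linZ (f : U -> V) a x : linear f -> f (a *: x) = a *: f x.
Proof. by move=> fL; have := fL a x 0; rewrite !addr0 (lin0 fL) addr0. Qed.

Lemma linN (f : U -> V) x : linear f -> f (- x) = - f x.
Proof. by move=> fL; rewrite -!scaleN1r linZ. Qed.

Lemma linB (f : U -> V) x y : linear f -> f (x - y) = f x - f y.
Proof. by move=> fL; rewrite linD // linN. Qed.

Lemma lin_sum (f : U -> V) (I : Type) (r : seq I) (P : pred I) (F : I -> U) :
  linear f -> f (\sum_(i <- r | P i) F i) = \sum_(i <- r | P i) f (F i).
Proof.
move=> fL; elim/big_rec2: _ => [|i x y _ <-]; [exact: lin0 | exact: linD].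
Qed.

Definition submod (P : set V) : Prop :=
  P 0 /\ forall a x y, P x -> P y -> P (a *: x + y).

Lemma submod0 (P : set V) : submod P -> P 0.
Proof. by case. Qed.

Lemma submod_D (P : set V) x y : submod P -> P x -> P y -> P (x + y).
Proof. by move=> [_ H] Px Py; have := H 1 _ _ Px Py; rewrite scale1r. Qed.

Lemma submod_Z (P : set V) a x : submod P -> P x -> P (a *: x).
Proof. by move=> [P0 H] Px; have := H a _ _ Px P0; rewrite addr0. Qed.

Lemma submod_N (P : set V) x : submod P -> P x -> P (- x).
Proof. by move=> PS Px; rewrite -scaleN1r; apply: submod_Z. Qed.

Lemma submod_B (P : set V) x y : submod P -> P x -> P y -> P (x - y).
Proof. by move=> PS Px Py; apply: submod_D => //; apply: submod_N. Qed.

Lemma submod_sum (P : set V) (I : Type) (r : seq I) (p : pred I) (F : I -> V) :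
  submod P -> (forall i, p i -> P (F i)) -> P (\sum_(i <- r | p i) F i).
Proof.
by move=> PS PF; elim/big_ind: _ => [|x y|//]; [case: PS | apply: submod_D].
Qed.

Lemma submod_sign (P : set V) n x : submod P -> P x -> P ((-1) ^+ n *: x).
Proof. exact: submod_Z. Qed.

End LinearFunctions.

Lemma signZK (R : pzRingType) (V : lmodType R) n (x : V) :
  (-1) ^+ n *: ((-1) ^+ n *: x) = x.
Proof. by rewrite scalerA -exprD addnn -mul2n exprM sqrrN !expr1n scale1r. Qed.

Section Combinations.
Variables (R : comNzRingType) (V W : lmodType R).

Definition comb n p (C : 'M[R]_(p, n)) (x : 'I_n -> V) : 'I_p -> V :=
  fun i => \sum_j C i j *: x j.

Lemma combM n p q (C : 'M[R]_(p, n)) (D : 'M[R]_(q, p)) x :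
  comb (D *m C) x = comb D (comb C x).
Proof.
apply/funext => i; rewrite /comb.
under [RHS]eq_bigr do rewrite scaler_sumr.
rewrite exchange_big; apply: eq_bigr => j _.
by rewrite mxE scaler_suml; apply: eq_bigr => l _; rewrite scalerA.
Qed.

Lemma comb1 n (x : 'I_n -> V) : comb 1%:M x = x.
Proof.
apply/funext => i; rewrite /comb (bigD1 i) //= mxE eqxx scale1r big1 ?addr0 //.
by move=> j ne; rewrite mxE eq_sym (negPf ne) scale0r.
Qed.

Lemma combB n p (C : 'M[R]_(p, n)) x y i :
  comb C (fun j => x j - y j) i = comb C x i - comb C y i.
Proof. by rewrite /comb -sumrB; apply: eq_bigr => j _; rewrite scalerBr. Qed.

Lemma submod_comb n p (C : 'M[R]_(p, n)) (P : set V) x i :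
  submod P -> (forall j, P (x j)) -> P (comb C x i).
Proof. by move=> PS Px; apply: submod_sum => // j _; apply: submod_Z. Qed.

End Combinations.

Lemma lin_comb (R : comNzRingType) (V W : lmodType R) (f : V -> W) n p
    (C : 'M[R]_(p, n)) x i :
  linear f -> f (comb C x i) = comb C (fun j => f (x j)) i.
Proof. by move=> fL; rewrite lin_sum //; apply: eq_bigr => j _; rewrite linZ. Qed.

Section Dimension.
Variables (R : comNzRingType) (k : fieldType) (pi : {rmorphism R -> k}).
Hypothesis pi_surj : forall y, exists x, pi x = y.

(* "dim_k (Z / B) <= e", phrased so that Z / B need not be killed by the kernel
   of [pi]. *)
Definition dimle (V : lmodType R) (Z B : set V) (e : nat) : Prop :=
  forall n (x : 'I_n -> V), (forall i, Z (x i)) ->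
    exists p (C : 'M[R]_(p, n)),
      [/\ (n <= p + e)%N, row_free (map_mx pi C) & forall i, B (comb C x i)].

Definition indep (V : lmodType R) (B : set V) d (x : 'I_d -> V) : Prop :=
  forall c : 'I_d -> R, B (\sum_i c i *: x i) -> forall i, pi (c i) = 0.

Definition dimge (V : lmodType R) (Z B : set V) (d : nat) : Prop :=
  exists x : 'I_d -> V, (forall i, Z (x i)) /\ indep B x.

Lemma map_mx_surj p n (A : 'M[k]_(p, n)) : exists C : 'M[R]_(p, n), map_mx pi C = A.
Proof.
have [s sP] := choice pi_surj; exists (map_mx s A).
by apply/matrixP => i j; rewrite !mxE.
Qed.

(** A matrix of relations on an independent family vanishes over k; having full row rank there, it
    has no rows. *)
Lemma dim_leq (V : lmodType R) (Z B : set V) d e :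
  dimge Z B d -> dimle Z B e -> (d <= e)%N.
Proof.
move=> [x [Zx xi]] /(_ _ _ Zx) [p [C [le fr BC]]].
suff p0 : p = 0%N by rewrite p0 in le.
have C0 : map_mx pi C = 0.
  by apply/matrixP => i j; rewrite !mxE; apply: xi (BC i) j.
by move: fr; rewrite C0 /row_free mxrank0 => /eqP.
Qed.

Lemma dimle_mono (V : lmodType R) (Z B : set V) e e' :
  (e <= e')%N -> dimle Z B e -> dimle Z B e'.
Proof.
move=> le H n x Zx; have [p [C [? ? ?]]] := H n x Zx; exists p, C; split=> //.
by apply: leq_trans (_ : p + e <= _)%N => //; rewrite leq_add2l.
Qed.

Lemma dimle0 (V : lmodType R) (Z B : set V) : Z `<=` B -> dimle Z B 0.
Proof.
move=> ZB n x Zx; exists n, 1%:M; split.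
- by rewrite addn0.
- by rewrite map_mx1 row_free_unit unitmx1.
- by move=> i; rewrite comb1; apply: ZB.
Qed.

Lemma dimge0 (V : lmodType R) (Z B : set V) : dimge Z B 0.
Proof. by exists (fun=> 0); split=> [[]|c _ []]. Qed.

Lemma row_freeM p q n (A : 'M[k]_(p, q)) (C : 'M[k]_(q, n)) :
  row_free A -> row_free C -> row_free (A *m C).
Proof. by move=> fA fC; rewrite /row_free mxrankMfree. Qed.

(** Modulo [B] the elements have coordinate vectors of length [e]. A basis over k of the left kernel
    of the coordinate matrix, lifted to R, gives the relations: the coefficients that remain lie in
    the kernel of [pi]. *)
Lemma dimle_fg (V : lmodType R) (Z B : set V) e (g : 'I_e -> V) :
  submod B ->
  (forall r i, pi r = 0 -> B (r *: g i)) ->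
  (forall z, Z z -> exists c, B (z - \sum_i c i *: g i)) -> dimle Z B e.
Proof.
move=> BS mg Zg n x Zx.
have /choice [c cP] i := Zg _ (Zx i).
pose c' := \matrix_(i, j) c i j : 'M[R]_(n, e).
have [C CE] := map_mx_surj (row_base (kermx (map_mx pi c'))).
exists _, C; split.
- by rewrite mxrank_ker addnC -leq_subLR leq_sub2l // rank_leq_col.
- by rewrite CE row_base_free.
move=> i.
have -> : comb C x i = comb C (fun j => x j - \sum_l c j l *: g l) i +
   comb (C *m c') g i.
  rewrite combB combM -[LHS]addr0 -addrA; congr (_ + _).
  rewrite addrC -[LHS](subrr (comb C (fun j => \sum_l c j l *: g l) i)).
  congr (_ - _); rewrite /comb; apply: eq_bigr => j _; congr (_ *: _).
  by apply: eq_bigr => l _; rewrite mxE.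
apply: submod_D => //; first exact: submod_comb.
apply: submod_sum => // j _; apply: mg.
have : map_mx pi (C *m c') = 0.
  by rewrite map_mxM CE; apply/sub_kermxP; rewrite eq_row_base.
by move/matrixP/(_ i j); rewrite !mxE.
Qed.

(* A spanning family of minimal length is independent. *)
Lemma dim_basis (V : lmodType R) (Z B : set V) e (g : 'I_e -> V) :
  submod B -> (forall i, Z (g i)) ->
  (forall r z, pi r = 0 -> Z z -> B (r *: z)) ->
  (forall z, Z z -> exists c, B (z - \sum_i c i *: g i)) ->
  exists d (z : 'I_d -> V), [/\ forall i, Z (z i), indep B z &
    forall a, Z a -> exists c, B (a - \sum_i c i *: z i)].
Proof.
move=> BS; elim: e g => [|e IH] g Zg mZ span.
  by exists 0%N, g; split=> // c _ [].
case: (pselect (indep B g)) => [gi|]; first by exists e.+1, g.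
move=> /existsNP [c /not_implyP [Bc /existsNP [i0 /eqP ci0]]].
(* The coefficient of the relation at [i0] is invertible in k. A lift [b] of its inverse eliminates
   [g i0], up to a multiple that [mZ] kills. *)
have [b bE] := pi_surj (pi (c i0))^-1.
apply: (IH (fun i => g (lift i0 i))) => // z Zz.
have [a Ba] := span z Zz.
exists (fun i => a (lift i0 i) - a i0 * b * c (lift i0 i)).
have E (F : 'I_e.+1 -> V) : \sum_i F i = F i0 + \sum_i F (lift i0 i).
  exact: (bigD1_ord i0).
have -> : z - \sum_i (a (lift i0 i) - a i0 * b * c (lift i0 i)) *: g (lift i0 i)
  = (z - \sum_i a i *: g i) + (a i0 * b) *: (\sum_i c i *: g i) +
    (a i0 * (1 - b * c i0)) *: g i0.
  rewrite !E scalerDr; under eq_bigr do rewrite scalerBl -scalerA.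
  rewrite sumrB -scaler_sumr mulrBr mulr1 scalerBl scalerA mulrA !opprD opprK.
  rewrite !addrA.
  by rewrite [RHS](AC 7 (1*3*5*(2*6)*(4*7)))%AC /= addNr subrr !addr0.
apply: submod_D => //; first by apply: submod_D => //; apply: submod_Z.
by apply: mZ => //; rewrite rmorphM rmorphB rmorph1 rmorphM bE mulVf // subrr mulr0.
Qed.

End Dimension.

Section GradedIndices.
Variable v : nat -> nat.

Definition upto n : seq {i : nat & 'I_(v i)} :=
  [seq existT (fun i => 'I_(v i)) j a | j <- iota 0 n.+1, a <- enum 'I_(v j)].

Lemma mem_upto n t : (t \in upto n) = (tag t <= n)%N.
Proof.
apply/idP/idP => [/allpairsPdep [j [a [+ _ ->]]]|le]; first by rewrite mem_iota.
by case: t le => j a /= le; apply/allpairsPdep; exists j, a; rewrite mem_iota mem_enum.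
Qed.

Lemma uniq_upto n : uniq (upto n).
Proof.
apply: allpairs_uniq_dep => [|j _|]; rewrite ?iota_uniq ?enum_uniq //.
by move=> [j a] [j' a'] _ _ /= e; rewrite -[j]/(tag (existT (fun i => 'I_(v i)) j a)) e.
Qed.

Lemma sum_upto n (h : nat -> nat) :
  (\sum_(t <- upto n) h (tag t) = \sum_(j < n.+1) v j * h j)%N.
Proof.
rewrite big_allpairs_dep /= -(big_mkord xpredT (fun j => v j * h j)%N) /index_iota subn0.
by apply: eq_bigr => j _; rewrite big_const_seq count_predT size_enum_ord iter_addn_0 mulnC.
Qed.

End GradedIndices.

(** * Graded complexes and their tensor products *)

Section Complexes.
Variable R : comNzRingType.

(* All the homogeneous components [gr n] of a complex live in one module;
   nothing is required of the elements outside them. *)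
Record gcomplex := GComplex {
  gcar :> lmodType R;
  gr : nat -> set gcar;
  gd : gcar -> gcar;
  gdL : linear gd;
  grS : forall n, submod (gr n);
  gd_gr : forall n x, gr n.+1 x -> gr n (gd x);
  gd0 : forall x, gr 0%N x -> gd x = 0;
  gdd : forall n x, gr n x -> gd (gd x) = 0 }.

(** Degree [n] of the shifted complex, so that degree 0 of a mapping cone needs no separate
    treatment. *)
Definition pgr (X : gcomplex) (n : nat) : set X :=
  if n is n'.+1 then gr n' else [set 0].

Definition cyc (X : gcomplex) n : set X := [set x | gr n x /\ gd x = 0].
Definition bdr (X : gcomplex) n : set X := [set gd y | y in gr n.+1].

(** One map per degree leaves room for signs and projections that depend on the degree. *)
Definition mor (X Y : gcomplex) (f : nat -> X -> Y) : Prop :=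
  [/\ forall n, linear (f n), forall n x, gr n x -> gr n (f n x)
    & forall n x, gr n.+1 x -> gd (f n.+1 x) = f n (gd x)].

(* Acyclicity of the mapping cone of [f], spelled out. *)
Definition qis (X Y : gcomplex) (f : nat -> X -> Y) : Prop :=
  forall n x y, pgr n x -> gr n y -> gd x = 0 -> f n.-1 x = gd y ->
    exists x' y', [/\ gr n x', gr n.+1 y', gd x' = x & y = f n x' + gd y'].

Definition qiso (X Y : gcomplex) : Prop :=
  exists f : nat -> X -> Y, mor f /\ qis f.

Section Basics.
Variable X : gcomplex.
Implicit Types (x y : X).

Lemma gr0 n : gr n (0 : X). Proof. by case: (grS X n). Qed.

Lemma pgrS n : submod (@pgr X n).
Proof.
case: n => [|n]; last exact: grS.
by split=> //= a x y -> ->; rewrite scaler0 addr0.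
Qed.

Lemma gd_pgr n x : gr n x -> pgr n (gd x).
Proof. by case: n => [/gd0|n /gd_gr]. Qed.

Lemma cycS n : submod (@cyc X n).
Proof.
split=> [|a x y [gx dx] [gy dy]]; first by split; [exact: gr0 | exact: lin0 (@gdL _)].
by split; [case: (grS X n) => _; apply | rewrite gdL dx dy scaler0 addr0].
Qed.

Lemma bdrS n : submod (@bdr X n).
Proof.
split=> [|a x y [u gu <-] [v gv <-]].
  by exists 0; [exact: gr0 | exact: lin0 (@gdL _)].
by exists (a *: u + v); [case: (grS X n.+1) => _; apply | exact: gdL].
Qed.

Lemma bdr_cyc n x : bdr n x -> cyc n x.
Proof. by move=> [u gu <-]; split; [apply: gd_gr | apply: gdd gu]. Qed.

End Basics.

Lemma mor_gd (X Y : gcomplex) (f : nat -> X -> Y) n x :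
  mor f -> gr n x -> gd (f n x) = f n.-1 (gd x).
Proof.
move=> [fL fg fd]; case: n => [gx|n]; last exact: fd.
by rewrite (gd0 gx) (gd0 (fg _ _ gx)) (lin0 (fL _)).
Qed.

Lemma mor_pgr (X Y : gcomplex) (f : nat -> X -> Y) n x :
  mor f -> pgr n x -> pgr n (f n.-1 x).
Proof.
move=> [fL fg fd]; case: n => [/= ->|n]; [exact: lin0 (fL _) | exact: fg].
Qed.

Lemma mor_comp (X Y Z : gcomplex) (f : nat -> X -> Y) (g : nat -> Y -> Z) :
  mor f -> mor g -> mor (fun n x => g n (f n x)).
Proof.
move=> [fL fg fd] [gL gg gdd']; split=> [n a x y|n x gx|n x gx].
- by rewrite fL gL.
- exact/gg/fg.
- by rewrite gdd' ?fd //; apply: fg.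
Qed.

Lemma qis_comp (X Y Z : gcomplex) (f : nat -> X -> Y) (g : nat -> Y -> Z) :
  mor f -> mor g -> qis f -> qis g -> qis (fun n x => g n (f n x)).
Proof.
move=> fm gm qf qg n x z gx gz dx gfx.
have fm' := fm; have gm' := gm; case: fm' gm' => fL fg fd [gL gg gdg].
have dfx : gd (f n.-1 x) = 0.
  case: n gx {gz gfx} => [/= ->|n /= gx]; first by rewrite (lin0 (fL _)) (lin0 (@gdL _)).
  by rewrite (mor_gd fm gx) dx (lin0 (fL _)).
have [y [z' [gy gz' dy zE]]] := qg n _ _ (mor_pgr fm gx) gz dfx gfx.
have [x' [y' [gx' gy' dx' yE]]] := qf n _ _ gx gy dx (esym dy).
exists x', (g n.+1 y' + z'); split=> //.
  by apply: submod_D => //; [exact: grS | apply: gg].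
by rewrite zE yE (linD _ _ (gL _)) (linD _ _ (@gdL Z)) gdg // addrA.
Qed.

Lemma qiso_trans (X Y Z : gcomplex) : qiso X Y -> qiso Y Z -> qiso X Z.
Proof.
move=> [f [fm fq]] [g [gm gq]]; exists (fun n x => g n (f n x)).
by split; [apply: mor_comp | apply: qis_comp].
Qed.

Lemma qiso_refl (X : gcomplex) : qiso X X.
Proof.
exists (fun _ x => x); split=> // n x y gx gy dx xE.
by exists y, 0; split; rewrite ?(lin0 (@gdL _)) ?addr0 //; exact: gr0.
Qed.

Lemma bij_qis (X Y : gcomplex) (f : nat -> X -> Y) : mor f ->
  (forall n x, gr n x -> f n x = 0 -> x = 0) ->
  (forall n y, gr n y -> exists2 x, gr n x & f n x = y) -> qis f.
Proof.
move=> fm fi fs n x y gx gy dx xE; have [x' gx' x'E] := fs n y gy.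
have [fL _ _] := fm.
exists x', 0; split=> //; [exact: gr0 | | by rewrite x'E (lin0 (@gdL _)) addr0].
apply/eqP; rewrite -subr_eq0; apply/eqP.
have: f n.-1 (gd x' - x) = 0.
  by rewrite (linB _ _ (fL _)) xE -(mor_gd fm gx') x'E subrr.
have: pgr n (gd x' - x) by apply: submod_B => //; [exact: pgrS | apply: gd_pgr].
by case: n {gx gy xE gx' x'E} => [//|n] /= g /(fi _ _ g).
Qed.

Definition ses (X Y Z : gcomplex) (f : nat -> X -> Y) (g : nat -> Y -> Z) : Prop :=
  [/\ mor f, mor g, forall n x, gr n x -> f n x = 0 -> x = 0,
      forall n y, gr n y -> g n y = 0 <-> exists2 x, gr n x & y = f n x
    & forall n z, gr n z -> exists2 y, gr n y & g n y = z].

Definition sesq (X Y Z : gcomplex) : Prop :=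
  exists (f : nat -> X -> Y) (g : nat -> Y -> Z), ses f g.

(** Isomorphism in degrees at most [N]; it compares a complex with a step of an exhausting
    filtration that already contains all of low degree. *)
Definition agree (N : nat) (X Y : gcomplex) : Prop :=
  exists f : nat -> X -> Y, [/\ mor f,
    forall n x, (n <= N)%N -> gr n x -> f n x = 0 -> x = 0
  & forall n y, (n <= N)%N -> gr n y -> exists2 x, gr n x & f n x = y].

(** This makes [r] act as zero on homology, and unlike that property it passes to tensor products
    with free complexes. *)
Definition null_homotopic (r : R) (X : gcomplex) : Prop :=
  exists h : X -> X, [/\ linear h, forall n x, gr n x -> gr n.+1 (h x)
    & forall n x, gr n x -> gd (h x) + h (gd x) = r *: x].

Definition fin_gen (V : lmodType R) (P : set V) : Prop :=
  exists N (g : 'I_N -> V), (forall i, P (g i)) /\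
    forall x, P x -> exists c, x = \sum_i c i *: g i.

Definition modcx_subproof (M : lmodType R) : forall n, submod (fun x : M => n = 0%N \/ x = 0).
Proof.
move=> n; split=> [|a x y [->|->] [e|->]]; rewrite ?scaler0 ?addr0; by [right|left].
Qed.

Program Definition modcx (M : lmodType R) : gcomplex :=
  @GComplex M (fun n x => n = 0%N \/ x = 0) (fun=> 0) _ _ _ _ _.
Next Obligation. by move=> M a x y; rewrite scaler0 addr0. Qed.
Next Obligation. exact: modcx_subproof. Qed.
Next Obligation. by move=> M n x _; right. Qed.
Next Obligation. by []. Qed.
Next Obligation. by []. Qed.

Record fcomplex := FComplex {
  fcx :> free_complex R;
  fcxP : forall n, dmx fcx n.+1 *m dmx fcx n = 0 }.

Definition bas (F : free_complex R) := {i : nat & 'I_(rk F i)}.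

Section Tensor.
Variables (F : fcomplex) (X : gcomplex).

(** As [F] is free, F (x) X is a sum of shifts of [X] indexed by the basis of [F], and an element is
    its family of coordinates. *)
Definition tgr n : set (bas F -> X) :=
  [set x | forall t, if (tag t <= n)%N then gr (n - tag t) (x t) else x t = 0].

Definition tgd (x : bas F -> X) : bas F -> X := fun t =>
  \sum_a dmx F (tag t) a (tagged t) *: x (existT _ (tag t).+1 a) +
  (-1) ^+ tag t *: gd (x t).

Lemma tgdL : linear tgd.
Proof.
move=> a x y; apply/funext => t; rewrite /tgd /= gdL.
rewrite [RHS](_ : _ = a *: (\sum_i dmx F (tag t) i (tagged t) *:
    x (existT _ (tag t).+1 i) + (-1) ^+ tag t *: gd (x t)) +
  (\sum_i dmx F (tag t) i (tagged t) *: y (existT _ (tag t).+1 i) +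
   (-1) ^+ tag t *: gd (y t))) //.
rewrite [X in _ = X + _]scalerDr scaler_sumr [RHS]addrACA -big_split /=; congr (_ + _).
  by apply: eq_bigr => i _; rewrite [LHS]scalerDr !scalerA mulrC.
by rewrite !scalerDr !scalerA mulrC.
Qed.

Lemma tgrS n : submod (tgr n).
Proof.
split=> [|a x y gx gy] t; first by case: ifP => // _; apply: gr0.
have := gx t; have := gy t; case: ifP => _.
  by move=> g1 g2; case: (grS X (n - tag t)) => _; apply.
by move=> /= e1 e2; rewrite [LHS](_ : _ = a *: x t + y t) // e1 e2 scaler0 addr0.
Qed.

Lemma tgr_le n x t : tgr n x -> (tag t <= n)%N -> gr (n - tag t) (x t).
Proof. by move=> /(_ t); case: ifP. Qed.

Lemma tgr_gt n x t : tgr n x -> (n < tag t)%N -> x t = 0.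
Proof. by move=> gx lt; have := gx t; rewrite leqNgt lt. Qed.

Lemma tgd_gr n x : tgr n.+1 x -> tgr n (tgd x).
Proof.
move=> gx t; case: (leqP (tag t) n) => le; rewrite /tgd.
  apply: submod_D; first exact: grS.
    apply: submod_sum => [|i _]; first exact: grS.
    apply: submod_Z; first exact: grS.
    by have := @tgr_le _ _ (existT _ (tag t).+1 i) gx; apply.
  apply: submod_Z; first exact: grS.
  by apply: gd_gr; rewrite -subSn //; apply: tgr_le gx (leqW le).
rewrite big1 => [|i _]; last by rewrite (tgr_gt gx) ?scaler0.
rewrite add0r; suff -> : gd (x t) = 0 by rewrite scaler0.
move: le; rewrite leq_eqVlt => /orP[/eqP e|lt].
  by apply: gd0; have := @tgr_le _ _ t gx; rewrite -e subnn; apply.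
by rewrite (tgr_gt gx) // (lin0 (@gdL _)).
Qed.

Lemma tgd0 x : tgr 0 x -> tgd x = 0.
Proof.
move=> gx; apply/funext => t; rewrite /tgd big1 => [|i _]; last first.
  by rewrite (tgr_gt gx) ?scaler0.
rewrite add0r; suff -> : gd (x t) = 0 by rewrite scaler0.
case: (posnP (tag t)) => [e|lt]; last by rewrite (tgr_gt gx) // (lin0 (@gdL _)).
by apply: gd0; have := @tgr_le _ _ t gx; rewrite e subnn; apply.
Qed.

Lemma tgdd n x : tgr n x -> tgd (tgd x) = 0.
Proof.
move=> gx; apply/funext => t; rewrite {1}/tgd (linD _ _ (@gdL X)) (linZ _ _ (@gdL X)).
have -> : gd (gd (x t)) = 0.
  case: (leqP (tag t) n) => le; first exact: gdd (tgr_le gx le).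
  by rewrite (tgr_gt gx le) !(lin0 (@gdL _)).
rewrite scaler0 addr0 (lin_sum _ _ _ (@gdL X)).
under eq_bigr do rewrite /tgd /= scalerDr.
rewrite big_split /= -[RHS](addr0 0) -addrA; congr (_ + _).
  under eq_bigr do rewrite scaler_sumr.
  rewrite exchange_big big1 // => j _.
  under eq_bigr do rewrite scalerA mulrC.
  rewrite -scaler_suml.
  by have /matrixP/(_ j (tagged t)) := fcxP F (tag t); rewrite !mxE => ->; rewrite scale0r.
rewrite scaler_sumr -big_split big1 //= => i _.
rewrite (linZ _ _ (@gdL X)) !scalerA -scalerDl exprS mulN1r mulrN mulrC addNr.
by rewrite scale0r.
Qed.

Definition tens : gcomplex :=
  @GComplex _ tgr tgd tgdL tgrS tgd_gr tgd0 tgdd.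

End Tensor.

Lemma tens_modcx_gr F (N : lmodType R) n (x : tens F (modcx N)) t :
  gr n x -> tag t != n -> x t = 0.
Proof.
move=> /(_ t); case: ifP => // le + ne.
by case=> //; move/eqP; rewrite subn_eq0 => ge; case/eqP: ne; apply/eqP; rewrite eqn_leq le.
Qed.

Definition tmap F (X Y : gcomplex) (f : nat -> X -> Y) n :
  tens F X -> tens F Y := fun x t => f (n - tag t)%N (x t).

Lemma tmap_mor F (X Y : gcomplex) (f : nat -> X -> Y) :
  mor f -> mor (@tmap F X Y f).
Proof.
move=> fm; have [fL fg fd] := fm; split.
- by move=> n a x y; apply/funext => t; rewrite /tmap fL.
- move=> n x gx t; case: (leqP (tag t) n) => le; rewrite /tmap.
    exact/fg/tgr_le.
  by rewrite (tgr_gt gx le) (lin0 (fL _)).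
move=> n x gx; apply/funext => t; rewrite /= /tgd /tmap /=.
rewrite (linD _ _ (fL _)) (lin_sum _ _ _ (fL _)) (linZ _ _ (fL _)) subSS.
congr (_ + _ *: _); first by apply: eq_bigr => i _; rewrite (linZ _ _ (fL _)).
case: (leqP (tag t) n) => le.
  by rewrite subSn // fd // -subSn //; apply: tgr_le gx (leqW le).
have := gx t; case: ifP => [le'|_ ->]; last by rewrite !(lin0 (@gdL _)) !(lin0 (fL _)) (lin0 (@gdL _)).
have e : tag t = n.+1 by apply/eqP; rewrite eqn_leq le le'.
rewrite e subnn => g0; rewrite (gd0 g0) (gd0 (fg _ _ g0)).
by rewrite (lin0 (fL _)).
Qed.

Lemma tens_pgr F X n (x : tens F X) t :
  pgr n x -> if (tag t <= n)%N then pgr (n - tag t) (x t) else x t = 0.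
Proof.
case: n => [/= ->|n /= gx]; first by case: ifP => // _; case: (pgrS X (0 - tag t)).
case: (leqP (tag t) n) => [le|lt].
  by rewrite leqW // subSn //; apply: tgr_le gx le.
have xt := tgr_gt gx lt; case: ifP => // le.
by have -> : (n.+1 - tag t = 0)%N by apply/eqP; rewrite subn_eq0.
Qed.

(** Induction on a bound [p] for the F-degrees where [x] and [y] live. The differential of [F]
    lowers the F-degree, so the components of highest F-degree form, up to sign, a cycle of the
    mapping cone of [f]. Solving there and subtracting lowers the bound. *)
Lemma tmap_qis F (X Y : gcomplex) (f : nat -> X -> Y) :
  mor f -> qis f -> qis (@tmap F X Y f).
Proof.
move=> fm fq n; have [fL fg fd] := fm; have tm := tmap_mor F fm.
have [tL tg td] := tm.
suff H p (x : tens F X) (y : tens F Y) : pgr n x -> gr n y -> gd x = 0 ->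
    tmap f n.-1 x = gd y ->
    (forall t, (p <= tag t)%N -> x t = 0 /\ y t = 0) ->
    exists x' y', [/\ gr n x', gr n.+1 y', gd x' = x & y = tmap f n x' + gd y'].
  move=> x y gx gy dx xE; apply: (H n.+1) => // t lt.
  split; last exact: tgr_gt gy lt.
  by have := tens_pgr t gx; rewrite leqNgt lt.
elim: p x y => [|p IH] x y gx gy dx xE x0.
  have -> : x = 0 by apply/funext => t; have [] := x0 t isT.
  have -> : y = 0 by apply/funext => t; have [] := x0 t isT.
  exists 0, 0; split; [exact: gr0 | exact: gr0 | exact: lin0 (@gdL _) |].
  by rewrite (lin0 (tL _)) (lin0 (@gdL _)) addr0.
have top t : exists x'y' : X * Y, tag t = p -> (p <= n)%N ->
    [/\ gr (n - p) x'y'.1, gr (n - p).+1 x'y'.2, gd x'y'.1 = x t &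
        (-1) ^+ p *: y t = f (n - p)%N x'y'.1 + gd x'y'.2].
  case: (pselect (tag t = p /\ (p <= n)%N)) => [[tp le]|ne]; last first.
    by exists (0, 0) => *; case: ne.
  have := tens_pgr t gx; have := gy t; rewrite tp le => gyt gxt.
  have nxt a : x (existT _ (tag t).+1 a) = 0.
    by have [] := x0 (existT _ (tag t).+1 a) => //=; rewrite tp.
  have nyt a : y (existT _ (tag t).+1 a) = 0.
    by have [] := x0 (existT _ (tag t).+1 a) => //=; rewrite tp.
  have dxt : gd (x t) = 0.
    have /(congr1 (fun h => h t)) := dx; rewrite /= /tgd big1 => [|a _]; last first.
      by rewrite nxt scaler0.
    rewrite add0r => /(congr1 (fun z => (-1) ^+ tag t *: z)).
    by rewrite signZK [X in _ *: X](_ : _ = 0) // scaler0.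
  have fxt : f (n - p).-1 (x t) = gd ((-1) ^+ p *: y t).
    have /(congr1 (fun h => h t)) := xE; rewrite /= /tgd big1 => [|a _]; last first.
      by rewrite nyt scaler0.
    by rewrite add0r (linZ _ _ (@gdL _)) /tmap tp -!subn1 subnAC.
  have [x' [y' [? ? ? ?]]] := fq _ _ _ gxt (submod_sign _ (grS Y _) gyt) dxt fxt.
  by exists (x', y').
have /choice [z zP] := top.
(* The sign cancels the one with which the differential of [X] enters [tgd]. None is needed in [y'],
   because [top] was solved for [(-1) ^+ p *: y t]. *)
pose x' : tens F X := fun t => if (tag t == p) && (p <= n)%N then (-1) ^+ p *: (z t).1 else 0.
pose y' : tens F Y := fun t => if (tag t == p) && (p <= n)%N then (z t).2 else 0.
have gx' : gr n x'.
  move=> t; rewrite /x'; case: eqP => [e|_] /=; last first.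
    by case: ifP => // _; apply: gr0.
  rewrite e; case: (leqP p n) => // le; apply: submod_Z; first exact: grS.
  by have [? _ _ _] := zP t e le.
have gy' : gr n.+1 y'.
  move=> t; rewrite /y'; case: eqP => [e|_] /=; last first.
    by case: ifP => // _; apply: gr0.
  rewrite e; case: (leqP p n) => le; last by case: ifP => // _; apply: gr0.
  by rewrite leqW // subSn //; have [] := zP t e le.
have vx' (t : bas F) a : (p <= tag t)%N -> x' (existT _ (tag t).+1 a) = 0.
  by move=> le; rewrite /x' /= eqn_leq ltnNge le.
have vy' (t : bas F) a : (p <= tag t)%N -> y' (existT _ (tag t).+1 a) = 0.
  by move=> le; rewrite /y' /= eqn_leq ltnNge le.
have [|||||x1 [y1 [gx1 gy1 dx1 yE1]]] := IH (x - gd x') (y - tmap f n x' - gd y').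
- by apply: submod_B => //; [exact: pgrS | apply: gd_pgr].
- apply: (submod_B (@grS (tens F Y) n)); last exact: gd_gr gy'.
  exact: (submod_B (@grS (tens F Y) n) gy (tg _ _ gx')).
- by rewrite (linB _ _ (@gdL _)) dx (gdd gx') subrr.
- rewrite (linB _ _ (tL _)) !(linB _ _ (@gdL _)) (gdd gy') subr0.
  by rewrite (mor_gd tm gx') xE.
- move=> t le.
  have -> : (y - tmap f n x' - gd y') t = y t - tmap f n x' t - gd y' t by [].
  have -> : (x - gd x') t = x t - gd x' t by [].
  rewrite /= /tgd !big1 => [|a _|a _]; try by rewrite ?vx' ?vy' ?scaler0.
  rewrite !add0r /tmap.
  move: le; rewrite leq_eqVlt => /orP[/eqP e|lt]; last first.
    have [-> ->] := x0 t lt; rewrite /x' /y' gtn_eqF //=.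
    by rewrite !(lin0 (@gdL _)) (lin0 (fL _)) !scaler0 !subr0.
  have e' := esym e; rewrite /x' /y' e' eqxx /=; case: (leqP p n) => le.
    have [_ _ dE yE] := zP t e' le.
    rewrite (linZ _ _ (@gdL _)) (linZ _ _ (fL _)) signZK dE.
    by rewrite subrr -addrA -opprD -scalerDr -yE signZK subrr.
  have := tens_pgr t gx; rewrite e' leqNgt le /= => ->.
  rewrite (tgr_gt gy) ?e' //.
  by rewrite !(lin0 (@gdL _)) (lin0 (fL _)) !scaler0 !subr0.
exists (x' + x1), (y' + y1); split.
- exact: (submod_D (@grS (tens F X) n) gx' gx1).
- exact: (submod_D (@grS (tens F Y) n.+1) gy' gy1).
- by rewrite (linD _ _ (@gdL _)) dx1 addrC subrK.
- rewrite (linD _ _ (tL _)) (linD _ _ (@gdL _)) addrACA -yE1.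
  by rewrite -[X in _ = _ + X]addrA -opprD [RHS]addrC subrK.
Qed.

Lemma qiso_tens F X Y : qiso X Y -> qiso (tens F X) (tens F Y).
Proof.
by move=> [f [fm fq]]; exists (@tmap F X Y f); split; [apply: tmap_mor | apply: tmap_qis].
Qed.

End Complexes.

(** * Exactness, homotopies and finiteness under tensor products *)

Section TensorExactness.
Variable R : comNzRingType.

Lemma ses_tens F (X Y Z : gcomplex R) (f : nat -> X -> Y) (g : nat -> Y -> Z) :
  ses f g -> ses (@tmap R F X Y f) (@tmap R F Y Z g).
Proof.
move=> [fm gm fi fgx gs]; have [fL _ _] := fm; have [gL _ _] := gm.
split; [exact: tmap_mor | exact: tmap_mor | | |].
- move=> n x gx fx; apply/funext => t.
  have fxt : f (n - tag t)%N (x t) = 0 by have := congr1 (fun h => h t) fx.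
  by have := gx t; case: ifP => // _ /fi; apply.
- move=> n y gy; split=> [gy0|[x gx ->]]; last first.
    apply/funext => t; rewrite /tmap; case: (leqP (tag t) n) => le.
      have [_ fg _] := fm; have gxt := tgr_le gx le.
      by have [_ H] := fgx _ _ (fg _ _ gxt); apply: H; exists (x t).
    by rewrite (tgr_gt gx le) (lin0 (fL _)) (lin0 (gL _)).
  have /choice [x xP] t : exists x : X, if (tag t <= n)%N then
      gr (n - tag t) x /\ y t = f (n - tag t)%N x else x = 0.
    case: (leqP (tag t) n) => le; last by exists 0.
    have gyt : g (n - tag t)%N (y t) = 0 by have := congr1 (fun h => h t) gy0.
    by have /fgx [/(_ gyt) [x gx xE] _] := tgr_le gy le; exists x.
  exists x; first by move=> t; have := xP t; case: ifP => // _ [].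
  apply/funext => t; have := xP t; rewrite /tmap; case: ifP => [_ [] //|le ->].
  by rewrite (lin0 (fL _)) (tgr_gt gy) // ltnNge le.
move=> n z gz.
have /choice [y yP] t : exists y : Y, if (tag t <= n)%N then
    gr (n - tag t) y /\ g (n - tag t)%N y = z t else y = 0.
  case: (leqP (tag t) n) => le; last by exists 0.
  by have [y gy yE] := gs _ _ (tgr_le gz le); exists y.
exists y; first by move=> t; have := yP t; case: ifP => // _ [].
apply/funext => t; have := yP t; rewrite /tmap; case: ifP => [_ [] //|le ->].
by rewrite (lin0 (gL _)) (tgr_gt gz) // ltnNge le.
Qed.

Lemma sesq_tens F (X Y Z : gcomplex R) :
  sesq X Y Z -> sesq (tens F X) (tens F Y) (tens F Z).
Proof. by move=> [f [g fgs]]; do 2 eexists; apply: ses_tens fgs. Qed.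

Lemma agree_tens F N (X Y : gcomplex R) :
  agree N X Y -> agree N (tens F X) (tens F Y).
Proof.
move=> [f [fm fi fs]]; have [fL _ _] := fm.
exists (@tmap R F X Y f); split; first exact: tmap_mor.
- move=> n x nN gx fx; apply/funext => t.
  have fxt : f (n - tag t)%N (x t) = 0 by have := congr1 (fun h => h t) fx.
  have := gx t; case: ifP => // _ g0; apply: fi g0 fxt.
  exact: leq_trans (leq_subr _ _) nN.
move=> n y nN gy.
have /choice [x xP] t : exists x : X, if (tag t <= n)%N then
    gr (n - tag t) x /\ f (n - tag t)%N x = y t else x = 0.
  case: (leqP (tag t) n) => le; last by exists 0.
  have [|x gx xE] := fs (n - tag t)%N (y t) _ (tgr_le gy le); last by exists x.
  exact: leq_trans (leq_subr _ _) nN.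
exists x; first by move=> t; have := xP t; case: ifP => // _ [].
apply/funext => t; have := xP t; rewrite /tmap; case: ifP => [_ [] //|le ->].
by rewrite (lin0 (fL _)) (tgr_gt gy) // ltnNge le.
Qed.

Lemma null_homotopic_tens F r (X : gcomplex R) :
  null_homotopic r X -> null_homotopic r (tens F X).
Proof.
move=> [h [hL hg hd]].
exists (fun x t => (-1) ^+ tag t *: h (x t)); split.
- move=> a x y; apply/funext => t; rewrite /= hL scalerDr.
  by rewrite [RHS](_ : _ = a *: ((-1) ^+ tag t *: h (x t)) +
       (-1) ^+ tag t *: h (y t)) // !scalerA mulrC.
- move=> n x gx t; case: (leqP (tag t) n) => le.
    by rewrite leqW // subSn //; apply: submod_Z; [exact: grS|apply: hg; apply: tgr_le gx le].
  rewrite (tgr_gt gx le) (lin0 hL) scaler0; case: ifP => // _; exact: gr0.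
move=> n x gx; apply/funext => t.
rewrite [LHS](_ : _ = tgd (fun t => (-1) ^+ tag t *: h (x t)) t +
  (-1) ^+ tag t *: h (tgd x t)) // [RHS](_ : _ = r *: x t) //.
rewrite /tgd /= (linD _ _ hL) (lin_sum _ _ _ hL) (linZ _ _ hL) (linZ _ _ (@gdL _ _)).
rewrite scalerDr !signZK addrACA.
have -> : gd (h (x t)) + h (gd (x t)) = r *: x t.
  case: (leqP (tag t) n) => le; first exact: hd (tgr_le gx le).
  by rewrite (tgr_gt gx le) (lin0 hL) !(lin0 (@gdL _ _)) (lin0 hL) scaler0 addr0.
rewrite scaler_sumr -big_split big1 ?add0r //= => i _.
rewrite (linZ _ _ hL) !scalerA -scalerDl exprS mulN1r mulrN mulrC addNr.
by rewrite scale0r.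
Qed.

Lemma fin_gen_tens F (X : gcomplex R) :
  (forall n, fin_gen (@gr R X n)) -> forall n, fin_gen (@gr R (tens F X) n).
Proof.
move=> fgX n.
suff [N [g [gg gP]]] : exists N (g : 'I_N -> tens F X), (forall i, gr n (g i)) /\
    forall x : tens F X, gr n x -> exists c, x = \sum_i c i *: g i.
  by exists N, g.
have tsP t : (tag t <= n)%N -> t \in upto (rk F) n by rewrite mem_upto.
suff: exists N (g : 'I_N -> tens F X), (forall i, gr n (g i)) /\
    forall x : tens F X, gr n x -> exists c, forall t, t \in upto (rk F) n -> x t = \sum_i c i *: g i t.
  move=> [N [g [gg gP]]]; exists N, g; split=> // x gx.
  have [c cP] := gP x gx; exists c; apply/funext => t; rewrite fct_sumE.
  case: (leqP (tag t) n) => le; first exact: cP (tsP t le).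
  by rewrite (tgr_gt gx le) big1 // => i _; rewrite [_ t](_ : _ = c i *: g i t) // (tgr_gt (gg i) le) scaler0.
have : forall t, t \in upto (rk F) n -> (tag t <= n)%N by move=> t; rewrite mem_upto.
elim: (upto _ _) {tsP} => [|t ts IH] tsn; first by exists 0%N, (fun=> 0); split=> [[]|x _] //; exists (fun=> 0).
have [|N [g [gg gP]]] := IH; first by move=> s sts; apply: tsn; rewrite inE sts orbT.
have [t_ts|t_ts] := boolP (t \in ts).
  exists N, g; split=> // x /gP [c cP]; exists c => s.
  by rewrite inE => /orP[/eqP ->|]; apply: cP.
have le : (tag t <= n)%N by apply: tsn; rewrite inE eqxx.
have [N' [g' [gg' gP']]] := fgX (n - tag t)%N.
pose h i : tens F X := match fintype.split i with
  | inl i => fun s => if s == t then 0 else g i s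
  | inr i => fun s => if s == t then g' i else 0 end.
exists (N + N')%N, h; split=> [i|x gx].
  rewrite /h; case: fintype.split => j s; case: eqP => [->|_].
  - by rewrite le; apply: gr0.
  - exact: gg.
  - by rewrite le.
  - by case: ifP => // _; apply: gr0.
have [c cP] := gP x gx; have [c' cP'] := gP' _ (tgr_le gx le).
exists (fun i => match fintype.split i with inl i => c i | inr i => c' i end) => s.
rewrite big_split_ord /= /h.
under eq_bigr do rewrite (unsplitK (inl _)).
under [X in _ -> _ = _ + X]eq_bigr do rewrite (unsplitK (inr _)).
rewrite inE; case: eqP => [->|ne] /= sts.
  by rewrite big1 ?add0r // => i _; rewrite scaler0.
rewrite [X in _ + X]big1 ?addr0; first exact: cP.
by move=> i _; rewrite scaler0.
Qed.

End TensorExactness.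

(** * Bounds for homology and the long exact sequence *)

Section HomologyDimension.
Variables (R : comNzRingType) (k : fieldType) (pi : {rmorphism R -> k}).
Hypothesis pi_surj : forall y, exists x, pi x = y.
Implicit Types X Y Z : gcomplex R.

Definition hle X n e := dimle pi (@cyc R X n) (@bdr R X n) e.
Definition hge X n d := dimge pi (@cyc R X n) (@bdr R X n) d.

Section Qis.
Variables (X Y : gcomplex R) (f : nat -> X -> Y).
Hypotheses (fm : mor f) (fq : qis f).

Let fL n : linear (f n). Proof. by case: fm. Qed.

Lemma mor_cyc n x : cyc n x -> cyc n (f n x).
Proof.
move=> [gx dx]; split; first by case: fm => _ fg _; apply: fg.
by rewrite (mor_gd fm gx) dx (lin0 (fL _)).
Qed.

Lemma mor_bdr n x : bdr n x -> bdr n (f n x).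
Proof.
move=> [u gu <-]; exists (f n.+1 u); first by case: fm => _ fg _; apply: fg.
by case: fm => _ _; apply.
Qed.

Lemma qis_inj n x : cyc n x -> bdr n (f n x) -> bdr n x.
Proof.
move=> [gx dx] [y gy yE]; have [x' [_ [gx' _ xE _]]] := @fq n.+1 x y gx gy dx (esym yE).
by exists x'.
Qed.

Lemma qis_surj n y : cyc n y -> exists2 x, cyc n x & bdr n (y - f n x).
Proof.
move=> [gy dy]; have [||x [y' [gx gy' dx yE]]] := fq (submod0 (@pgrS R X n)) gy.
- exact: lin0 (@gdL _ _).
- by rewrite dy (lin0 (fL _)).
by exists x => //; exists y' => //; rewrite yE addrC addKr.
Qed.

Lemma hle_qis_r n e : hle X n e -> hle Y n e.
Proof.
move=> H N y Zy; have /choice [x xP] i : exists x, cyc n x /\ bdr n (y i - f n x).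
  by have [x] := qis_surj (Zy i); exists x.
have [p [C [le fr BC]]] := H N x (fun i => (xP i).1); exists p, C; split=> // i.
have -> : comb C y i = comb C (fun j => y j - f n (x j)) i + f n (comb C x i).
  by rewrite combB (lin_comb _ _ _ (fL n)) subrK.
apply: submod_D; [exact: bdrS | | exact: mor_bdr].
by apply: submod_comb => [|j]; [exact: bdrS | case: (xP j)].
Qed.

Lemma hle_qis_l n e : hle Y n e -> hle X n e.
Proof.
move=> H N x Zx; have [p [C [le fr BC]]] := H N (fun i => f n (x i)) (fun i => mor_cyc (Zx i)).
exists p, C; split=> // i; apply: qis_inj; last by rewrite (lin_comb _ _ _ (fL _)).
by apply: submod_comb => //; exact: cycS.
Qed.

Lemma hge_qis_r n d : hge X n d -> hge Y n d.
Proof.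
move=> [x [Zx xi]]; exists (fun i => f n (x i)); split=> [i|c Bc]; first exact: mor_cyc.
apply: xi; apply: qis_inj; last first.
  by rewrite (lin_sum _ _ _ (fL n)); under eq_bigr do rewrite (linZ _ _ (fL n)).
by apply: submod_sum => [|i _]; [|apply: submod_Z]; try exact: cycS.
Qed.

Lemma hge_qis_l n d : hge Y n d -> hge X n d.
Proof.
move=> [y [Zy yi]]; have /choice [x xP] i : exists x, cyc n x /\ bdr n (y i - f n x).
  by have [x] := qis_surj (Zy i); exists x.
exists x; split=> [i|c Bc]; first by case: (xP i).
apply: yi.
have -> : \sum_i c i *: y i = \sum_i c i *: (y i - f n (x i)) + f n (\sum_i c i *: x i).
  rewrite (lin_sum _ _ _ (fL n)) -big_split; apply: eq_bigr => i _.
  by rewrite (linZ _ _ (fL n)) /= -scalerDr subrK.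
apply: submod_D; [exact: bdrS | | exact: mor_bdr].
by apply: submod_sum => [|i _]; [|apply: submod_Z; last by case: (xP i)]; exact: bdrS.
Qed.

End Qis.

Lemma hle_qiso X Y n e : qiso X Y -> hle X n e <-> hle Y n e.
Proof.
by move=> [f [fm fq]]; split; [apply: hle_qis_r fm fq _ _ | apply: hle_qis_l fm fq _ _].
Qed.

Lemma hge_qiso X Y n e : qiso X Y -> hge X n e <-> hge Y n e.
Proof.
by move=> [f [fm fq]]; split; [apply: hge_qis_r fm fq _ _ | apply: hge_qis_l fm fq _ _].
Qed.

Lemma hle_agree N X Y n e : agree N X Y -> (n < N)%N -> hle X n e -> hle Y n e.
Proof.
move=> [f [fm fi fs]] nN H M y Zy; have fm' := fm; case: fm' => fL fg fd.
have /choice [x xP] i : exists x, cyc n x /\ f n x = y i.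
  have [gy dy] := Zy i; have [x gx xE] := fs n (y i) (ltnW nN) gy.
  exists x; split=> //; split=> //.
  have : pgr n (gd x) by apply: gd_pgr.
  have : f n.-1 (gd x) = 0 by rewrite -(mor_gd fm gx) xE.
  case: n nN H Zy gx xE gy => [|n] nN H Zy gx xE gy //= fx gdx.
  by apply: fi gdx fx; apply: ltnW; apply: ltnW.
have [p [C [le fr BC]]] := H M x (fun i => (xP i).1); exists p, C; split=> // i.
have -> : y = fun i => f n (x i) by apply/funext => j; case: (xP j).
by rewrite -(lin_comb _ _ _ (fL _)); apply: mor_bdr.
Qed.

Section Ses.
Variables (X Y Z : gcomplex R) (f : nat -> X -> Y) (g : nat -> Y -> Z).
Hypothesis fgs : ses f g.

Let fm : mor f. Proof. by case: fgs. Qed.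
Let gm : mor g. Proof. by case: fgs. Qed.
Let fL n : linear (f n). Proof. by case: fm. Qed.
Let gL n : linear (g n). Proof. by case: gm. Qed.
Let fg n x : gr n x -> gr n (f n x). Proof. by case: fm => _ + _; apply. Qed.
Let gg n x : gr n x -> gr n (g n x). Proof. by case: gm => _ + _; apply. Qed.
Let fi n x : gr n x -> f n x = 0 -> x = 0. Proof. by case: fgs => _ _ + _ _; apply. Qed.
Let gker n y : gr n y -> g n y = 0 -> exists2 x, gr n x & y = f n x.
Proof. by move=> gy; case: fgs => _ _ _ /(_ n y gy) [+ _] _; apply. Qed.
Let gf0 n x : gr n x -> g n (f n x) = 0.
Proof.
by move=> gx; case: fgs => _ _ _ /(_ n _ (fg gx)) [_ +] _; apply; exists x.
Qed.
Let gs n z : gr n z -> exists y, gr n y /\ g n y = z.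
Proof. by case: fgs => _ _ _ _ /(_ n z) H /H [y]; exists y. Qed.

Let gcomb (W : gcomplex R) n N p (C : 'M[R]_(p, N)) (x : 'I_N -> W) i :
  (forall j, gr n (x j)) -> gr n (comb C x i).
Proof. by move=> gx; apply: submod_comb => //; exact: grS. Qed.

Let finj n x x' : gr n x -> gr n x' -> f n x = f n x' -> x = x'.
Proof.
move=> gx gx' e; apply/eqP; rewrite -subr_eq0; apply/eqP.
have gB := submod_B (@grS _ X n) gx gx'.
by apply: fi gB _; rewrite linB // e subrr.
Qed.

Let bdrE (W : gcomplex R) n N (x : 'I_N -> W) : (forall i, bdr n (x i)) ->
  exists u : 'I_N -> W, forall i, gr n.+1 (u i) /\ gd (u i) = x i.
Proof.
move=> bx; have /choice [u uP] i : exists u, gr n.+1 u /\ gd u = x i.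
  by case: (bx i) => u; exists u.
by exists u.
Qed.

(** This and the next three bounds are what the long exact homology sequence yields. In general,
    relations [C] found in one homology produce, by lifting along the sequence, cycles for another;
    relations [D] among those combine to [D *m C], which still has full rank over k. No connecting
    map has to be defined. *)
Lemma hle_ses n e e' : hle X n e -> hle Z n e' -> hle Y n (e + e').
Proof.
move=> HX HZ N y Zy.
have [p [C [le fr /bdrE [z zP]]]] := HZ N (fun i => g n (y i)) (fun i => mor_cyc gm (Zy i)).
have [y' yP] := choice (fun i => gs (zP i).1).
have gy i : gr n (comb C y i) by apply: gcomb => j; case: (Zy j).
have gdy i : gr n (gd (y' i)) by apply: gd_gr; case: (yP i).
have /choice [x xP] i : exists x, gr n x /\ comb C y i - gd (y' i) = f n x.
  have [||x gx xE] := gker (y := comb C y i - gd (y' i)) (n := n); last by exists x.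
    exact: (submod_B (@grS _ Y n)).
  rewrite (linB _ _ (gL _)) (lin_comb _ _ _ (gL _)) -(zP i).2 -(yP i).2.
  have [gy' _] := yP i; have [_ _ gd_g] := gm.
  by rewrite gd_g // subrr.
have Zx i : cyc n (x i).
  have [gx xE] := xP i; split=> //.
  have : pgr n (gd (x i)) by apply: gd_pgr.
  have : f n.-1 (gd (x i)) = 0.
    rewrite -(mor_gd fm gx) -xE (linB _ _ (@gdL _ _)) (lin_comb _ _ _ (@gdL _ _)).
    rewrite (gdd (yP i).1) subr0 /comb big1 // => j _.
    by have [_ ->] := Zy j; rewrite scaler0.
  by case: (n) => [//|n'] /= fx gdx; apply: fi gdx fx.
have [q [D [le' fr' BD]]] := HX p x Zx.
exists q, (D *m C); split.
- by rewrite addnA; apply: leq_trans le _; rewrite leq_add2r.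
- by rewrite map_mxM; apply: row_freeM.
move=> i; rewrite combM.
have -> : comb D (comb C y) i =
    f n (comb D x i) + comb D (fun j => gd (y' j)) i.
  rewrite (lin_comb _ _ _ (fL _)) /comb -big_split; apply: eq_bigr => j _ /=.
  by rewrite -scalerDr -(xP j).2 subrK.
apply: submod_D; [exact: bdrS | exact: (mor_bdr fm) |].
apply: submod_comb => [|j]; [exact: bdrS | by exists (y' j) => //; case: (yP j)].
Qed.

Lemma hle_quotient0 e : hle Y 0 e -> hle Z 0 e.
Proof.
move=> HY N z Zz.
have [y yP] := choice (fun i => gs (Zz i).1).
have Zy i : cyc 0 (y i) by split; [case: (yP i) | apply: gd0; case: (yP i)].
have [p [C [le fr BC]]] := HY N y Zy; exists p, C; split=> // i.
have -> : z = fun i => g 0%N (y i) by apply/funext => j; case: (yP j).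
by rewrite -(lin_comb _ _ _ (gL _)); apply: mor_bdr.
Qed.

Lemma hle_quotientS n e e' : hle Y n.+1 e -> hle X n e' -> hle Z n.+1 (e + e').
Proof.
move=> HY HX N z Zz.
have [y yP] := choice (fun i => gs (Zz i).1).
(* [x i] represents the image of the class of [z i] under the connecting map. *)
have /choice [x xP] i : exists x, gr n x /\ gd (y i) = f n x.
  have [||x gx xE] := gker (y := gd (y i)) (n := n); last by exists x.
    by apply: gd_gr; case: (yP i).
  have [_ _ gd_g] := gm; rewrite -gd_g; last by case: (yP i).
  by rewrite (yP i).2; case: (Zz i).
have Zx i : cyc n (x i).
  have [gx xE] := xP i; split=> //.
  have : pgr n (gd (x i)) by apply: gd_pgr.
  have : f n.-1 (gd (x i)) = 0.
    by rewrite -(mor_gd fm gx) -xE (gdd (yP i).1).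
  by case: (n) => [//|n'] /= fx gdx; apply: fi gdx fx.
have [p [C [le fr /bdrE [x' x'P]]]] := HX N x Zx.
pose w i := comb C y i - f n.+1 (x' i).
have gy i : gr n.+1 (comb C y i) by apply: gcomb => j; case: (yP j).
have gfx i : gr n.+1 (f n.+1 (x' i)) by apply: fg; case: (x'P i).
have Zw i : cyc n.+1 (w i).
  split; first exact: (submod_B (@grS _ Y _)).
  have [_ _ fd] := fm.
  rewrite /w (linB _ _ (@gdL _ _)) fd; last by case: (x'P i).
  rewrite (x'P i).2 (lin_comb _ _ _ (@gdL _ _)) (lin_comb _ _ _ (fL _)).
  by apply/eqP; rewrite subr_eq0; apply/eqP/eq_bigr => j _; rewrite (xP j).2.
have [q [D [le' fr' /bdrE [u uP]]]] := HY p w Zw.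
exists q, (D *m C); split.
- by rewrite addnA; apply: leq_trans le _; rewrite leq_add2r.
- by rewrite map_mxM; apply: row_freeM.
move=> i; rewrite combM; exists (g n.+2 (u i)); first by apply: gg; case: (uP i).
have [_ _ gd_g] := gm; rewrite gd_g; last by case: (uP i).
rewrite (uP i).2 (lin_comb _ _ _ (gL _)); apply: eq_bigr => j _; congr (_ *: _).
rewrite (linB _ _ (gL _)) gf0 ?subr0; last by case: (x'P j).
by rewrite (lin_comb _ _ _ (gL _)); apply: eq_bigr => l _; rewrite (yP l).2.
Qed.

Lemma hle_sub n e e' : hle Y n e -> hle Z n.+1 e' -> hle X n (e + e').
Proof.
move=> HY HZ N x Zx.
have [p [C [le fr /bdrE [y yP]]]] := HY N (fun i => f n (x i)) (fun i => mor_cyc fm (Zx i)).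
have gCx i : gr n (comb C x i) by apply: gcomb => j; case: (Zx j).
have Zgy i : cyc n.+1 (g n.+1 (y i)).
  split; first by apply: gg; case: (yP i).
  have [_ _ gd_g] := gm; rewrite gd_g; last by case: (yP i).
  by rewrite (yP i).2 -(lin_comb _ _ _ (fL _)) gf0.
have [q [D [le' fr' /bdrE [z zP]]]] := HZ p _ Zgy.
exists q, (D *m C); split.
- by rewrite [(e + e')%N]addnC addnA; apply: leq_trans le _; rewrite leq_add2r.
- by rewrite map_mxM; apply: row_freeM.
have [y' y'P] := choice (fun i => gs (zP i).1).
move=> i; rewrite combM.
have gDy : gr n.+1 (comb D y i) by apply: gcomb => j; case: (yP j).
have gy' : gr n.+1 (gd (y' i)) by apply: gd_gr; case: (y'P i).
have [||x' gx' x'E] := gker (y := comb D y i - gd (y' i)) (n := n.+1).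
- exact: (submod_B (@grS _ Y _)).
- have [_ _ gd_g] := gm.
  rewrite (linB _ _ (gL _)) -gd_g; last by case: (y'P i).
  by rewrite (y'P i).2 (zP i).2 (lin_comb _ _ _ (gL _)) subrr.
exists x' => //; apply: (@finj n); [exact: gd_gr gx' | exact: gcomb |].
have [_ _ fd] := fm; rewrite -fd // -x'E (linB _ _ (@gdL _ _)) (gdd (y'P i).1) subr0.
rewrite (lin_comb _ _ _ (@gdL _ _)) (lin_comb _ _ _ (fL _)).
by apply: eq_bigr => j _; rewrite (yP j).2 (lin_comb _ _ _ (fL _)).
Qed.

End Ses.
End HomologyDimension.

(** * Direct sums of shifts of a complex *)

Section ZeroDifferential.
Variables (R : comNzRingType) (k : fieldType) (pi : {rmorphism R -> k}).
Hypothesis pi_surj : forall y, exists x, pi x = y.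

(** Tensoring with it forms a direct sum of shifted copies, [v n] of them shifted by [n]. *)
Program Definition zd (v : nat -> nat) : fcomplex R :=
  @FComplex R (@FreeComplex R v (fun=> 0)) _.
Next Obligation. by move=> v n; rewrite mul0mx. Qed.

Lemma zd_gd v (X : gcomplex R) (x : tens (zd v) X) t :
  gd x t = (-1) ^+ tag t *: gd (x t).
Proof.
by rewrite /= /tgd big1 ?add0r // => i _; rewrite mxE scale0r.
Qed.

Lemma zd_cyc v (X : gcomplex R) n (x : tens (zd v) X) t :
  cyc n x -> (tag t <= n)%N -> cyc (n - tag t) (x t).
Proof.
move=> [gx dx] le; split; first exact: tgr_le gx le.
have /(congr1 (fun h => (-1) ^+ tag t *: h t)) := dx.
by rewrite zd_gd signZK => ->; rewrite scaler0.
Qed.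

Lemma zd_bdr v (X : gcomplex R) n (x : tens (zd v) X) t :
  bdr n x -> (tag t <= n)%N -> bdr (n - tag t) (x t).
Proof.
move=> [u gu <-] le; rewrite zd_gd; apply: submod_Z; first exact: bdrS.
by exists (u t) => //; rewrite -subSn //; apply: tgr_le gu (leqW le).
Qed.

(** Relations are found one summand at a time and multiplied. The bound is required only where [v j]
    is nonzero, so that finitely many shifts preserve vanishing in high degrees. *)
Lemma hle_zd v (X : gcomplex R) n (h : nat -> nat) :
  (forall j, (j <= n)%N -> (0 < v j)%N -> hle pi X (n - j) (h (n - j)%N)) ->
  hle pi (tens (zd v) X) n (\sum_(j < n.+1) v j * h (n - j)).
Proof.
move=> hX N x Zx.
rewrite -(sum_upto v n (fun j => h (n - j)%N)).
suff: exists p (C : 'M[R]_(p, N)),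
   [/\ (N <= p + \sum_(t <- upto v n) h (n - tag t))%N, row_free (map_mx pi C)
     & forall i t, t \in upto v n -> bdr (n - tag t) (comb C x i t)].
  move=> [p [C [le fr BC]]]; exists p, C; split=> // i.
  have /choice [u uP] t : exists u : X, if (tag t <= n)%N then
      gr (n - tag t).+1 u /\ gd u = comb C x i t else u = 0.
    case: (leqP (tag t) n) => le'; last by exists 0.
    by have [|u] := BC i t; [rewrite mem_upto | exists u].
  exists (fun t => (-1) ^+ tag t *: u t).
    move=> t; have := uP t; case: (leqP (tag t) n) => [le' [gu _]|lt ->].
      by rewrite leqW // subSn //; apply: submod_Z => //; apply: grS.
    by rewrite scaler0; case: ifP => // _; apply: gr0.
  apply/funext => t; rewrite zd_gd (linZ _ _ (@gdL _ X)) signZK.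
  have := uP t; case: (leqP (tag t) n) => [le' [] //|lt ->].
  rewrite (lin0 (@gdL _ X)) (_ : comb C x i t = \sum_j C i j *: x j t); last first.
    by rewrite /comb fct_sumE.
  by rewrite big1 // => j _; have [gx _] := Zx j; rewrite (tgr_gt gx lt) scaler0.
have : forall t, t \in upto v n -> (tag t <= n)%N by move=> t; rewrite mem_upto.
elim: (upto v n) => [|t ts IH] tsn.
  exists N, 1%:M; rewrite big_nil addn0; split=> //.
  by rewrite map_mx1 row_free_unit unitmx1.
have [|p [C [le fr BC]]] := IH; first by move=> s sts; apply: tsn; rewrite inE sts orbT.
have le_t : (tag t <= n)%N by apply: tsn; rewrite inE eqxx.
have Zt i : cyc (n - tag t) (comb C x i t).
  apply: zd_cyc => //; apply: submod_comb => //; exact: cycS.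
have v0 : (0 < v (tag t))%N by case: (t) => j [a /= lt]; apply: leq_ltn_trans lt.
have [q [D [le' fr' BD]]] := hX _ le_t v0 p (fun i => comb C x i t) Zt.
exists q, (D *m C); split.
- rewrite big_cons addnA; apply: leq_trans le _; rewrite leq_add2r //.
- by rewrite map_mxM; apply: row_freeM.
move=> i s; rewrite combM.
have -> : comb D (comb C x) i s = comb D (fun j => comb C x j s) i by rewrite /comb fct_sumE.
rewrite inE => /orP[/eqP -> //|sts].
by apply: submod_comb => [|j]; [exact: bdrS | exact: BC].
Qed.

Lemma hge_zd v (X : gcomplex R) n (h : nat -> nat) :
  (forall i, (i <= n)%N -> hge pi X i (h i)) ->
  hge pi (tens (zd v) X) n (\sum_(j < n.+1) v j * h (n - j)).
Proof.
move=> hX; rewrite -(sum_upto v n (fun j => h (n - j)%N)).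
suff: exists x : 'I_(\sum_(t <- upto v n) h (n - tag t)) -> tens (zd v) X,
    (forall i, cyc n (x i)) /\ forall c, (forall t, t \in upto v n ->
      bdr (n - tag t) (\sum_i c i *: x i t)) -> forall i, pi (c i) = 0.
  move=> [x [Zx xi]]; exists x; split=> // c Bc; apply: xi => t; rewrite mem_upto => le.
  by have := zd_bdr Bc le; rewrite fct_sumE.
have := uniq_upto v n.
have : forall t, t \in upto v n -> (tag t <= n)%N by move=> t; rewrite mem_upto.
elim: (upto v n) => [|t ts IH] tsn.
  by move=> _; rewrite big_nil; exists (fun=> 0); split=> [[]|c _ []].
rewrite [uniq _]/= => /andP[t_ts uts].
have [||x [Zx xi]] := IH => //; first by move=> s sts; apply: tsn; rewrite inE sts orbT.
have le : (tag t <= n)%N by apply: tsn; rewrite inE eqxx.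
have [z [Zz zi]] := hX _ (leq_subr (tag t) n).
rewrite big_cons.
pose y i : tens (zd v) X := match fintype.split i with
  | inl i => fun s => if s == t then z i else 0
  | inr i => fun s => if s == t then 0 else x i s end.
exists y; split=> [i|c Bc].
  rewrite /y; case: fintype.split => j; split.
  - move=> s; case: eqP => [->|_]; first by rewrite le; case: (Zz j).
    by case: ifP => // _; apply: gr0.
  - apply/funext => s; rewrite zd_gd; case: eqP => [->|_].
      by have [_ ->] := Zz j; rewrite scaler0.
    by rewrite (lin0 (@gdL _ X)) scaler0.
  - move=> s; case: eqP => [->|_]; first by rewrite le; apply: gr0.
    by have [gx _] := Zx j; apply: gx.
  apply/funext => s; rewrite zd_gd; case: eqP => [_|_].
    by rewrite (lin0 (@gdL _ X)) scaler0.
  by have [_ /(congr1 (fun h => h s))] := Zx j; rewrite zd_gd.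
have E s : \sum_i c i *: y i s = \sum_i c (lshift _ i) *: (if s == t then z i else 0) +
    \sum_i c (rshift _ i) *: (if s == t then 0 else x i s).
  rewrite big_split_ord /= /y; congr (_ + _); apply: eq_bigr => i _.
    by rewrite (unsplitK (inl _)).
  by rewrite (unsplitK (inr _)).
have zc : forall i, pi (c (lshift _ i)) = 0.
  apply: (zi (fun i => c (lshift _ i))); have := Bc t; rewrite E eqxx inE eqxx.
  by rewrite [X in _ + X]big1 ?addr0; [apply | move=> i _; rewrite scaler0].
have xc : forall i, pi (c (rshift _ i)) = 0.
  apply: (xi (fun i => c (rshift _ i))) => s sts.
  have := Bc s; rewrite E inE sts orbT.
  have -> : (s == t) = false by apply: contraNF t_ts => /eqP <-.
  by rewrite [X in X + _]big1 ?add0r; [apply | move=> i _; rewrite scaler0].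
by move=> i; rewrite -(splitK i); case: fintype.split.
Qed.

(** The isomorphism carries Koszul's sign for exchanging a basis element of [F] with one of
    [zd R v]. *)
Lemma tens_swap F v (X : gcomplex R) :
  qiso (tens F (tens (zd v) X)) (tens (zd v) (tens F X)).
Proof.
pose f (n : nat) (x : tens F (tens (zd v) X)) : tens (zd v) (tens F X) :=
  fun t s => (-1) ^+ (tag s * tag t) *: x s t.
have fm : mor f.
  split.
  - move=> n a x y; apply/funext => t; apply/funext => s.
    rewrite /f [LHS](_ : _ = (-1) ^+ (tag s * tag t) *: (a *: x s t + y s t)) //.
    by rewrite scalerDr scalerA mulrC -scalerA.
  - move=> n x gx t; case: (leqP (tag t) n) => let_; last first.
      apply/funext => s; rewrite /f; have := gx s; case: ifP => [les /(_ t)|_ ->]; last exact: scaler0.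
      by rewrite leqNgt ltn_subLR // ltn_addl //= => ->; rewrite scaler0.
    move=> s; rewrite /f; case: ifP => [les|les]; last first.
      have := gx s; case: ifP => [les' /(_ t)|_ ->]; last exact: scaler0.
      suff -> : (tag t <= n - tag s)%N = false by move=> ->; rewrite scaler0.
      by apply: contraFF les; rewrite !leq_subRL // addnC.
    apply: submod_Z; first exact: grS.
    have les' : (tag s <= n)%N := leq_trans les (leq_subr _ _).
    have := tgr_le (tgr_le gx les') (t := t); rewrite subnAC; apply.
    by rewrite leq_subRL // addnC -leq_subRL.
  move=> n x gx; apply/funext => t; apply/funext => s.
  rewrite zd_gd [LHS](_ : _ = (-1) ^+ tag t *: tgd (f n.+1 x t) s) //.
  rewrite /f /tgd scalerDr.
  rewrite [RHS](_ : _ = (-1) ^+ (tag s * tag t) *: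
    ((\sum_a dmx F (tag s) a (tagged s) *: x (existT _ (tag s).+1 a)) t +
      (-1) ^+ tag s *: (gd (x s) t))) //.
  rewrite fct_sumE zd_gd scalerDr; congr (_ + _).
    rewrite !scaler_sumr; apply: eq_bigr => a _ /=.
    rewrite [in RHS](_ : (_ *: _) t = dmx F (tag s) a (tagged s) *: x (existT _ (tag s).+1 a) t) //.
    rewrite !scalerA; congr (_ *: _).
    by rewrite mulSn exprD mulrCA !mulrA -exprD addnn -mul2n exprM sqrrN !expr1n mul1r mulrC.
  rewrite (linZ _ _ (@gdL _ X)) !scalerA; congr (_ *: _).
  by rewrite -!exprD; congr (_ ^+ _); lia.
exists f; split=> //; apply: bij_qis => //.
  move=> n x gx fx; apply/funext => s; apply/funext => t.
  have := congr1 (fun h => (-1) ^+ (tag s * tag t) *: h t s) fx.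
  by rewrite /f signZK => ->; rewrite scaler0.
move=> n y gy; exists (fun s t => (-1) ^+ (tag s * tag t) *: y t s).
  move=> s; case: (leqP (tag s) n) => les; last first.
    apply/funext => t; have := gy t; case: ifP => [let_ /(_ s)|_ ->]; last exact: scaler0.
    by rewrite leqNgt ltn_subLR // ltn_addl //= => ->; rewrite scaler0.
  move=> t; case: ifP => [let_|let_]; last first.
    have := gy t; case: ifP => [let' /(_ s)|_ ->]; last exact: scaler0.
    suff -> : (tag s <= n - tag t)%N = false by move=> ->; rewrite scaler0.
    by apply: contraFF let_; rewrite !leq_subRL // addnC.
  apply: submod_Z; first exact: grS.
  have let' : (tag t <= n)%N := leq_trans let_ (leq_subr _ _).
  have := tgr_le (tgr_le gy let') (t := s); rewrite subnAC; apply.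
  by rewrite leq_subRL // addnC -leq_subRL.
by apply/funext => t; apply/funext => s; rewrite /f signZK.
Qed.

End ZeroDifferential.

(** * The residue field and Künneth's formula *)

Section ResidueField.
Variables (R : comNzRingType) (k : fieldType) (pi : {rmorphism R -> k}).
Hypothesis pi_surj : forall y, exists x, pi x = y.

(** The argument is a phantom: it lets the R-module structure, which depends on [pi], be inferred
    from the type. *)
Definition kmod of {rmorphism R -> k} : Type := k.
HB.instance Definition _ := GRing.Zmodule.on (kmod pi).

Definition kscale (r : R) (x : kmod pi) : kmod pi := pi r * x.

Fact kscaleA a b v : kscale a (kscale b v) = kscale (a * b) v.
Proof. by rewrite /kscale rmorphM mulrA. Qed.
Fact kscale1 : left_id 1 kscale.
Proof. by move=> x; rewrite /kscale rmorph1 mul1r. Qed.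
Fact kscaleDr : right_distributive kscale +%R.
Proof. by move=> a x y; rewrite /kscale mulrDr. Qed.
Fact kscaleDl v : {morph kscale^~ v : a b / a + b}.
Proof. by move=> a b; rewrite /kscale rmorphD mulrDl. Qed.
HB.instance Definition _ := @GRing.Zmodule_isLmodule.Build R (kmod pi)
  kscale kscaleA kscale1 kscaleDr kscaleDl.

Definition kc : gcomplex R := modcx (kmod pi).

Lemma kscaleE (r : R) (x : kmod pi) : r *: x = pi r * (x : k) :> k.
Proof. by []. Qed.

Lemma bdr_modcx (M : lmodType R) n (x : modcx M) : bdr n x -> x = 0.
Proof. by case. Qed.

Lemma hle_kc n : hle pi kc n (n == 0%N).
Proof.
case: n => [|n] /=; last first.
  by apply: dimle0 => x [[//|->] _]; apply: submod0; exact: bdrS.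
apply: (@dimle_fg R k pi pi_surj (modcx (kmod pi)) _ _ 1 (fun=> 1 : k)).
- exact: bdrS.
- move=> r i r0; rewrite [_ *: _](_ : _ = 0); first by apply: submod0; exact: bdrS.
  by rewrite [LHS](_ : _ = pi r * 1) // r0 mul0r.
move=> z _; have [r rz] := pi_surj z; exists (fun=> r).
rewrite big_ord1 [X in bdr _ X](_ : _ = 0); first by apply: submod0; exact: bdrS.
by rewrite [LHS](_ : _ = (z : k) - pi r * 1) // rz mulr1 subrr.
Qed.

Lemma hge_kc n : hge pi kc n (n == 0%N).
Proof.
case: n => [|n] /=; last exact: dimge0.
exists (fun=> 1 : k); split=> [i|c]; first by split=> //; left.
rewrite big_ord1 => /bdr_modcx; rewrite [X in X = _](_ : _ = pi (c ord0) * 1) //.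
by rewrite mulr1 => c0 i; rewrite ord1.
Qed.

Section Kunneth.
Variable G : fcomplex R.

Let cycmx n := kermx (map_mx pi (out_mx G n)).
Let bdrmx n := map_mx pi (dmx G n).
(** The difference is a complement of the boundaries inside the cycles of G (x) k, hence a copy of
    the homology; [homrep] is a basis of it by cycles. *)
Definition hombetti n := \rank (cycmx n :\: bdrmx n)%MS.
Definition homrep n : 'M[k]_(hombetti n, rk G n) := row_base (cycmx n :\: bdrmx n)%MS.

Let bdr_cyc n : (bdrmx n <= cycmx n)%MS.
Proof.
apply/sub_kermxP; rewrite /bdrmx; case: n => [|n] /=; first by rewrite map_mx0 mulmx0.
by rewrite -map_mxM fcxP map_mx0.
Qed.

Lemma hombettiE n :
  hombetti n = (\rank (kermx (map_mx pi (out_mx G n))) - \rank (map_mx pi (dmx G n)))%N.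
Proof.
rewrite -(mxrank_cap_compl (cycmx n) (bdrmx n)) -/(hombetti n).
by rewrite (capmx_idPr (bdr_cyc n)) addKn.
Qed.

Lemma homrep_cyc n : homrep n *m map_mx pi (out_mx G n) = 0.
Proof. by apply/sub_kermxP; rewrite eq_row_base diffmxSl. Qed.

Lemma homrep_indep n (x : 'rV_(hombetti n)) y : x *m homrep n = y *m bdrmx n -> x = 0.
Proof.
move=> e; have : (x *m homrep n <= (cycmx n :\: bdrmx n) :&: bdrmx n)%MS.
  by rewrite sub_capmx (submx_trans (submxMl _ _)) ?eq_row_base // e submxMl.
rewrite capmx_diff submx0 => /eqP; rewrite -[RHS](mul0mx _ (homrep n)).
exact: row_free_inj (row_base_free _) _ _.
Qed.

Lemma homrep_span n (y : 'rV_(rk G n)) : y *m map_mx pi (out_mx G n) = 0 ->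
  exists (x : 'rV_(hombetti n)) (w : 'rV_(rk G n.+1)), y = x *m homrep n + w *m bdrmx n.
Proof.
move/sub_kermxP; rewrite -(addsmx_diff_cap_eq (cycmx n) (bdrmx n)).
move/sub_addsmxP => [[u v] /= ->].
have : (u *m (cycmx n :\: bdrmx n) <= homrep n)%MS by rewrite eq_row_base submxMl.
have : (v *m (cycmx n :&: bdrmx n) <= bdrmx n)%MS.
  by rewrite (submx_trans (submxMl _ _)) // capmxSr.
by move=> /submxP [w ->] /submxP [x ->]; exists x, w.
Qed.

Let vec n (y : tens G kc) : 'rV[k]_(rk G n) := \row_a y (existT _ n a).

Let gd_vec (y : tens G kc) n (a : 'I_(rk G n)) :
  gd y (existT _ n a) = (vec n.+1 y *m bdrmx n) 0 a.
Proof.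
rewrite [LHS](_ : _ = \sum_i dmx G n i a *: y (existT _ n.+1 i) + (-1) ^+ n *: 0) //.
rewrite scaler0 addr0 mxE.
have E I (r : seq I) (F : I -> kmod pi) : \sum_(i <- r) F i = \sum_(i <- r) (F i : k).
  by [].
by rewrite E; apply: eq_bigr => i _; rewrite !mxE kscaleE mulrC.
Qed.

(** Over a field a complex is quasi-isomorphic to its homology. Once the differential is zero, a
    further tensor product is a sum of shifts, and Künneth's formula follows. *)
Lemma tens_kc_qiso : qiso (tens (zd R hombetti) kc) (tens G kc).
Proof.
pose f (n : nat) (x : tens (zd R hombetti) kc) : tens G kc := fun t =>
  (\row_a (x (existT _ (tag t) a) : k) *m homrep (tag t)) 0 (tagged t).
have fE n x i : vec i (f n x) = \row_a (x (existT _ i a) : k) *m homrep i.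
  by apply/rowP => a; rewrite mxE.
have gdx (x : tens (zd R hombetti) kc) : gd x = 0.
  by apply/funext => t; rewrite zd_gd scaler0.
have fm : mor f.
  split.
  - move=> n a x y; apply/funext => t; rewrite /f.
    rewrite [RHS](_ : _ = pi a * (\row_a (x (existT _ (tag t) a) : k) *m homrep (tag t)) 0 (tagged t)
      + (\row_a (y (existT _ (tag t) a) : k) *m homrep (tag t)) 0 (tagged t)) //.
    rewrite !mxE mulr_sumr -big_split; apply: eq_bigr => j _ /=.
    by rewrite !mxE mulrA -mulrDl.
  - move=> n x gx t.
    case: (eqVneq (tag t) n) => [->|ne]; first by rewrite leqnn subnn; left.
    suff -> : f n x t = 0 by case: ifP => // _; right.
    rewrite /f [X in X *m _](_ : _ = 0) ?mul0mx ?mxE //.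
    by apply/rowP => a; rewrite !mxE (tens_modcx_gr gx).
  move=> n x gx; apply/funext => -[i a]; rewrite gd_vec fE -mulmxA.
  have -> : homrep i.+1 *m bdrmx i = 0 by exact: (homrep_cyc i.+1).
  rewrite mulmx0 mxE gdx /f [X in X *m _](_ : _ = 0) ?mul0mx ?mxE //.
  by apply/rowP => b; rewrite !mxE.
exists f; split=> // n x y gx gy _ xE.
have x0 : x = 0.
  case: n gx {gy} xE => [//|n] /= gx xE; apply/funext => -[i a].
  case: (eqVneq i n) => [e|ne]; last by rewrite (tens_modcx_gr gx).
  subst i; have : vec n (f n x) = vec n.+1 y *m bdrmx n.
    by apply/rowP => b; rewrite [LHS]mxE xE; apply: gd_vec.
  by rewrite fE => /homrep_indep /rowP /(_ a); rewrite !mxE.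
have y0 : vec n y *m map_mx pi (out_mx G n) = 0.
  case: n {gx gy} xE => [|n] /= xE; first by rewrite map_mx0 mulmx0.
  apply/rowP => a; transitivity (gd y (existT _ n a)); first by rewrite gd_vec.
  rewrite (_ : gd y = f n x); last by rewrite xE.
  rewrite x0 /f [X in X *m _](_ : _ = 0) ?mul0mx ?mxE //.
  by apply/rowP => b; rewrite !mxE.
have [x' [w yE]] := homrep_span y0.
(* The types of [x'] and [w] depend on [n]; this extends the two vectors to families over all
   degrees. *)
have XWE i : exists xw : 'rV_(hombetti i) * 'rV_(rk G i.+1),
    i = n -> vec i y = xw.1 *m homrep i + xw.2 *m bdrmx i.
  case: (eqVneq i n) => [e|ne]; first by subst i; exists (x', w).
  by exists 0 => e; rewrite e eqxx in ne.
pose X' i := (projT1 (cid (XWE i))).1; pose W i := (projT1 (cid (XWE i))).2.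
have XW i : i = n -> vec i y = X' i *m homrep i + W i *m bdrmx i.
  exact: projT2 (cid (XWE i)).
pose X : tens (zd R hombetti) kc := fun t => if tag t == n then X' (tag t) 0 (tagged t) else 0.
pose Y : tens G kc := fun t => match t with
  | existT 0 _ => 0 | existT i.+1 a => if i == n then W i 0 a else 0 end.
exists X, Y; split.
- move=> t; rewrite /X; case: eqP => [e|_].
    have le : (tag t <= n)%N by rewrite e.
    by rewrite le; left; rewrite e subnn.
  by case: ifP => // _; right.
- move=> [[|i] a] /=; first by right.
  by case: eqP => [e|_]; [subst i; rewrite leqnn subnn; left | case: ifP => // _; right].
- by rewrite gdx x0.
apply/funext => -[i a]; rewrite [RHS](_ : _ = f n X (existT _ i a) + gd Y (existT _ i a)) //.
rewrite gd_vec [f n X _](_ : _ = vec i (f n X) 0 a); last by rewrite mxE.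
rewrite fE.
case: (eqVneq i n) => [e|ne].
  have -> : \row_b (X (existT _ i b) : k) = X' i.
    by apply/rowP => b; rewrite mxE /X /= ifT //; apply/eqP.
  have -> : vec i.+1 Y = W i by apply/rowP => b; rewrite mxE /= ifT //; apply/eqP.
  have /rowP/(_ a) := XW i e; rewrite [in X in X -> _]mxE => ->.
  by rewrite [in LHS]mxE.
have -> : \row_b (X (existT _ i b) : k) = 0.
  by apply/rowP => b; rewrite !mxE /X /= (negPf ne).
have -> : vec i.+1 Y = 0 by apply/rowP => b; rewrite !mxE /= (negPf ne).
by rewrite !mul0mx !mxE addr0; apply: (tens_modcx_gr gy).
Qed.

End Kunneth.

(** The lists that matter are empty, one resolution, and both resolutions; one form covers R, M, N
    and the pair. *)
Definition multitens (Fs : seq (fcomplex R)) (X : gcomplex R) : gcomplex R :=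
  foldr (fun F Y => tens F Y) X Fs.

Lemma qiso_mt Fs X Y : qiso X Y -> qiso (multitens Fs X) (multitens Fs Y).
Proof. by elim: Fs => //= F Fs IH /IH; apply: qiso_tens. Qed.

Lemma sesq_mt Fs X Y Z :
  sesq X Y Z -> sesq (multitens Fs X) (multitens Fs Y) (multitens Fs Z).
Proof. by elim: Fs => //= F Fs IH /IH; apply: sesq_tens. Qed.

Lemma agree_mt Fs N X Y : agree N X Y -> agree N (multitens Fs X) (multitens Fs Y).
Proof. by elim: Fs => //= F Fs IH /IH; apply: agree_tens. Qed.

Lemma null_homotopic_mt Fs r X :
  null_homotopic r X -> null_homotopic r (multitens Fs X).
Proof. by elim: Fs => //= F Fs IH /IH; apply: null_homotopic_tens. Qed.

Lemma fin_gen_mt Fs X :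
  (forall n, fin_gen (@gr R X n)) -> forall n, fin_gen (@gr R (multitens Fs X) n).
Proof. by elim: Fs => //= F Fs IH /IH; apply: fin_gen_tens. Qed.

Lemma mt_swap Fs v X : qiso (multitens Fs (tens (zd R v) X)) (tens (zd R v) (multitens Fs X)).
Proof.
elim: Fs => [|F Fs IH] /=; first exact: qiso_refl.
exact: qiso_trans (qiso_tens F IH) (tens_swap _ _ _).
Qed.

Lemma hle_mt_zd Fs v X n (h : nat -> nat) :
  (forall j, (j <= n)%N -> (0 < v j)%N -> hle pi (multitens Fs X) (n - j) (h (n - j)%N)) ->
  hle pi (multitens Fs (tens (zd R v) X)) n (\sum_(j < n.+1) v j * h (n - j)).
Proof. by move=> H; apply/(hle_qiso pi _ _ (mt_swap _ _ _)); apply: hle_zd. Qed.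

Lemma hge_mt_zd Fs v X n (h : nat -> nat) :
  (forall i, (i <= n)%N -> hge pi (multitens Fs X) i (h i)) ->
  hge pi (multitens Fs (tens (zd R v) X)) n (\sum_(j < n.+1) v j * h (n - j)).
Proof. by move=> H; apply/(hge_qiso pi _ _ (mt_swap _ _ _)); apply: hge_zd. Qed.

Lemma conv_delta (b : nat -> nat) n :
  (\sum_(j < n.+1) b j * (n - j == 0) = b n)%N.
Proof.
rewrite big_ord_recr /= subnn muln1 big1 // => j _.
by rewrite subn_eq0 leqNgt ltn_ord muln0.
Qed.

Lemma tens_kc_dim (G : fcomplex R) n :
  hle pi (tens G kc) n (hombetti G n) /\ hge pi (tens G kc) n (hombetti G n).
Proof.
rewrite -(conv_delta (hombetti G)).
split; [apply/(hle_qiso pi _ _ (tens_kc_qiso G)) | apply/(hge_qiso pi _ _ (tens_kc_qiso G))].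
  by apply: (@hle_zd _ _ pi _ _ _ (fun i => nat_of_bool (i == 0%N))) => i _ _; apply: hle_kc.
by apply: (@hge_zd _ _ pi _ _ _ (fun i => nat_of_bool (i == 0%N))) => i _; apply: hge_kc.
Qed.

Lemma tens2_kc_dim (F G : fcomplex R) n :
  let b := (\sum_(j < n.+1) hombetti G j * hombetti F (n - j))%N in
  hle pi (tens F (tens G kc)) n b /\ hge pi (tens F (tens G kc)) n b.
Proof.
have q := qiso_tens F (tens_kc_qiso G).
split; [apply/(hle_qiso pi _ _ q); apply: (@hle_mt_zd [:: F])
       | apply/(hge_qiso pi _ _ q); apply: (@hge_mt_zd [:: F])] => i _.
  by case: (tens_kc_dim F (n - i)).
by case: (tens_kc_dim F i).
Qed.

Section Noetherian.
Hypothesis noethR : noetherian R.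

(** The coordinate vectors of elements of [Q] form a submodule of a finite free module. *)
Lemma noeth_sub (V : lmodType R) (P Q : set V) :
  submod Q -> Q `<=` P -> fin_gen P -> fin_gen Q.
Proof.
move=> QS QP [N [g [Pg gP]]].
pose phi (v : 'rV[R]_N) : V := \sum_i v 0 i *: g i.
have phiL : linear phi.
  move=> a x y; rewrite /phi scaler_sumr -big_split; apply: eq_bigr => i _.
  by rewrite !mxE scalerDl scalerA.
have [|||p [A AP]] := @row_submodule_fg R noethR N [set v | Q (phi v)].
- by rewrite /= (lin0 phiL); apply: submod0.
- by move=> u v Qu Qv; rewrite /= (linD _ _ phiL); apply: submod_D.
- by move=> a u Qu; rewrite /= (linZ _ _ phiL); apply: submod_Z.
exists p, (fun i => phi (row i A)); split.
  by move=> i; apply/AP; exists (delta_mx 0 i); rewrite -rowE.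
move=> x Qx; have [c xE] := gP x (QP _ Qx).
have [w wE] : exists w, \row_i c i = w *m A.
  apply/AP; rewrite /= (_ : phi _ = x) // xE.
  by apply: eq_bigr => i _; rewrite mxE.
exists (fun i => w 0 i).
transitivity (phi (w *m A)); first by rewrite -wE xE; apply: eq_bigr => i _; rewrite mxE.
rewrite mulmx_sum_row (lin_sum _ _ _ phiL).
by apply: eq_bigr => i _; rewrite (linZ _ _ phiL).
Qed.

Lemma killed_homology r (X : gcomplex R) n (x : X) :
  null_homotopic r X -> cyc n x -> bdr n (r *: x).
Proof.
move=> [h [hL hg hd]] [gx dx]; exists (h x); first exact: hg.
by rewrite -(hd n x gx) dx (lin0 hL) addr0.
Qed.

(** Null homotopies make the homology a vector space over k, and Noetherianity makes it
    finite-dimensional. *)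
Lemma homology_basis (X : gcomplex R) n :
  fin_gen (@gr R X n) -> (forall r, pi r = 0 -> null_homotopic r X) ->
  exists d (z : 'I_d -> X), [/\ forall i, cyc n (z i), indep pi (@bdr R X n) z &
    forall a, cyc n a -> exists c, bdr n (a - \sum_i c i *: z i)].
Proof.
move=> fgX nX.
have [N [g [Zg gZ]]] : fin_gen (@cyc R X n).
  by apply: noeth_sub fgX => [|x []//]; exact: cycS.
apply: (dim_basis pi_surj (g := g)) => //; first exact: bdrS.
  by move=> r z r0; apply: killed_homology; apply: nX.
move=> z /gZ [c ->]; exists c; rewrite subrr; apply: submod0; exact: bdrS.
Qed.

Lemma hle_exists (X : gcomplex R) n :
  fin_gen (@gr R X n) -> (forall r, pi r = 0 -> null_homotopic r X) ->
  exists h, hle pi X n h.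
Proof.
move=> fgX nX; have [d [z [Zz _ zP]]] := homology_basis fgX nX.
exists d; apply: (dimle_fg pi_surj (g := z)) => //; first exact: bdrS.
by move=> r i r0; apply: killed_homology; [apply: nX | exact: Zz].
Qed.

End Noetherian.
End ResidueField.

(** * The monomial basis of a Tate algebra *)

Section MonomialBasis.
Variables (R : comNzRingType) (A : tate_algebra R).

Definition texpo := expo (nvar A).
(** Exponents are functions of all variables; their equality is decided classically, so that equal
    monomials can be collected. *)
HB.instance Definition _ := gen_eqMixin texpo.

Implicit Types (al be : texpo) (P Q : set texpo) (a b : A).

Definition tvar := {n : nat & 'I_(nvar A n)}.
Definition vpow (t : tvar) : nat -> A := dp (tagged t).
Definition vexp al (t : tvar) : nat := al (tag t) (tagged t).
Definition mono (s : seq tvar) al : A := \prod_(t <- s) vpow t (vexp al t).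

Definition eadd al be : texpo := fun n i => (al n i + be n i)%N.
Definition e0 : texpo := fun _ _ => 0%N.

Lemma monomialE q al : monomial (@dp R A) q al = mono (upto (nvar A) q) al.
Proof.
rewrite /mono big_allpairs_dep /monomial.
transitivity (\prod_(0 <= n < q.+1) \prod_(i < nvar A n) dp i (al n i)).
  by rewrite big_mkord.
by rewrite /index_iota subn0; apply: eq_bigr => n _; rewrite enumT [index_enum _]unlock.
Qed.

Lemma signE n a : (-1) ^+ n * a = (-1) ^+ n *: a.
Proof.
by elim: n => [|n IH]; rewrite ?expr0 ?mul1r ?scale1r // !exprS !mulN1r mulNr IH scaleNr.
Qed.

Lemma vpowM t i j : vpow t i * vpow t j = ('C(i + j, i)%:R : R) *: vpow t (i + j).
Proof. by rewrite /vpow dpM scaler_nat. Qed.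

Lemma vpowC t t' i j : vpow t i * vpow t' j =
  (-1) ^+ (tag t * i * (tag t' * j))%N *: (vpow t' j * vpow t i).
Proof. by rewrite /vpow dpC signE. Qed.

Lemma mono_vpowC s al t i :
  exists e, mono s al * vpow t i = (-1) ^+ e *: (vpow t i * mono s al).
Proof.
rewrite /mono; elim: s => [|u s [e IH]]; first by exists 0%N; rewrite !big_nil mulr1 mul1r scale1r.
exists (e + tag u * vexp al u * (tag t * i))%N; rewrite !big_cons -mulrA IH -scalerAr.
by rewrite [in LHS]mulrA [vpow u _ * vpow t _]vpowC -scalerAl scalerA -exprD -mulrA.
Qed.

(** Moving a power past a monomial costs a sign, and merging two divided powers costs a binomial
    coefficient. *)
Lemma monoM s al be : exists c : R, mono s al * mono s be = c *: mono s (eadd al be).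
Proof.
rewrite /mono; elim: s => [|t s [c IH]]; first by exists 1; rewrite !big_nil mulr1 scale1r.
have [e eE] := mono_vpowC s al t (vexp be t).
exists ((-1) ^+ e * 'C(vexp al t + vexp be t, vexp al t)%:R * c).
rewrite !big_cons -!/(mono s _) in IH *.
have -> : vpow t (vexp al t) * mono s al * (vpow t (vexp be t) * mono s be) =
  vpow t (vexp al t) * (mono s al * vpow t (vexp be t)) * mono s be by rewrite !mulrA.
rewrite eE -scalerAr mulrA vpowM -!scalerAl -[_ * mono s al * _]mulrA IH.
by rewrite -scalerAr !scalerA.
Qed.

Lemma mono_eq0 s al t : t \in s -> odd (tag t) -> (1 < vexp al t)%N -> mono s al = 0.
Proof.
move=> ts ot lt; rewrite /mono; elim: s ts => [//|u s IH]; rewrite inE big_cons.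
case/orP => [/eqP <-|/IH ->]; last by rewrite mulr0.
by rewrite {1}/vpow dp_odd // mul0r.
Qed.

Definition normal_in lo hi : set texpo :=
  [set al | (forall n i, (n < lo)%N || (hi < n)%N -> al n i = 0%N) /\
            (forall n i, odd n -> (al n i <= 1)%N)].

Definition nrm : set texpo := [set al | exists q, normal_expo q al].

Lemma normal_expoW q q' al : (q <= q')%N -> normal_expo q al -> normal_expo q' al.
Proof. by move=> le [h1 h2]; split=> // n i lt; apply: h1; apply: leq_ltn_trans lt. Qed.

Lemma monomial_widen q q' al :
  (q <= q')%N -> normal_expo q al -> monomial (@dp R A) q' al = monomial (@dp R A) q al.
Proof.
move=> + [h _]; elim: q' => [|q' IH]; first by rewrite leqn0 => /eqP ->.
rewrite leq_eqVlt => /orP[/eqP <- //|lt]; rewrite -IH // /monomial big_ord_recr /=.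
by rewrite [X in _ * X]big1 ?mulr1 // => i _; rewrite h // dp0.
Qed.

Lemma expo_deg_widen q q' al :
  (q <= q')%N -> normal_expo q al -> expo_deg q' al = expo_deg q al.
Proof.
move=> + [h _]; elim: q' => [|q' IH]; first by rewrite leqn0 => /eqP ->.
rewrite leq_eqVlt => /orP[/eqP <- //|lt]; rewrite -IH // /expo_deg big_ord_recr /=.
by rewrite [X in (_ + X)%N]big1 ?addn0 // => i _; rewrite h // muln0.
Qed.

(** A monomial and its degree do not depend on the stage in which they are formed; one chosen stage
    per exponent removes [q] from [mon] and [edeg]. *)
Definition bnd al : nat := xget 0%N [set q | normal_expo q al].

Lemma bndP al : nrm al -> normal_expo (bnd al) al.
Proof. by move=> [q qP]; rewrite /bnd; case: xgetP => [q' -> //|/(_ q)]. Qed.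

Definition mon al : A := monomial (@dp R A) (bnd al) al.
Definition edeg al : nat := expo_deg (bnd al) al.

Lemma monE q al : normal_expo q al -> monomial (@dp R A) q al = mon al.
Proof.
move=> nq; have nb : normal_expo (bnd al) al by apply: bndP; exists q.
by case: (leqP q (bnd al)) => [le|/ltnW le]; rewrite /mon (monomial_widen le).
Qed.

Lemma edegE q al : normal_expo q al -> expo_deg q al = edeg al.
Proof.
move=> nq; have nb : normal_expo (bnd al) al by apply: bndP; exists q.
by case: (leqP q (bnd al)) => [le|/ltnW le]; rewrite /edeg (expo_deg_widen le).
Qed.

Lemma nrm0 : nrm e0. Proof. by exists 0%N. Qed.

Lemma mon0 : mon e0 = 1.
Proof.
by rewrite -(@monE 0) // /monomial big_ord1 big1 // => i; rewrite dp0.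
Qed.

Lemma edeg0 : edeg e0 = 0%N.
Proof.
by rewrite -(@edegE 0) // /expo_deg big_ord1 big1 // => i; rewrite muln0.
Qed.

Lemma edegD al be : nrm al -> nrm be -> nrm (eadd al be) ->
  edeg (eadd al be) = (edeg al + edeg be)%N.
Proof.
move=> na nb nab; pose q := maxn (bnd al) (maxn (bnd be) (bnd (eadd al be))).
have nqa := normal_expoW (leq_maxl _ _ : _ <= q)%N (bndP na).
have nqb : normal_expo q be.
  by apply: normal_expoW (bndP nb); rewrite leq_max leq_maxl orbT.
have nqab : normal_expo q (eadd al be).
  by apply: normal_expoW (bndP nab); rewrite leq_max leq_maxr orbT.
rewrite -(edegE nqa) -(edegE nqb) -(edegE nqab) /expo_deg -big_split; apply: eq_bigr => n _.
by rewrite -big_split; apply: eq_bigr => i _; rewrite mulnDr.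
Qed.

(** The sum of two normal exponents fails to be normal only if a variable of odd degree gets
    exponent 2, and then the product is zero. *)
Lemma monM q al be : normal_expo q al -> normal_expo q be ->
  exists c : R, mon al * mon be = c *: mon (eadd al be) /\
    (normal_expo q (eadd al be) \/ c = 0).
Proof.
move=> na nb; have [na1 na2] := na; have [nb1 nb2] := nb.
rewrite -(monE na) -(monE nb) !monomialE.
have [c ->] := monoM (upto (nvar A) q) al be.
case: (pselect (normal_expo q (eadd al be))) => [nab|nab].
  by exists c; split; [rewrite -monomialE monE | left].
exists 0; split; last by right.
rewrite scale0r (_ : mono _ _ = 0) ?scaler0 //.
case: (pselect (exists n (i : 'I_(nvar A n)), odd n /\ (1 < al n i + be n i)%N)); last first.
  move=> nex; case: nab; split=> n i H; first by rewrite /eadd na1 // nb1.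
  by rewrite leqNgt; apply/negP => lt; case: nex; exists n, i.
move=> [n [i [on lt]]]; apply: (@mono_eq0 _ _ (existT _ n i)) => //.
by rewrite mem_upto /= leqNgt; apply/negP => ltq; rewrite na1 // nb1 in lt.
Qed.

(* When the two sets of variables are separated, no reordering is needed. *)
Lemma mon_low_high c q al be : (0 < c <= q.+1)%N ->
  normal_in 0 c.-1 al -> normal_in c q be ->
  normal_expo q (eadd al be) /\ mon al * mon be = mon (eadd al be).
Proof.
move=> /andP[c0 cq] [al1 al2] [be1 be2].
have nal : normal_expo q al.
  by split=> // n i lt; apply: al1 => /=; apply: leq_trans lt; rewrite prednK.
have nbe : normal_expo q be by split=> // n i lt; apply: be1; rewrite lt orbT.
have nab : normal_expo q (eadd al be).
  split=> n i H; first by rewrite /eadd nal.1 // nbe.1.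
  rewrite /eadd; case: (ltnP n c) => lt; first by rewrite be1 ?lt // addn0 al2.
  by rewrite al1 ?be2 //= prednK.
split=> //; rewrite -(monE nal) -(monE nbe) -(monE nab) /monomial.
pose G (ga : texpo) n : A := \prod_(i < nvar A n) dp i (ga n i).
have sp (ga : texpo) : \prod_(n < q.+1) \prod_(i < nvar A n) dp i (ga n i) =
    (\prod_(0 <= n < c) G ga n) * \prod_(c <= n < q.+1) G ga n.
  by rewrite -(big_mkord xpredT (G ga)) (@big_cat_nat _ _ _ c).
have alH : \prod_(c <= n < q.+1) G al n = 1.
  rewrite big_nat big1 // => n /andP[cn _]; rewrite /G big1 // => i _.
  by rewrite al1 ?dp0 //= prednK.
have beL : \prod_(0 <= n < c) G be n = 1.
  rewrite big_nat big1 // => n /andP[_ nc]; rewrite /G big1 // => i _.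
  by rewrite be1 ?dp0 // nc.
rewrite !sp alH beL mulr1 mul1r; congr (_ * _); rewrite big_nat [RHS]big_nat;
  apply: eq_bigr => n /andP[l1 l2]; apply: eq_bigr => i _; congr (dp _ _).
  by rewrite /eadd be1 ?l2 // addn0.
by rewrite /eadd al1 //= prednK.
Qed.

Definition lsum (V : lmodType R) (phi : texpo -> V) (l : seq (R * texpo)) : V :=
  \sum_(x <- l) x.1 *: phi x.2.

Definition allnrm (P : set texpo) (l : seq (R * texpo)) : Prop :=
  forall x, x \in l -> nrm x.2 /\ P x.2.

(** After collecting equal exponents, freeness makes every coefficient vanish, so arbitrary values
    on monomials respect the relation. This is why [ext] does not depend on the chosen
    representation. *)
Lemma lsum_free l (V : lmodType R) (phi : texpo -> V) :
  allnrm setT l -> lsum mon l = 0 -> lsum phi l = 0.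
Proof.
move=> ln l0.
pose s := undup (map snd l); pose cf be := \sum_(x <- l | x.2 == be) x.1.
have lE (W : lmodType R) (psi : texpo -> W) : lsum psi l = \sum_(be <- s) cf be *: psi be.
  rewrite /cf; under [RHS]eq_bigr do rewrite scaler_suml big_mkcond.
  rewrite exchange_big /lsum big_seq [RHS]big_seq; apply: eq_bigr => x xl.
  rewrite (bigD1_seq x.2) ?undup_uniq ?mem_undup ?map_f //= eqxx big1 ?addr0 // => be ne.
  by rewrite eq_sym (negPf ne).
have sn be : be \in s -> nrm be.
  by rewrite mem_undup => /mapP[x xl ->]; case: (ln _ xl).
have [q qP] : exists q, forall be, be \in s -> normal_expo q be.
  elim: (s) sn => [|be r IH] sn; first by exists 0%N.
  have [|q qP] := IH; first by move=> al ar; apply: sn; rewrite inE ar orbT.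
  exists (maxn q (bnd be)) => al; rewrite inE => /orP[/eqP ->|/qP].
    by apply: normal_expoW (bndP (sn _ _)); rewrite ?leq_maxr ?inE ?eqxx.
  by apply: normal_expoW; rewrite leq_maxl.
rewrite lE big_seq big1 // => be bes; rewrite (_ : cf be = 0) ?scale0r //.
have i_lt : (index be s < size s)%N by rewrite index_mem.
rewrite -(nth_index e0 bes) -[index be s]/(nat_of_ord (Ordinal i_lt)).
apply: (monomial_free (t := A) (q := q) (al := fun i : 'I_(size s) => nth e0 s i)
  (c := fun i : 'I_(size s) => cf (nth e0 s i))).
- by move=> i j /eqP; rewrite nth_uniq ?undup_uniq // => /eqP /val_inj.
- by move=> i; apply: qP; rewrite mem_nth.
rewrite -[RHS]l0 lE (big_nth e0) big_mkord; apply: eq_bigr => i _.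
by rewrite monE //; apply: qP; rewrite mem_nth.
Qed.

Lemma rep_exists a : exists l, allnrm setT l /\ a = lsum mon l.
Proof.
have [q [r [al [c [aln ->]]]]] := monomial_span a.
exists [seq (c i, al i : texpo) | i <- enum 'I_r]; split.
  by move=> x /mapP[i _ ->]; split=> //; exists q; apply: aln.
by rewrite /lsum big_map big_enum; apply: eq_bigr => i _; rewrite monE.
Qed.

Definition rep a : seq (R * texpo) := projT1 (cid (rep_exists a)).

Lemma rep_nrm a : allnrm setT (rep a).
Proof. by case: (projT2 (cid (rep_exists a))). Qed.

Lemma repE a : a = lsum mon (rep a).
Proof. by case: (projT2 (cid (rep_exists a))). Qed.

Lemma lsum_cat (V : lmodType R) (phi : texpo -> V) l l' :
  lsum phi (l ++ l') = lsum phi l + lsum phi l'.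
Proof. by rewrite /lsum big_cat. Qed.

Definition lscale (c : R) (l : seq (R * texpo)) := [seq (c * x.1, x.2) | x <- l].

Lemma lsum_scale (V : lmodType R) (phi : texpo -> V) c l :
  lsum phi (lscale c l) = c *: lsum phi l.
Proof. by rewrite /lsum big_map scaler_sumr; apply: eq_bigr => x _; rewrite scalerA. Qed.

Lemma allnrm_cat P l l' : allnrm P l -> allnrm P l' -> allnrm P (l ++ l').
Proof. by move=> h h' x; rewrite mem_cat => /orP[/h|/h']. Qed.

Lemma allnrm_scale P c l : allnrm P l -> allnrm P (lscale c l).
Proof. by move=> h x /mapP[y yl ->]; apply: h yl. Qed.

Definition ext (V : lmodType R) (phi : texpo -> V) a : V := lsum phi (rep a).

Lemma ext_lsum (V : lmodType R) (phi : texpo -> V) l :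
  allnrm setT l -> ext phi (lsum mon l) = lsum phi l.
Proof.
move=> ln; set a := lsum mon l.
have : lsum phi (rep a ++ lscale (-1) l) = 0.
  apply: lsum_free; last by rewrite lsum_cat lsum_scale -repE scaleN1r subrr.
  by apply: allnrm_cat; [exact: rep_nrm | exact: allnrm_scale].
by rewrite lsum_cat lsum_scale scaleN1r => /eqP; rewrite subr_eq0 => /eqP.
Qed.

Lemma extL (V : lmodType R) (phi : texpo -> V) : linear (ext phi).
Proof.
move=> c a b; rewrite {1}(repE a) {1}(repE b) -lsum_scale -lsum_cat ext_lsum.
  by rewrite lsum_cat lsum_scale.
by apply: allnrm_cat; [apply: allnrm_scale|]; exact: rep_nrm.
Qed.

Lemma ext_mon (V : lmodType R) (phi : texpo -> V) al : nrm al -> ext phi (mon al) = phi al.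
Proof.
move=> na; have -> : mon al = lsum mon [:: (1, al)] by rewrite /lsum big_seq1 scale1r.
rewrite ext_lsum; first by rewrite /lsum big_seq1 scale1r.
by move=> x; rewrite inE => /eqP ->.
Qed.

(** Degree components, stages and filtration steps are all spans of monomials, so their properties
    can be checked on monomials. *)
Definition inA P : set A := [set a | exists l, allnrm P l /\ a = lsum mon l].

Lemma inA_submod P : submod (inA P).
Proof.
split=> [|c a b [l [ln ->]] [l' [ln' ->]]].
  by exists [::]; rewrite /lsum big_nil.
exists (lscale c l ++ l'); rewrite lsum_cat lsum_scale; split=> //.
by apply: allnrm_cat => //; apply: allnrm_scale.
Qed.

Lemma inA_mon P al : nrm al -> P al -> inA P (mon al).
Proof.
move=> na Pa; exists [:: (1, al)]; rewrite /lsum big_seq1 scale1r; split=> // x.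
by rewrite inE => /eqP ->.
Qed.

Lemma inA_ind P (Q : set A) : submod Q ->
  (forall al, nrm al -> P al -> Q (mon al)) -> inA P `<=` Q.
Proof.
move=> QS Qm a [l [ln ->]]; rewrite /lsum big_seq; apply: submod_sum => // x /ln [nx Px].
by apply: submod_Z => //; apply: Qm.
Qed.

Lemma inAT a : inA setT a.
Proof. by exists (rep a); split; [exact: rep_nrm | exact: repE]. Qed.

Lemma inA_sub P P' : P `<=` P' -> inA P `<=` inA P'.
Proof.
by move=> PP; apply: inA_ind => [|al na Pa]; [exact: inA_submod | apply: inA_mon => //; apply: PP].
Qed.

Lemma submod_eq (V : lmodType R) (f g : A -> V) :
  linear f -> linear g -> submod [set a | f a = g a].
Proof.
move=> fL gL; split=> [|c a b /= fa fb]; first by rewrite /= (lin0 fL) (lin0 gL).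
by rewrite fL gL fa fb.
Qed.

Lemma lin_eq P (V : lmodType R) (f g : A -> V) : linear f -> linear g ->
  (forall al, nrm al -> P al -> f (mon al) = g (mon al)) -> forall a, inA P a -> f a = g a.
Proof.
by move=> fL gL fg a; apply: (inA_ind (submod_eq fL gL)) => al na Pa; apply: fg.
Qed.

Definition prj P : A -> A := ext (fun al => if `[< P al >] then mon al else 0).

Lemma prjL P : linear (prj P). Proof. exact: extL. Qed.

Lemma prj_mon P al : nrm al -> prj P (mon al) = if `[< P al >] then mon al else 0.
Proof. by move=> na; rewrite /prj ext_mon. Qed.

Lemma idL (V : lmodType R) : linear (@id V). Proof. by []. Qed.

Lemma prj_id P a : inA P a -> prj P a = a.
Proof.
apply: lin_eq => [||al na Pa]; [exact: prjL | exact: idL | rewrite prj_mon //].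
by case: asboolP.
Qed.

Lemma prj_in P Q a : inA Q a -> inA (P `&` Q) (prj P a).
Proof.
apply: (inA_ind (Q := [set a | inA (P `&` Q) (prj P a)])) => [|al na Qa].
  split=> [|c x y /= Px Py]; first by rewrite /= (lin0 (@prjL P)); apply: submod0; exact: inA_submod.
  by rewrite prjL; case: (inA_submod (P `&` Q)) => _; apply.
rewrite /= prj_mon //; case: asboolP => Pa; first exact: inA_mon.
by apply: submod0; exact: inA_submod.
Qed.

(** The projection onto the monomials in [P] fixes [a] and does not leave the span of [Q]. *)
Lemma inAI P Q a : inA P a -> inA Q a -> inA (P `&` Q) a.
Proof. by move=> Pa Qa; rewrite -(prj_id Pa); apply: prj_in. Qed.

Definition dgr n : set texpo := [set al | edeg al = n].
Definition le_var q : set texpo := [set al | normal_expo q al].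

Lemma homogE n a : homog (@dp R A) n a <-> inA (dgr n) a.
Proof.
split=> [[q [r [al [c [alP ->]]]]]|].
  apply: submod_sum => [|i _]; first exact: inA_submod.
  apply: submod_Z; first exact: inA_submod.
  have [nal dal] := alP i; rewrite monE //; apply: inA_mon; first by exists q.
  by rewrite /dgr /= -(edegE nal).
move=> [l [ln ->]].
have [q qP] : exists q, forall x, x \in l -> normal_expo q x.2.
  elim: (l) ln => [|x r IH] ln; first by exists 0%N.
  have [|q qP] := IH; first by move=> y yr; apply: ln; rewrite inE yr orbT.
  exists (maxn q (bnd x.2)) => y; rewrite inE => /orP[/eqP ->|/qP].
    have [nx _] : nrm x.2 /\ dgr n x.2 by apply: ln; rewrite inE eqxx.
    by apply: normal_expoW (bndP nx); rewrite leq_maxr.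
  by apply: normal_expoW; rewrite leq_maxl.
exists q, (size l), (fun i => (tnth (in_tuple l) i).2), (fun i => (tnth (in_tuple l) i).1).
split=> [i|].
  have xl : tnth (in_tuple l) i \in l by rewrite -[X in _ \in X]/(tval (in_tuple l)) mem_tnth.
  have [_ <-] := ln _ xl; split; first exact: qP.
  by rewrite edegE //; apply: qP.
rewrite /lsum big_tnth; apply: eq_bigr => i _; rewrite monE //; apply: qP.
by rewrite -[X in _ \in X]/(tval (in_tuple l)) mem_tnth.
Qed.

Lemma stageE q a : stage q a <-> inA (le_var q) a.
Proof.
split=> [[r [al [c [alP ->]]]]|].
  apply: submod_sum => [|i _]; first exact: inA_submod.
  apply: submod_Z; first exact: inA_submod.
  by rewrite monE //; apply: inA_mon; [exists q|]; apply: alP.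
move=> [l [ln ->]].
exists (size l), (fun i => (tnth (in_tuple l) i).2), (fun i => (tnth (in_tuple l) i).1).
have lP i : normal_expo q (tnth (in_tuple l) i).2.
  by case: (ln (tnth (in_tuple l) i)) => //; rewrite -[X in _ \in X]/(tval (in_tuple l)) mem_tnth.
by split=> //; rewrite /lsum big_tnth; apply: eq_bigr => i _; rewrite monE.
Qed.

End MonomialBasis.

(** * Products, differential and augmentation on monomials *)

Section TateStructure.
Variables (R : comNzRingType) (A : tate_algebra R).
Implicit Types (al be : texpo A) (P Q : set (texpo A)) (a b : A).
Local Notation d := (dif A).

Lemma difL : linear d. Proof. exact: linearP. Qed.

Lemma mulL (a : A) : linear (fun x : A => a * x).
Proof. by move=> c x y; rewrite mulrDr scalerAr. Qed.

Lemma mulrL (a : A) : linear (fun x : A => x * a).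
Proof. by move=> c x y; rewrite mulrDl scalerAl. Qed.

Lemma common_bound al be : nrm al -> nrm be -> exists q, normal_expo q al /\ normal_expo q be.
Proof.
move=> na nb; exists (maxn (bnd al) (bnd be)); split.
  by apply: normal_expoW (bndP na); rewrite leq_maxl.
by apply: normal_expoW (bndP nb); rewrite leq_maxr.
Qed.

Lemma bilin_ind P Q (S : set A) : submod S ->
  (forall al be, nrm al -> P al -> nrm be -> Q be -> S (mon al * mon be)) ->
  forall a b, inA P a -> inA Q b -> S (a * b).
Proof.
move=> SS H a b Pa Qb; move: a Pa; apply: inA_ind => [|al na Pa].
  split=> [|c x y Sx Sy]; first by rewrite /= mul0r; apply: submod0.
  by rewrite /= mulrDl -scalerAl; case: SS => _; apply.
move: b Qb; apply: inA_ind => [|be nb Qb]; last exact: H.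
split=> [|c x y Sx Sy]; first by rewrite /= mulr0; apply: submod0.
by rewrite /= mulrDr -scalerAr; case: SS => _; apply.
Qed.

Lemma inA_mul_var q a b : inA (@le_var R A q) a -> inA (@le_var R A q) b -> inA (@le_var R A q) (a * b).
Proof.
apply: bilin_ind => [|al be _ qa _ qb]; first exact: inA_submod.
have [c [-> [nab| ->]]] := monM qa qb.
  by apply: submod_Z; [exact: inA_submod | apply: inA_mon => //; exists q].
by rewrite scale0r; apply: submod0; exact: inA_submod.
Qed.

Lemma inA_mul_dgr n p a b : inA (@dgr R A n) a -> inA (@dgr R A p) b -> inA (@dgr R A (n + p)) (a * b).
Proof.
apply: bilin_ind => [|al be na da nb db]; first exact: inA_submod.
have [q [qa qb]] := common_bound na nb.
have [c [-> [nab| ->]]] := monM qa qb.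
  apply: submod_Z; first exact: inA_submod.
  have nab' : nrm (eadd al be) by exists q.
  by apply: inA_mon => //; rewrite /dgr /= edegD // da db.
by rewrite scale0r; apply: submod0; exact: inA_submod.
Qed.

(** A variable of degree [j] that occurs contributes at least [j] to the degree of the monomial. *)
Lemma dgr_le_var n al : nrm al -> dgr n al -> le_var n al.
Proof.
move=> na da; have [b1 b2] := bndP na; split=> // j i lt; apply/eqP; rewrite -leqn0 leqNgt.
apply/negP => pos.
case: (ltnP (bnd al) j) => [/b1 e|le]; first by rewrite e in pos.
have : (j * al j i <= edeg al)%N.
  have jq : (j < (bnd al).+1)%N by [].
  rewrite /edeg /expo_deg (bigD1 (Ordinal jq)) //= (bigD1 i) //=.
  by rewrite -!addnA leq_addr.
rewrite da leqNgt => /negP; apply; apply: leq_trans lt _.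
by rewrite leq_pmulr.
Qed.

Lemma inA_dgr_le_var n q a : (n <= q)%N -> inA (@dgr R A n) a -> inA (@le_var R A q) a.
Proof.
move=> le; apply: inA_ind => [|al na da]; first exact: inA_submod.
by apply: inA_mon => //; apply: normal_expoW le _; apply: dgr_le_var.
Qed.

Lemma dif_dgr0 a : inA (@dgr R A 0) a -> d a = 0.
Proof. by move/homogE; apply: dif_homog0. Qed.

Lemma dif_dgr n a : inA (@dgr R A n.+1) a -> inA (@dgr R A n) (d a).
Proof. by move/homogE => h; apply/homogE; apply: dif_homogS. Qed.

Lemma inA_dgr0 a : inA (@dgr R A 0) a -> exists r : R, a = r%:A.
Proof.
apply: (inA_ind (Q := [set a | exists r : R, a = r%:A])) => [|al na da].
  split=> [|c x y [r ->] [s ->]]; first by exists 0; rewrite scale0r.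
  by exists (c * r + s); rewrite scalerA -scalerDl.
exists 1; rewrite scale1r -mon0; congr mon.
have [h1 h2] := dgr_le_var na da.
apply: functional_extensionality_dep => n; apply/funext => i.
case: n i => [|n] i; last by rewrite h1.
by exfalso; case: i => j; rewrite nvar0.
Qed.

Lemma inA_const (r : R) : inA (@dgr R A 0) r%:A.
Proof.
apply: submod_Z; first exact: inA_submod.
by rewrite -mon0; apply: inA_mon; [exact: nrm0 | exact: edeg0].
Qed.

Lemma mono_single (s : seq (tvar A)) t i : uniq s -> t \in s ->
  mono s (fun n j => if existT _ n j == t then i else 0%N) = vpow t i.
Proof.
have one (u : tvar A) : vpow u 0 = 1 by rewrite /vpow dp0.
pose F u : A := vpow u (if u == t then i else 0%N).
have -> : mono s (fun n j => if existT _ n j == t then i else 0%N) = \prod_(u <- s) F u.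
  by apply: eq_bigr => -[n j] _.
elim: s => [//|u s IH] /= /andP[us uns]; rewrite inE big_cons => /orP[/eqP e|ts].
  rewrite /F -e eqxx big_seq big1 ?mulr1 // => w ws.
  by case: eqP => [wt|_]; [rewrite -e -wt ws in us | exact: one].
rewrite {1}/F; case: eqP => [e|_]; first by rewrite e ts in us.
by rewrite one mul1r; apply: IH.
Qed.

Lemma vpow_in t i : inA (@le_var R A (tag t)) (vpow t i) /\
  inA (@dgr R A (tag t * i)) (vpow t i).
Proof.
have [odd2|nrmal] := boolP (odd (tag t) && (1 < i)%N).
  case/andP: odd2 => o lt; rewrite /vpow dp_odd //.
  by split; apply: submod0; exact: inA_submod.
pose al : texpo A := fun n j => if existT _ n j == t then i else 0%N.
have qal : normal_expo (tag t) al.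
  split=> n j H; rewrite /al; case: eqP => // e.
    by rewrite -e /= ltnn in H.
  by rewrite leqNgt; apply/negP => lt; case/negP: nrmal; rewrite -e /= H.
have na : nrm al by exists (tag t).
have -> : vpow t i = mon al.
  by rewrite -(monE qal) monomialE mono_single ?uniq_upto // mem_upto.
split; apply: inA_mon => //; rewrite /dgr /= -(edegE qal).
transitivity (\sum_(u <- upto (nvar A) (tag t)) tag u * vexp al u)%N.
  rewrite big_allpairs_dep /expo_deg -(big_mkord xpredT
     (fun n => \sum_(j < nvar A n) n * al n j)%N) /index_iota subn0.
  by apply: eq_bigr => n _; rewrite /= big_enum.
rewrite (bigD1_seq t) ?mem_upto ?uniq_upto //= big1 ?addn0 => [|[n j] ne].
  by rewrite /vexp /al (_ : existT _ (tag t) (tagged t) = t) ?eqxx //; case: (t).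
by rewrite /vexp /al /= (negPf ne) muln0.
Qed.

Lemma dif1 : d 1 = 0.
Proof. by apply: dif_dgr0; rewrite -mon0; apply: inA_mon; [exact: nrm0 | exact: edeg0]. Qed.

(** The differential of a variable has smaller degree, hence involves only variables of smaller
    degree. Divided powers of even variables follow by [dif_dp]; those of odd variables vanish
    beyond the first. *)
Lemma dif_vpow_in t i : inA (@le_var R A (tag t)) (d (vpow t i)).
Proof.
have hdv : inA (@le_var R A (tag t)) (d (vpow t 1)).
  have [_] := vpow_in t 1; rewrite muln1.
  case: (tag t) => [/dif_dgr0 ->|n /dif_dgr]; first by apply: submod0; exact: inA_submod.
  by apply: inA_dgr_le_var.
case: i => [|i]; first by rewrite /vpow dp0 dif1; apply: submod0; exact: inA_submod.
have [od|ev] := boolP (odd (tag t)); last first.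
  rewrite /vpow dif_dp // -/(vpow t 1) -/(vpow t i).
  by apply: inA_mul_var => //; case: (vpow_in t i).
case: i => [//|i]; rewrite /vpow dp_odd // (lin0 difL).
by apply: submod0; exact: inA_submod.
Qed.

Lemma mono_var q s al : (forall t, t \in s -> (tag t <= q)%N) ->
  inA (@le_var R A q) (mono s al) /\ inA (@le_var R A q) (d (mono s al)).
Proof.
have sub n : (n <= q)%N -> inA (@le_var R A n) `<=` inA (@le_var R A q).
  by move=> le; apply: inA_sub => be; apply: normal_expoW.
elim: s => [|t s IH] sq.
  rewrite /mono big_nil dif1; split; last by apply: submod0; exact: inA_submod.
  by rewrite -mon0; apply: inA_mon => //; exact: nrm0.
have [|m1 m2] := IH; first by move=> u us; apply: sq; rewrite inE us orbT.
have tq : (tag t <= q)%N by apply: sq; rewrite inE eqxx.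
have [v1 v2] := vpow_in t (vexp al t); have v3 := dif_vpow_in t (vexp al t).
rewrite /mono big_cons -/(mono s al); split; first by apply: inA_mul_var => //; apply: sub v1.
rewrite (leibniz _ (n := tag t * vexp al t)); last exact/homogE.
rewrite signE; apply: submod_D; first exact: inA_submod.
  by apply: inA_mul_var => //; apply: sub v3.
apply: submod_Z; first exact: inA_submod.
by apply: inA_mul_var => //; apply: sub v1.
Qed.

Lemma dif_var q a : inA (@le_var R A q) a -> inA (@le_var R A q) (d a).
Proof.
apply: (inA_ind (Q := [set a | inA (@le_var R A q) (d a)])) => [|al _ qa].
  split=> [|c x y dvx dvy]; first by rewrite /= (lin0 difL); apply: submod0; exact: inA_submod.
  by rewrite /= difL; case: (inA_submod (@le_var R A q)) => _; apply.
rewrite /= -(monE qa) monomialE.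
by have [] := @mono_var q (upto (nvar A) q) al; first by move=> t; rewrite mem_upto.
Qed.

(** With this involution Leibniz's rule holds for inhomogeneous elements ([dif_mul]), and the bar of
    the Massey relation is [- sg] ([barE]). *)
Definition sg : A -> A := ext (fun al => (-1) ^+ edeg al *: mon al).

Lemma sgL : linear sg. Proof. exact: extL. Qed.

Lemma sg_mon al : nrm al -> sg (mon al) = (-1) ^+ edeg al *: mon al.
Proof. by move=> na; rewrite /sg ext_mon. Qed.

Lemma sg_dgr n a : inA (@dgr R A n) a -> sg a = (-1) ^+ n *: a.
Proof.
apply: (lin_eq sgL) => [c x y|al na <-]; last exact: sg_mon.
by rewrite scalerDr !scalerA mulrC.
Qed.

Lemma compL (V W Z : lmodType R) (f : V -> W) (g : W -> Z) :
  linear f -> linear g -> linear (fun x => g (f x)).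
Proof. by move=> fL gL c x y; rewrite fL gL. Qed.

Lemma oppL (V W : lmodType R) (f : V -> W) : linear f -> linear (fun x => - f x).
Proof. by move=> fL c x y; rewrite fL opprD scalerN. Qed.

Lemma addL (V W : lmodType R) (f g : V -> W) :
  linear f -> linear g -> linear (fun x => f x + g x).
Proof. by move=> fL gL c x y; rewrite fL gL scalerDr addrACA. Qed.

Lemma sgK a : sg (sg a) = a.
Proof.
apply: (lin_eq (compL sgL sgL) (@idL _ _)) (inAT a) => al na _ /=.
by rewrite sg_mon // (linZ _ _ sgL) sg_mon // signZK.
Qed.

Lemma sg1 : sg 1 = 1.
Proof. by rewrite -mon0 sg_mon ?edeg0 ?scale1r //; exact: nrm0. Qed.

Lemma sgM a b : sg (a * b) = sg a * sg b.
Proof.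
apply: (lin_eq (compL (mulrL b) sgL) (compL sgL (mulrL (sg b)))) (inAT a) => al na _.
apply: (lin_eq (compL (mulL (mon al)) sgL) (compL sgL (mulL (sg (mon al))))) (inAT b) => be nb _.
rewrite /= (@sg_dgr (edeg al + edeg be)); last first.
  by apply: inA_mul_dgr; apply: inA_mon.
by rewrite !sg_mon // -scalerAl -scalerAr scalerA exprD.
Qed.

Lemma sg_dif a : sg (d a) = - d (sg a).
Proof.
apply: (lin_eq (compL difL sgL) (oppL (compL sgL difL))) (inAT a) => al na _ /=.
rewrite sg_mon // (linZ _ _ difL).
have : inA (@dgr R A (edeg al)) (mon al) by apply: inA_mon.
case: (edeg al) => [/dif_dgr0 ->|n /dif_dgr dn]; first by rewrite (lin0 sgL) scaler0 oppr0.
by rewrite (sg_dgr dn) exprS mulN1r scaleNr opprK.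
Qed.

Lemma sg_var q a : inA (@le_var R A q) a -> inA (@le_var R A q) (sg a).
Proof.
apply: (inA_ind (Q := [set a | inA (@le_var R A q) (sg a)])) => [|al na qa].
  split=> [|c x y dvx dvy]; first by rewrite /= (lin0 sgL); apply: submod0; exact: inA_submod.
  by rewrite /= sgL; case: (inA_submod (@le_var R A q)) => _; apply.
rewrite /= sg_mon //; apply: submod_Z; [exact: inA_submod | exact: inA_mon].
Qed.

Lemma dif_mul a b : d (a * b) = d a * b + sg a * d b.
Proof.
apply: (lin_eq (compL (mulrL b) difL)
  (addL (compL difL (mulrL b)) (compL sgL (mulrL (d b))))) (inAT a) => al na _ /=.
rewrite (leibniz _ (n := edeg al)); last by apply/homogE; apply: inA_mon.
by rewrite sg_mon // signE scalerAl.
Qed.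

(** Asserting the identity for every large [l'] makes the property stable under sums. *)
Lemma prj_dgr_sum a : exists l, forall l', (l <= l')%N -> a = \sum_(n < l') prj (@dgr R A n) a.
Proof.
apply: (inA_ind (P := setT) (Q := [set a | exists l, forall l', (l <= l')%N ->
  a = \sum_(n < l') prj (@dgr R A n) a])) (inAT a) => [|al na _].
  split=> [|c x y [l lP] [l1 l1P]].
    by exists 0%N => l' _; rewrite big1 // => i _; rewrite (lin0 (@prjL _ _ _)).
  exists (maxn l l1) => l'; rewrite geq_max => /andP[/lP xE /l1P yE].
  rewrite {1}xE {1}yE scaler_sumr -big_split; apply: eq_bigr => i _.
  by rewrite prjL.
exists (edeg al).+1 => l' lt; rewrite (bigD1 (Ordinal lt)) //= prj_mon // asboolT //.
rewrite big1 ?addr0 // => i ne; rewrite prj_mon // asboolF // => e.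
by move: ne; rewrite -val_eqE /= -e eqxx.
Qed.

Lemma prj_dgr_in n P a : inA P a -> inA (P `&` @dgr R A n) (prj (@dgr R A n) a).
Proof. by move=> /(prj_in (@dgr R A n)); apply: inA_sub => al []. Qed.

Lemma homog_decomp_exists a : exists l, homog_decomp a l.+1 (fun n => prj (@dgr R A n) a).
Proof.
have [l lP] := prj_dgr_sum a; exists l; split; last exact: lP.
by move=> n; apply/homogE; apply: inA_sub (prj_dgr_in n (inAT a)) => al [].
Qed.

Lemma barE a : bar a = - sg a.
Proof.
rewrite /bar; case: xgetP => [b -> [l [f [[fh ->] ->]]]|].
  rewrite (lin_sum _ _ _ sgL) -sumrN; apply: eq_bigr => n _.
  by rewrite (@sg_dgr n) ?signE ?exprS ?mulN1r ?scaleNr //; apply/homogE.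
have [l lP] := homog_decomp_exists a.
by move=> /(_ (\sum_(n < l.+1) (-1) ^+ n.+1 * prj (@dgr R A n) a)); case; do 2 eexists; split; first exact: lP.
Qed.

(** The coefficient of the monomial 1 is kept in R, since constants have to be subtracted before
    they are reduced to k; [pi] of it is the augmentation ([augE]). *)
Definition aug0 : A -> R := ext (fun al => ((al == @e0 R A)%:R : R^o)).

Lemma aug0L : linear (aug0 : A -> R^o). Proof. exact: extL. Qed.

Lemma aug0_mon al : nrm al -> aug0 (mon al) = (al == @e0 R A)%:R.
Proof. by move=> na; rewrite /aug0 ext_mon. Qed.

Lemma aug0_1 : aug0 1 = 1.
Proof. by rewrite -mon0 aug0_mon ?eqxx //; exact: nrm0. Qed.

Lemma aug0_const (r : R) : aug0 r%:A = r.
Proof. by rewrite (linZ _ _ aug0L) aug0_1 [LHS]mulr1. Qed.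

Lemma aug0_dgr n a : (0 < n)%N -> inA (@dgr R A n) a -> aug0 a = 0.
Proof.
move=> n0; apply: (lin_eq aug0L (g := fun=> 0)) => [c x y|al na da].
  by rewrite scaler0 addr0.
rewrite aug0_mon //; case: eqP => // e.
by move: n0; rewrite -da e edeg0.
Qed.

Lemma aug0_mul a b : aug0 (a * b) = aug0 a * aug0 b.
Proof.
have mR (c : R^o) : linear (fun x : R^o => x * c : R^o).
  by move=> e x y; rewrite mulrDl scalerAl.
have mL (c : R^o) : linear (fun x : R^o => c * x : R^o).
  by move=> e x y; rewrite mulrDr scalerAr.
apply: (lin_eq (compL (mulrL b) aug0L) (compL aug0L (mR (aug0 b)))) (inAT a) => al na _.
apply: (lin_eq (compL (mulL (mon al)) aug0L) (compL aug0L (mL (aug0 (mon al))))) (inAT b) => be nb _ /=.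
case: (posnP (edeg al)) => [dal|pos]; last first.
  rewrite (aug0_dgr (n := edeg al) _ (a := mon al)) ?mul0r //; last exact: inA_mon.
  rewrite (aug0_dgr (n := edeg al + edeg be)) ?addn_gt0 ?pos //.
  by apply: inA_mul_dgr; apply: inA_mon.
have [r rE] : exists r : R, mon al = r%:A by apply: inA_dgr0; apply: inA_mon.
by rewrite rE aug0_const -scalerAl mul1r (linZ _ _ aug0L).
Qed.

Section Aug.
Variables (k : fieldType) (pi : {rmorphism R -> k}).

Lemma augE a : aug pi a = pi (aug0 a).
Proof.
rewrite /aug; case: xgetP => [c -> [l [f [r [[fh ->] f0 ->]]]]|].
  rewrite (lin_sum _ _ _ aug0L) big_ord_recl /= f0 aug0_const big1 ?addr0 // => i _.
  by apply: (aug0_dgr (n := lift ord0 i)) => //; apply/homogE.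
have [l lP] := homog_decomp_exists a.
have [r rE] := inA_dgr0 (inA_sub (fun _ => @proj2 _ _) (prj_dgr_in 0 (inAT a))).
by move=> /(_ (pi r)); case; exists l, (fun n => prj (@dgr R A n) a), r.
Qed.

End Aug.
End TateStructure.

(** * The acyclic closure *)

Section AcyclicClosure.
Variables (R : comNzRingType) (m : set R) (k : fieldType) (pi : {rmorphism R -> k}).
Hypothesis residue : residue_map m pi.
Variable A : tate_algebra R.
Hypothesis acl : is_acyclic_closure m A.
Implicit Types (al be : texpo A) (P Q : set (texpo A)) (a b : A).
Local Notation d := (dif A).

Lemma pi_surj : forall y, exists x, pi x = y. Proof. by case: residue. Qed.

Lemma kill_const (r : R) : pi r = 0 ->
  exists h : A, inA (@dgr R A 1) h /\ d h = r%:A.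
Proof.
move=> r0; have mr : m r by apply/residue.2.
case: acl => -[_ gen _] _; have [|c] := gen r%:A; first by exists r.
move=> /= /eqP; rewrite subr_eq0 => /eqP ->.
exists (\sum_i c i *: dp i 1%N); split.
  apply: submod_sum => [|i _]; first exact: inA_submod.
  apply: submod_Z; first exact: inA_submod.
  by have [_] := vpow_in (existT _ 1%N i : tvar A) 1.
by rewrite (lin_sum _ _ _ (@difL R A)); apply: eq_bigr => i _; rewrite (linZ _ _ (@difL R A)).
Qed.

Lemma aug_dif_vpow (t : tvar A) i : pi (aug0 (d (vpow t i))) = 0.
Proof.
have v1 : pi (aug0 (d (vpow t 1))) = 0.
  have [_] := vpow_in t 1; rewrite muln1.
  case: t => -[|[|n]] x /=.
  - by move/dif_dgr0 => ->; rewrite (lin0 (@aug0L R A)) rmorph0.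
  - move=> _; case: acl => -[/(_ x) [r mr rE] _ _] _.
    by rewrite /vpow /= -rE aug0_const; apply/residue.2.
  by move/dif_dgr/(aug0_dgr (ltn0Sn n)) => ->; rewrite rmorph0.
case: i => [|i]; first by rewrite /vpow dp0 dif1 (lin0 (@aug0L R A)) rmorph0.
have [od|ev] := boolP (odd (tag t)); last first.
  by rewrite /vpow dif_dp // aug0_mul rmorphM -/(vpow t 1) v1 mul0r.
case: i => [//|i]; rewrite /vpow dp_odd // (lin0 (@difL R A)) (lin0 (@aug0L R A)).
by rewrite rmorph0.
Qed.

(** Variables of degree 1 are mapped into the maximal ideal and the differentials of the others have
    augmentation zero as well; Leibniz's rule extends this to monomials. *)
Lemma aug_dif a : pi (aug0 (d a)) = 0.
Proof.
apply: (inA_ind (P := setT) (Q := [set a | pi (aug0 (d a)) = 0])) (inAT a) => [|al [q qal] _].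
  split=> [|c x y /= x0 y0]; first by rewrite /= (lin0 (@difL R A)) (lin0 (@aug0L R A)) rmorph0.
  by rewrite /= difL aug0L rmorphD rmorphM x0 y0 mulr0 addr0.
rewrite /= -(monE qal) monomialE.
elim: (upto _ _) => [|t s IH].
  by rewrite /mono big_nil dif1 (lin0 (@aug0L R A)) rmorph0.
rewrite /mono big_cons -/(mono s al) dif_mul (linD _ _ (@aug0L R A)) !aug0_mul.
by rewrite rmorphD !rmorphM IH aug_dif_vpow mulr0 mul0r addr0.
Qed.

(** For degree reasons the cycle lies in the stage of variables of degree at most [n.+1], where the
    variables of degree [n.+2] kill its class. *)
Lemma tate_acyclic n a : inA (@dgr R A n.+1) a -> d a = 0 ->
  exists b, inA (@dgr R A n.+2) b /\ d b = a.
Proof.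
move=> na da; case: acl => _ /(_ n.+1 isT) [_ gen _].
have [|c] := gen a.
  by split=> //; [apply/stageE; apply: inA_dgr_le_var na | apply/homogE].
move=> [w [_ /homogE dw] wE].
exists (w + \sum_i c i *: dp i 1%N); split; last first.
  rewrite (linD _ _ (@difL R A)) wE (lin_sum _ _ _ (@difL R A)).
  under [X in _ + X = _]eq_bigr do rewrite (linZ _ _ (@difL R A)).
  by rewrite subrK.
apply: submod_D => //; first exact: inA_submod.
apply: submod_sum => [|i _]; first exact: inA_submod.
apply: submod_Z; first exact: inA_submod.
by have [_] := vpow_in (existT _ n.+2 i : tvar A) 1; rewrite muln1.
Qed.

Section Subcomplex.
Variable P : set (texpo A).
Hypothesis PC : forall a, inA P a -> inA P (d a).

Lemma subcx_gd_gr n a : inA (P `&` @dgr R A n.+1) a -> inA (P `&` @dgr R A n) (d a).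
Proof.
move=> Pa; apply: inAI.
  by apply: PC; apply: inA_sub Pa => al [].
by apply: dif_dgr; apply: inA_sub Pa => al [].
Qed.

Lemma subcx_gd0 a : inA (P `&` @dgr R A 0) a -> d a = 0.
Proof. by move=> Pa; apply: dif_dgr0; apply: inA_sub Pa => al []. Qed.

Definition subcx : gcomplex R :=
  @GComplex R A (fun n => inA (P `&` @dgr R A n)) d (@difL R A)
    (fun n => inA_submod _) subcx_gd_gr subcx_gd0 (fun n a _ => difK a).

End Subcomplex.

Definition tA : gcomplex R := @subcx setT (fun a _ => inAT (d a)).
Definition tU q : gcomplex R := @subcx (@le_var R A q) (@dif_var R A q).

Definition utgr q n : set A :=
  [set a | inA (@le_var R A q `&` @dgr R A n) a /\ pi (aug0 a) = 0].

Lemma utgrS q n : submod (utgr q n).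
Proof.
split=> [|c x y [gx x0] [gy y0]].
  by split; [apply: submod0; exact: inA_submod | rewrite (lin0 (@aug0L R A)) rmorph0].
split; first by case: (inA_submod (@le_var R A q `&` @dgr R A n)) => _; apply.
by rewrite aug0L rmorphD rmorphM x0 y0 mulr0 addr0.
Qed.

Lemma utgr_gd q n a : utgr q n.+1 a -> utgr q n (d a).
Proof. by move=> [ga _]; split; [apply: subcx_gd_gr => //; apply: dif_var | exact: aug_dif]. Qed.

Definition tUt q : gcomplex R :=
  @GComplex R A (utgr q) d (@difL R A) (utgrS q) (@utgr_gd q)
    (fun a Ha => @subcx_gd0 (@le_var R A q) a Ha.1) (fun n a _ => difK a).

Lemma tU_tUt q n a : inA (@le_var R A q `&` @dgr R A n.+1) a -> utgr q n.+1 a.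
Proof.
move=> ga; split=> //; rewrite (aug0_dgr (n := n.+1)) ?rmorph0 //.
by apply: inA_sub ga => al [].
Qed.

Definition augmap (n : nat) (a : A) : kmod pi := pi (aug0 a).

Lemma augmapL n : linear (augmap n).
Proof. by move=> c x y; rewrite /augmap aug0L rmorphD rmorphM. Qed.

Lemma augmap_gr n a : inA (@dgr R A n) a -> n = 0%N \/ augmap n a = 0.
Proof.
case: n => [|n] ga; [by left | right].
by rewrite /augmap (aug0_dgr (ltn0Sn n) ga) rmorph0.
Qed.

Lemma inAIr P Q a : inA (P `&` Q) a -> inA Q a.
Proof. by apply: inA_sub => al []. Qed.

Lemma inAIl P Q a : inA (P `&` Q) a -> inA P a.
Proof. by apply: inA_sub => al []. Qed.

Lemma tA_kc : qiso tA (kc pi).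
Proof.
exists augmap; split.
  split=> [n|n a ga|n a ga]; first exact: augmapL.
    exact/augmap_gr/inAIr/ga.
  by rewrite /= /augmap aug_dif.
move=> n x y gx gy dx xE.
(* The index [n] is the degree in the cone: [x] has degree [n - 1]. So [n = 1] concerns constants,
   and acyclicity in positive degrees applies from [n = 2] on. *)
have [x' [gx' dx']] : exists x', inA (setT `&` @dgr R A n) x' /\ d x' = x.
  case: n gx gy xE => [|[|n]] gx gy xE.
  - by exists 0; rewrite (lin0 (@difL R A)); split=> //; apply: submod0; exact: inA_submod.
  - have [r rE] := inA_dgr0 (inAIr gx); subst x.
    have [|h [gh dh]] := @kill_const r; first by rewrite -[RHS]xE /= /augmap aug0_const.
    by exists h; split=> //; apply: inAI gh; exact: inAT.
  have [h [gh dh]] := tate_acyclic (inAIr gx) dx.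
  by exists h; split=> //; apply: inAI gh; exact: inAT.
have [r rE] := pi_surj (y - augmap n x' : k).
have gr1 : inA (setT `&` @dgr R A 0) r%:A by apply: inAI (@inA_const R A r); exact: inAT.
case: n gx gy xE gx' rE => [|n] gx gy xE gx' rE.
  exists (x' + r%:A), 0; split.
  - by apply: submod_D => //; exact: inA_submod.
  - by right.
  - by rewrite /= (linD _ _ (@difL R A)) dx' (dif_dgr0 (inA_const _ _)) addr0.
  - rewrite /= addr0 /augmap (linD _ _ (@aug0L R A)) aug0_const rmorphD rE.
    by rewrite /augmap addrC subrK.
exists x', 0; split=> //; first by right.
case: gy => // ->; rewrite /= addr0.
by have [] := augmap_gr (inAIr gx').
Qed.

Lemma ses_Ut_U q : @ses R (tUt q) (tU q) (kc pi) (fun _ a => a) augmap.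
Proof.
split.
- by split=> // n a [].
- split=> [n|n a ga|n a ga]; first exact: augmapL.
    exact/augmap_gr/inAIr/ga.
  by rewrite /= /augmap aug_dif.
- by [].
- move=> n y gy; split=> [y0|[x [_ x0] ->] //]; by exists y.
move=> n z gz; have [r rE] := pi_surj (z : k).
case: n gz => [|n] [//|->].
- move=> _; exists r%:A; last by rewrite /augmap aug0_const.
  apply: inAI (inA_const _ _); apply: inA_dgr_le_var (inA_const _ _); exact: leq0n.
- by exists 0; [exact: gr0 | rewrite /augmap (lin0 (@aug0L R A)) rmorph0].
- by exists 0; [exact: gr0 | rewrite /augmap (lin0 (@aug0L R A)) rmorph0].
Qed.

Section NullHomotopic.
Variables (q : nat) (q1 : (1 <= q)%N).

Lemma mul_dgr1 n (h a : A) : inA (@dgr R A 1) h ->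
  inA (@le_var R A q `&` @dgr R A n) a -> inA (@le_var R A q `&` @dgr R A n.+1) (h * a).
Proof.
move=> gh ga; apply: inAI.
  by apply: inA_mul_var (inAIl ga); apply: inA_dgr_le_var gh.
by rewrite -add1n; apply: inA_mul_dgr (inAIr ga).
Qed.

Lemma homotopy_dgr1 (h a : A) (r : R) : inA (@dgr R A 1) h -> d h = r%:A ->
  d (h * a) + h * d a = r *: a.
Proof.
move=> gh dh; rewrite dif_mul dh (sg_dgr gh) expr1 scaleN1r mulNr -addrA addNr addr0.
by rewrite -scalerAl mul1r.
Qed.

(** The homotopy is multiplication by an element of degree 1 with differential [r], which lies in
    the stage because [q] is at least 1. *)
Lemma null_homotopic_tU r : pi r = 0 -> null_homotopic r (tU q).
Proof.
move=> /kill_const [h [gh dh]]; exists (fun a => h * a); split.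
- exact: mulL.
- by move=> n a; apply: mul_dgr1.
- by move=> n a _; apply: homotopy_dgr1.
Qed.

Lemma null_homotopic_tUt r : pi r = 0 -> null_homotopic r (tUt q).
Proof.
move=> /kill_const [h [gh dh]]; exists (fun a => h * a); split.
- exact: mulL.
- by move=> n a [ga _]; apply: tU_tUt; apply: mul_dgr1.
- by move=> n a _; apply: homotopy_dgr1.
Qed.

End NullHomotopic.

(** All exponents bounded by [n] on the variables in [s]. Exponents do not exceed the degree, so the
    size of this list bounds the number of monomials of degree [n] by a polynomial. *)
Fixpoint expos (s : seq (tvar A)) n : seq (texpo A) :=
  if s is t :: s' then
    [seq (fun j i => if existT _ j i == t then e else (al : texpo A) j i) : texpo A
       | al <- expos s' n, e <- iota 0 n.+1]
  else [:: @e0 R A].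

Lemma size_expos s n : size (expos s n) = (n.+1 ^ size s)%N.
Proof.
elim: s => // t s IH.
by apply: etrans (size_allpairs _ _ _) _; rewrite IH size_iota mulnC expnS.
Qed.

Lemma mem_expos s n al : (forall t, vexp al t <= n)%N ->
  (forall t, t \notin s -> vexp al t = 0%N) -> al \in expos s n.
Proof.
elim: s al => [|t s IH] al le supp.
  rewrite inE; apply/eqP; apply: functional_extensionality_dep => j; apply/funext => i.
  exact: supp (existT _ j i) isT.
apply/allpairsP.
pose al' : texpo A := fun j i => if existT _ j i == t then 0%N else al j i.
exists (al', vexp al t); split=> /=.
- apply: IH => [[j i]|[j i] ns]; rewrite /vexp /al' /=.
    by case: eqP => // _; apply: (le (existT _ j i)).
  case: eqP => // /eqP ne; apply: (supp (existT _ j i)).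
  by rewrite inE negb_or ne.
- by rewrite -[0%N :: _]/(iota 0 n.+1) mem_iota /= add0n ltnS.
apply: functional_extensionality_dep => j; apply/funext => i; rewrite /al'.
by case: eqP => // <-.
Qed.

Lemma vexp_le_edeg al t : nrm al -> (vexp al t <= edeg al)%N.
Proof.
case: t => j i na; rewrite /vexp /=; have [b1 _] := bndP na.
case: (ltnP (bnd al) j) => [/b1 -> //|le].
have jq : (j < (bnd al).+1)%N by [].
rewrite /edeg /expo_deg (bigD1 (Ordinal jq)) //= (bigD1 i) //= -addnA.
apply: leq_trans (leq_addr _ _); rewrite leq_pmull //.
by case: j i {le jq} => // -[j' H]; rewrite nvar0 in H.
Qed.

Definition degexpos q n : seq (texpo A) :=
  undup [seq al <- expos (upto (nvar A) q) n | `[< normal_expo q al /\ edeg al = n >]].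

Lemma mem_degexpos q n al :
  (al \in degexpos q n) = `[< normal_expo q al /\ edeg al = n >].
Proof.
rewrite mem_undup mem_filter; case: asboolP => //= -[qal dal].
apply: mem_expos => [t|[j i]]; first by rewrite -dal; apply: vexp_le_edeg; exists q.
by rewrite mem_upto /= -ltnNge => lt; rewrite /vexp /=; apply: qal.1.
Qed.

Lemma fin_gen_tU q n : fin_gen (@gr R (tU q) n).
Proof.
exists (size (degexpos q n)), (fun i => mon (nth (@e0 R A) (degexpos q n) i)).
have dP al : al \in degexpos q n -> normal_expo q al /\ edeg al = n.
  by rewrite mem_degexpos => /asboolP.
split=> [i|a].
  have [qi di] := dP _ (mem_nth (@e0 R A) (ltn_ord i)).
  by apply: inA_mon; [exists q|split].
apply: (inA_ind (Q := [set a : A | exists c : 'I_(size (degexpos q n)) -> R,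
  a = \sum_i c i *: mon (nth (@e0 R A) (degexpos q n) i)])) => [|al na [qal dal]].
  split=> [|e x y [c ->] [c' ->]].
    by exists (fun=> 0); rewrite big1 // => i _; rewrite scale0r.
  exists (fun i => e * c i + c' i); rewrite scaler_sumr -big_split.
  by apply: eq_bigr => i _; rewrite scalerDl scalerA.
have al_in : al \in degexpos q n by rewrite mem_degexpos; apply/asboolP.
have lt : (index al (degexpos q n) < size (degexpos q n))%N by rewrite index_mem.
exists (fun i => (i == Ordinal lt)%:R); rewrite (bigD1 (Ordinal lt)) //= eqxx scale1r.
rewrite nth_index // big1 ?addr0 // => i ne.
by rewrite (negPf ne) scale0r.
Qed.

End AcyclicClosure.

(** * Massey operations and the augmentation kernel *)

Section FormalSums.
Variables (R : comNzRingType) (A : algType R) (I : eqType).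
Implicit Types (l : seq (A * seq I)) (w : seq I).

(* A list [l] stands for the finite sum of the [x.1 (x) x.2], an element of
   A (x) T(I); [cfw l w] is its coefficient at the word [w], and [ev psi] is the
   linear map with values [psi w u] at [u (x) w]. *)
Definition ev (V : lmodType R) (psi : seq I -> A -> V) l : V :=
  \sum_(x <- l) psi x.2 x.1.

Definition cfw l w : A := ev (fun w' u => if w' == w then u else 0) l.

Lemma ev_cat (V : lmodType R) (psi : seq I -> A -> V) l l' :
  ev psi (l ++ l') = ev psi l + ev psi l'.
Proof. by rewrite /ev big_cat. Qed.

Lemma ev_cons (V : lmodType R) (psi : seq I -> A -> V) x l :
  ev psi (x :: l) = psi x.2 x.1 + ev psi l.
Proof. by rewrite /ev big_cons. Qed.

Lemma ev_nil (V : lmodType R) (psi : seq I -> A -> V) : ev psi [::] = 0.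
Proof. by rewrite /ev big_nil. Qed.

Lemma ev_flatten (V : lmodType R) (psi : seq I -> A -> V) (T : Type)
    (F : T -> seq (A * seq I)) (s : seq T) :
  ev psi (flatten [seq F x | x <- s]) = \sum_(x <- s) ev psi (F x).
Proof.
elim: s => [|x s IH] /=; first by rewrite ev_nil big_nil.
by rewrite ev_cat big_cons IH.
Qed.

Definition fscale (c : R) l := [seq (c *: x.1, x.2) | x <- l].

Lemma ev_fscale (V : lmodType R) (psi : seq I -> A -> V) c l :
  (forall w, linear (psi w)) -> ev psi (fscale c l) = c *: ev psi l.
Proof.
move=> pL; rewrite /ev big_map scaler_sumr; apply: eq_bigr => x _.
by rewrite (linZ _ _ (pL _)).
Qed.

Lemma cfwL w : forall w', linear (fun u : A => if w' == w then u else 0).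
Proof. by move=> w' c x y; case: eqP => // _; rewrite scaler0 addr0. Qed.

Lemma ev_lin (V W : lmodType R) (psi : seq I -> A -> V) (f : V -> W) l :
  linear f -> f (ev psi l) = ev (fun w u => f (psi w u)) l.
Proof. by move=> fL; rewrite /ev (lin_sum _ _ _ fL). Qed.

Lemma ev_eq_in (V : lmodType R) (psi psi' : seq I -> A -> V) l :
  (forall x, x \in l -> psi x.2 x.1 = psi' x.2 x.1) -> ev psi l = ev psi' l.
Proof. by move=> H; rewrite /ev big_seq [RHS]big_seq; apply: eq_bigr. Qed.

Lemma ev_cfw (V : lmodType R) (psi : seq I -> A -> V) l :
  (forall w, linear (psi w)) ->
  ev psi l = \sum_(w <- undup (map snd l)) psi w (cfw l w).
Proof.
move=> pL; rewrite /cfw.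
under [RHS]eq_bigr do rewrite (ev_lin _ _ (pL _)).
rewrite /ev exchange_big big_seq [RHS]big_seq; apply: eq_bigr => x xl.
rewrite (bigD1_seq x.2) ?undup_uniq ?mem_undup ?map_f //= eqxx big1 ?addr0 // => w ne.
by rewrite eq_sym (negPf ne) (lin0 (pL _)).
Qed.

Lemma ev0 (V : lmodType R) (psi : seq I -> A -> V) l :
  (forall w, linear (psi w)) -> (forall w, cfw l w = 0) -> ev psi l = 0.
Proof.
by move=> pL l0; rewrite ev_cfw // big1 // => w _; rewrite l0 (lin0 (pL _)).
Qed.

(** Lists with the same coefficients stand for the same tensor, so linear maps do not distinguish
    them. *)
Lemma ev_eq (V : lmodType R) (psi : seq I -> A -> V) l l' :
  (forall w, linear (psi w)) -> (forall w, cfw l w = cfw l' w) -> ev psi l = ev psi l'.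
Proof.
move=> pL ll'; apply/eqP; rewrite -subr_eq0; apply/eqP.
have := @ev0 V psi (l ++ fscale (-1) l') pL.
rewrite ev_cat ev_fscale // scaleN1r; apply=> w.
by rewrite /cfw ev_cat ev_fscale ?scaleN1r -/(cfw l w) ?ll' ?subrr //; exact: cfwL.
Qed.

Lemma cfw_mem l w : cfw l w != 0 -> w \in map snd l.
Proof.
apply: contraNT => nw; rewrite /cfw /ev big_seq big1 // => x xl.
by case: eqP => // e; rewrite -e map_f in nw.
Qed.

End FormalSums.

(** Two successive cuts of a word, at [j] and then at [i + j], are indexed by the later one. *)
Lemma triangular_sum (V : nmodType) n (F : nat -> nat -> V) :
  \sum_(1 <= j < n.+1) \sum_(1 <= i < (n - j).+1) F j (i + j)%N =
  \sum_(1 <= s < n.+1) \sum_(1 <= j < s) F j s.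
Proof.
transitivity (\sum_(1 <= j < n.+1) \sum_(1 <= s < n.+1 | (j < s)%N) F j s).
  rewrite big_nat [RHS]big_nat; apply: eq_bigr => j /andP[j1 jn].
  rewrite -subSn; last by rewrite -ltnS.
  rewrite -(big_addn 1 n.+1 j xpredT (F j)) add1n.
  rewrite big_nat_cond [RHS]big_nat_cond (big_nat_widenl _ 1 _) //.
  by apply: eq_bigl => s; rewrite !andbT; case: (ltnP j s) => js; rewrite ?andbF ?andbT //=; lia.
rewrite (exchange_big_dep_nat xpredT) //=; apply: eq_big_nat => s /andP[s1 sn].
rewrite big_nat_cond [RHS]big_nat_cond [RHS](big_nat_widen _ _ n.+1) //; last exact: ltnW.
by apply: eq_bigl => j; rewrite !andbT; case: (ltnP j s) => js; rewrite ?andbF ?andbT //; lia.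
Qed.

(** * The bar-type resolution and the maps it induces *)

Section MasseyMaps.
Variables (R : comNzRingType) (m : set R) (k : fieldType) (pi : {rmorphism R -> k}).
Hypothesis residue : residue_map m pi.
Variable A : tate_algebra R.
Hypothesis acl : is_acyclic_closure m A.
Variables (q : nat) (v : nat -> nat).
Local Notation d := (dif A).
Local Notation U := (inA (@le_var R A q)).
Let I := {j : nat & 'I_(v j)}.
(* [g] is the Massey operation on words in a basis [z] of the homology of Ut. *)
Variables (z : I -> A) (g : seq I -> A).
Let Ut : gcomplex R := tUt residue acl q.
Hypothesis zP : forall t, @cyc R Ut (tag t) (z t).
Hypothesis zi : forall j, indep pi (@bdr R Ut j) (fun i => z (existT _ j i)).
Hypothesis zs : forall j a, @cyc R Ut j a ->
  exists c : 'I_(v j) -> R, @bdr R Ut j (a - \sum_i c i *: z (existT _ j i)).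
Hypothesis gP : forall w, (0 < size w)%N -> U (g w) /\ pi (aug0 (g w)) = 0.
Hypothesis g1 : forall t, d (g [:: t]) = 0 /\ exists2 b, U b & g [:: t] = z t + d b.
Hypothesis gM : forall w, (0 < size w)%N ->
  d (g w) = - \sum_(1 <= j < size w) sg (g (take j w)) * g (drop j w).
Hypothesis g2 : forall u t, U u -> d u = 0 -> pi (aug0 u) = 0 ->
  exists2 b, U b & sg u * g [:: t] = d b.
Implicit Types (l : seq (A * seq I)) (w : seq I) (t : I) (a b u : A).

Let dL : linear d := @difL R A.
Let sL : linear (@sg R A) := @sgL R A.

Definition stg l : Prop := forall x, x \in l -> U x.1.

Lemma stg_cat l l' : stg l -> stg l' -> stg (l ++ l').
Proof. by move=> h h' x; rewrite mem_cat => /orP[/h|/h']. Qed.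

Lemma stg_fscale c l : stg l -> stg (fscale c l).
Proof. by move=> h x /mapP[y yl ->]; apply: submod_Z; [exact: inA_submod | exact: h]. Qed.

Lemma stg_cfw l w : stg l -> U (cfw l w).
Proof.
move=> h; rewrite /cfw /ev big_seq; apply: submod_sum => [|x xl]; first exact: inA_submod.
by case: eqP => _; [exact: h | apply: submod0; exact: inA_submod].
Qed.

(* The differential u (x) w |-> du (x) w + sum_j sg(u) g(w_{<= j}) (x) w_{> j}. *)
Definition Dl l : seq (A * seq I) :=
  flatten [seq (d x.1, x.2) ::
    [seq (sg x.1 * g (take j x.2), drop j x.2) | j <- iota 1 (size x.2)] | x <- l].

(** The transpose of [Dl] ([ev_Dl]): identities for [Dl] are checked on one elementary tensor
    against an arbitrary [psi]. *)
Definition dual (V : lmodType R) (psi : seq I -> A -> V) w u : V :=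
  psi w (d u) + \sum_(1 <= j < (size w).+1) psi (drop j w) (sg u * g (take j w)).

Lemma ev_Dl (V : lmodType R) (psi : seq I -> A -> V) l :
  ev psi (Dl l) = ev (dual psi) l.
Proof.
rewrite /Dl ev_flatten {2}/ev; apply: eq_bigr => x _.
rewrite ev_cons /dual /=; congr (_ + _).
by rewrite /ev big_map /index_iota subn1.
Qed.

Lemma dualL (V : lmodType R) (psi : seq I -> A -> V) :
  (forall w, linear (psi w)) -> forall w, linear (dual psi w).
Proof.
move=> pL w c x y; rewrite /dual dL pL scalerDr [RHS]addrACA; congr (_ + _).
rewrite scaler_sumr -big_split; apply: eq_bigr => j _ /=.
by rewrite sL mulrDl -scalerAl pL.
Qed.

(** The square of the differential is zero: at a cut [s] the Massey relation gives a sum over the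
    earlier cuts [j < s], and cutting twice gives the same sum with the opposite sign. *)
Lemma dual_dual (V : lmodType R) (psi : seq I -> A -> V) w u :
  (forall w, linear (psi w)) -> dual (dual psi) w u = 0.
Proof.
move=> pL; rewrite /dual difK (lin0 (pL _)) add0r.
rewrite big_split /= addrA -big_split /=.
have E1 : \sum_(1 <= j < (size w).+1) (psi (drop j w) (sg (d u) * g (take j w)) +
    psi (drop j w) (d (sg u * g (take j w)))) =
  - \sum_(1 <= s < (size w).+1) \sum_(1 <= j < s)
     psi (drop s w) (u * (sg (g (take j w)) * g (take (s - j) (drop j w)))).
  rewrite -sumrN big_nat [RHS]big_nat; apply: eq_bigr => s /andP[s1 sn].
  rewrite -(linD _ _ (pL _)) sg_dif dif_mul mulNr addrA addNr add0r sgK.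
  rewrite gM; last by rewrite size_takel.
  rewrite mulrN (linN _ (pL _)) size_takel // mulr_sumr (lin_sum _ _ _ (pL _)).
  congr (- _); rewrite big_nat [RHS]big_nat; apply: eq_bigr => j /andP[j1 js].
  by rewrite take_takel ?(ltnW js) // take_drop subnK // ltnW.
have E2 : \sum_(1 <= j < (size w).+1) \sum_(1 <= i < (size (drop j w)).+1)
    psi (drop i (drop j w)) (sg (sg u * g (take j w)) * g (take i (drop j w))) =
  \sum_(1 <= s < (size w).+1) \sum_(1 <= j < s)
     psi (drop s w) (u * (sg (g (take j w)) * g (take (s - j) (drop j w)))).
  rewrite -triangular_sum; apply: eq_bigr => j _; rewrite size_drop; apply: eq_bigr => i _.
  by rewrite drop_drop addnK sgM sgK mulrA.
by rewrite E1 E2 addNr.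
Qed.

Lemma stg_Dl l : stg l -> stg (Dl l).
Proof.
move=> h x /flattenP[s /mapP[y yl ->]]; rewrite inE => /orP[/eqP -> /=|/mapP[j]].
  by apply: dif_var; apply: h.
rewrite mem_iota add1n => /andP[j1 jn] -> /=.
apply: inA_mul_var; first by apply: sg_var; apply: h.
by have [] := gP (w := take j y.2); rewrite ?size_takel.
Qed.

Lemma Dl_Dl l w : cfw (Dl (Dl l)) w = 0.
Proof.
rewrite /cfw !ev_Dl /ev big1 // => x _; apply: dual_dual => w'; exact: cfwL.
Qed.

Lemma Dl_eq l l' : (forall w, cfw l w = cfw l' w) -> forall w, cfw (Dl l) w = cfw (Dl l') w.
Proof. by move=> e w; rewrite /cfw !ev_Dl; apply: ev_eq e; apply: dualL; exact: cfwL. Qed.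

Lemma piaug_sum (T : eqType) (s : seq T) (F : T -> A) :
  (forall x, x \in s -> pi (aug0 (F x)) = 0) -> pi (aug0 (\sum_(x <- s) F x)) = 0.
Proof.
by move=> F0; rewrite (lin_sum _ _ _ (@aug0L R A)) rmorph_sum big_seq big1.
Qed.

Lemma aug_Dl l w : pi (aug0 (cfw (Dl l) w)) = 0.
Proof.
rewrite /cfw ev_Dl /ev; apply: piaug_sum => x _; rewrite /dual.
rewrite (linD _ _ (@aug0L R A)) rmorphD [X in X + _](_ : _ = 0) ?add0r; last first.
  by case: eqP => _; [exact: (aug_dif residue acl) | rewrite (lin0 (@aug0L R A)) rmorph0].
apply: piaug_sum => j; rewrite mem_index_iota => /andP[j1 jn].
case: eqP => _; last by rewrite (lin0 (@aug0L R A)) rmorph0.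
have [|_ g0] := gP (w := take j x.2); first by rewrite size_takel.
by rewrite aug0_mul rmorphM g0 mulr0.
Qed.

Lemma prj_dgr_neq n p a : p != n -> inA (@dgr R A p) a -> prj (@dgr R A n) a = 0.
Proof.
move=> np; apply: (lin_eq (@prjL R A (@dgr R A n)) (g := fun=> 0)) => [c x y|be nb db].
  by rewrite scaler0 addr0.
by rewrite prj_mon // asboolF // /dgr /= db => /eqP; rewrite (negPf np).
Qed.

Lemma prj_dgr_dif n a : d (prj (@dgr R A n.+1) a) = prj (@dgr R A n) (d a).
Proof.
apply: (lin_eq (compL (@prjL _ _ _) dL) (compL dL (@prjL _ _ _))) (inAT a) => al na _ /=.
rewrite prj_mon //; case: asboolP => [da|da].
  by rewrite prj_id //; apply: dif_dgr; apply: inA_mon.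
rewrite (lin0 dL).
have : inA (@dgr R A (edeg al)) (mon al) by apply: inA_mon.
case e : (edeg al) => [|p] gal; first by rewrite (dif_dgr0 gal) (lin0 (@prjL _ _ _)).
have np : p != n by apply/eqP => pn; apply: da; rewrite /dgr /= e pn.
by rewrite (prj_dgr_neq np (dif_dgr gal)).
Qed.

Lemma aug0_prj0 a : aug0 (prj (@dgr R A 0) a) = aug0 a.
Proof.
apply: (lin_eq (compL (@prjL _ _ _) (@aug0L R A)) (@aug0L R A)) (inAT a) => al na _ /=.
rewrite prj_mon //; case: asboolP => // da; rewrite (lin0 (@aug0L R A)) aug0_mon //.
by case: eqP => // e; case: da; rewrite e /dgr /= edeg0.
Qed.

Lemma prj_Ut n a : U a -> pi (aug0 a) = 0 -> @gr R Ut n (prj (@dgr R A n) a).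
Proof.
move=> Ua a0; have ga := prj_dgr_in n Ua; case: n ga => [|n] ga; last exact: tU_tUt ga.
by split=> //; rewrite aug0_prj0.
Qed.

Lemma prj_bdr n b : U b -> @bdr R Ut n (d (prj (@dgr R A n.+1) b)).
Proof.
move=> Ub; exists (prj (@dgr R A n.+1) b) => //.
exact: tU_tUt (prj_dgr_in _ Ub).
Qed.

(** [g [:: t]] may be inhomogeneous, but it differs from [z t] by a boundary of U; its component in
    the degree of [t] thus still represents the class of [z t]. *)
Lemma prj_g t : @bdr R Ut (tag t) (z t - prj (@dgr R A (tag t)) (g [:: t])).
Proof.
have [_ [b Ub ->]] := g1 t; have [[gz _] _] := zP t.
rewrite (linD _ _ (@prjL _ _ _)) prj_id; last exact: inAIr gz.
rewrite opprD addrA subrr add0r -prj_dgr_dif.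
by apply: submod_N; [exact: bdrS | apply: prj_bdr].
Qed.

(** Each of the finitely many homogeneous components is expressed in the basis; passing from [z t]
    to [g [:: t]] costs a boundary. *)
Lemma homology_span u : U u -> d u = 0 -> pi (aug0 u) = 0 ->
  exists L (c : I -> R) b, U b /\ u = \sum_(t <- upto v L) c t *: g [:: t] + d b.
Proof.
move=> Uu du u0; have [L /(_ L.+1 (leqnSn _)) uE] := prj_dgr_sum u.
have H n : exists cb : ('I_(v n) -> R) * A, U cb.2 /\
    prj (@dgr R A n) u = \sum_i cb.1 i *: z (existT _ n i) + d cb.2.
  have [|c [b gb bE]] := zs (j := n) (a := prj (@dgr R A n) u).
    split; first exact: prj_Ut.
    case: (n) => [|n']; last by rewrite /= prj_dgr_dif du (lin0 (@prjL _ _ _)).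
    by apply: dif_dgr0; apply: inAIr (prj_dgr_in 0 Uu).
  exists (c, b); rewrite [d _]bE addrC subrK; split=> //.
  by case: gb => gb _; apply: inAIl gb.
pose cb n := projT1 (cid (H n)); have cbP n := projT2 (cid (H n)).
have /all_sig2 [b' Ub' b'E] t : {b | U b & z t = g [:: t] + d b}.
  have [_ Hb] := g1 t; have [b Ub bE] := cid2 Hb; exists (- b).
    by apply: submod_N => //; exact: inA_submod.
  by rewrite bE (linN _ dL) addrK.
exists L, (fun t => (cb (tag t)).1 (tagged t)),
  (\sum_(n < L.+1) ((cb n).2 + \sum_i (cb n).1 i *: b' (existT _ (n : nat) i))); split.
  apply: submod_sum => [|n _]; first exact: inA_submod.
  apply: submod_D; [exact: inA_submod | by case: (cbP n) |].
  apply: submod_sum => [|i _]; first exact: inA_submod.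
  by apply: submod_Z => //; exact: inA_submod.
rewrite big_allpairs_dep {1}uE -[L.+1]subn0 -/(index_iota 0 L.+1) big_mkord.
rewrite (lin_sum _ _ _ dL) -big_split /=; apply: eq_bigr => n _.
have [_ ->] := cbP n; rewrite big_enum (linD _ _ dL) (lin_sum _ _ _ dL) addrCA.
rewrite -/(cb n) addrC; congr (_ + _); rewrite -big_split; apply: eq_bigr => i _ /=.
by rewrite b'E scalerDr (linZ _ _ dL).
Qed.

(** In the component of degree [n], the terms [g [:: t]] with [t] of another degree contribute
    boundaries only, so the independence of the basis in degree [n] applies. *)
Lemma homology_indep L (c : I -> R) b : U b ->
  \sum_(t <- upto v L) c t *: g [:: t] = d b -> forall t, t \in upto v L -> pi (c t) = 0.
Proof.
move=> Ub cE [n i]; rewrite mem_upto /= => nL.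
have Ln : (n < L.+1)%N by [].
pose e (j : 'I_(v n)) : I := existT _ n j.
suff H : @bdr R Ut n (\sum_i c (e i) *: z (e i)) by exact: (@zi n (fun i => c (e i)) H i).
have E : \sum_i c (e i) *: z (e i) =
    \sum_i c (e i) *: (z (e i) - prj (@dgr R A n) (g [:: e i])) +
    \sum_i c (e i) *: prj (@dgr R A n) (g [:: e i]).
  by rewrite -big_split; apply: eq_bigr => j _; rewrite /= -scalerDr subrK.
rewrite [X in bdr n X]E; apply: submod_D; first exact: bdrS.
  apply: submod_sum => [|j _]; first exact: bdrS.
  by apply: submod_Z; [exact: bdrS | apply: (prj_g (e j))].
have prjz t : tag t != n -> @bdr R Ut n (prj (@dgr R A n) (g [:: t])).
  move=> ne; have [_ [b' Ub' ->]] := g1 t; rewrite (linD _ _ (@prjL _ _ _)) -prj_dgr_dif.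
  have [[gz _] _] := zP t; rewrite (_ : prj _ (z t) = 0) ?add0r; first exact: prj_bdr.
  exact: prj_dgr_neq ne (inAIr gz).
have : @bdr R Ut n (prj (@dgr R A n) (d b)) by rewrite -prj_dgr_dif; apply: prj_bdr.
rewrite -cE (lin_sum _ _ _ (@prjL _ _ _)) big_allpairs_dep -[L.+1]subn0 -/(index_iota 0 L.+1).
rewrite big_mkord (bigD1 (Ordinal Ln)) //= big_enum /=.
under eq_bigr do rewrite (linZ _ _ (@prjL _ _ _)).
set S := (X in bdr n (_ + X)) => H.
have BS : @bdr R Ut n S.
  apply: submod_sum => [|p ne]; first exact: bdrS.
  rewrite big_enum; apply: submod_sum => [|j _]; first exact: bdrS.
  rewrite (linZ _ _ (@prjL _ _ _)); apply: submod_Z; first exact: bdrS.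
  by apply: prjz; rewrite -val_eqE in ne.
have -> : \sum_i c (e i) *: prj (@dgr R A n) (g [:: e i]) =
    \sum_(i in 'I_(v n)) c (e i) *: prj (@dgr R A n) (g [:: e i]) by apply: eq_bigl.
by rewrite -[X in bdr n X](addrK S); apply: submod_B => //; exact: bdrS.
Qed.

(* The complex of formal sums is a resolution of k. *)
Lemma Dl_exact l : stg l -> (forall w, cfw (Dl l) w = 0) -> pi (aug0 (cfw l [::])) = 0 ->
  exists l', [/\ stg l', forall w, cfw (Dl l') w = cfw l w & pi (aug0 (cfw l' [::])) = 0].
Proof.
(* Induction on a bound [n] for the word lengths; the augmentation of the primitive is corrected
   afterwards. *)
suff H n l0 : (forall x, x \in l0 -> (size x.2 < n)%N) -> stg l0 ->
    (forall w, cfw (Dl l0) w = 0) -> pi (aug0 (cfw l0 [::])) = 0 ->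
    exists l', stg l' /\ forall w, cfw (Dl l') w = cfw l0 w.
  move=> sl Dl0 a0.
  have [|l' [sl' l'E]] := H (\max_(x <- l) (size x.2).+1)%N l _ sl Dl0 a0.
    by move=> x xl; apply: (@leq_bigmax_seq _ l xpredT (fun x : A * seq I => (size x.2).+1)).
  have U1 c : U c%:A by apply: inA_dgr_le_var (inA_const _ _).
  (* [Dl] kills a scalar at the empty word, so subtracting it normalizes the augmentation. *)
  exists (l' ++ [:: (- (aug0 (cfw l' [::]))%:A, [::])]); split.
  - apply: stg_cat => // x; rewrite inE => /eqP -> /=.
    by apply: submod_N (U1 _); exact: inA_submod.
  - move=> w; rewrite -l'E /cfw !ev_Dl ev_cat ev_cons ev_nil addr0 /dual /=.
    rewrite big_geq // addr0 (linN _ dL) (dif_dgr0 (inA_const _ _)) oppr0.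
    by case: eqP; rewrite addr0.
  - rewrite /cfw ev_cat ev_cons ev_nil addr0 /= -/(cfw l' [::]).
    by rewrite (linB _ _ (@aug0L R A)) aug0_const subrr rmorph0.
elim: n l0 => [|n IH] l0 lt sl Dl0 a0.
  exists [::]; split=> // w; rewrite /cfw ev_nil; case: l0 lt {sl Dl0 a0} => [|x l0] lt.
    by rewrite ev_nil.
  by have := lt x; rewrite inE eqxx => /(_ isT).
have cf_big w : (n < size w)%N -> cfw l0 w = 0.
  move=> nw; apply/eqP; apply: contraLR nw => /cfw_mem /mapP[x xl ->].
  by rewrite -leqNgt -ltnS; apply: lt.
have drop_lt w w0 j : (size w <= size w0)%N -> (1 <= j)%N -> (j < (size w).+1)%N -> drop j w != w0.
  move=> le j1 jw; apply/eqP => /(congr1 size); rewrite size_drop => e.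
  have : (size w - j < size w)%N by rewrite ltn_subrL j1 (leq_trans j1).
  by rewrite e ltnNge le.
(* Apart from the term with [d], the differential shortens words, so nothing else reaches a word of
   maximal length. *)
have cyc_top w : size w = n -> d (cfw l0 w) = 0.
  move=> sw; rewrite -[RHS](Dl0 w) /cfw ev_Dl (ev_lin _ _ dL); apply: ev_eq_in => x xl.
  rewrite /dual big_nat big1 ?addr0; first by case: eqP => // _; rewrite (lin0 dL).
  move=> j /andP[j1 jx]; rewrite (negPf (drop_lt _ _ _ _ j1 jx)) //.
  by rewrite sw -ltnS; apply: lt.
(* For nonempty [w], drop its first letter and read off the coefficient of [Dl l0] at the rest,
   which is [E]. By [g2] the coefficients minus their scalar parts contribute boundaries, so the
   scalar parts form a relation among the classes [g [:: t]] and vanish in k. *)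
have aug_top w : size w = n -> pi (aug0 (cfw l0 w)) = 0.
  case: w => [//|t0 w0] [sw].
  have [L LP] : exists L, forall x t, x \in l0 -> t \in x.2 -> (tag t <= L)%N.
    exists (\max_(x <- l0) \max_(t <- x.2) tag t)%N => x t xl tx.
    apply: leq_trans (_ : \max_(t <- x.2) tag t <= _)%N.
      exact: (@leq_bigmax_seq _ x.2 xpredT (fun t : I => tag t)).
    exact: (@leq_bigmax_seq _ l0 xpredT (fun x : A * seq I => \max_(t <- x.2) tag t)%N).
  have [t0L|t0L] := boolP (t0 \in upto v L); last first.
    rewrite (_ : cfw l0 _ = 0) ?(lin0 (@aug0L R A)) ?rmorph0 //.
    apply/eqP; apply: contraNT t0L => /cfw_mem /mapP[x xl xE].
    by rewrite mem_upto; apply: (LP x) => //; rewrite -xE inE eqxx.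
  have E : d (cfw l0 w0) + \sum_(t <- upto v L) sg (cfw l0 (t :: w0)) * g [:: t] = 0.
    rewrite -[RHS](Dl0 w0) /cfw ev_Dl (ev_lin _ _ dL).
    under eq_bigr do rewrite (ev_lin _ _ (compL sL (@mulrL R A (g _)))).
    rewrite /ev exchange_big -big_split big_seq [RHS]big_seq; apply: eq_bigr => x xl /=.
    rewrite /dual; congr (_ + _); first by case: eqP => // _; rewrite (lin0 dL).
    have := lt x xl; have : forall t, t \in x.2 -> (tag t <= L)%N by move=> t; apply: LP.
    case: (x.2) => [|t w] tL lw.
      rewrite /= big_geq // big1 // => t _.
      by rewrite (lin0 sL) mul0r.
    rewrite big_ltn //= drop0 take0 [X in _ + X]big_nat [X in _ + X]big1 ?addr0.
      rewrite (bigD1_seq t) ?uniq_upto ?mem_upto ?tL ?inE ?eqxx //= big1 ?addr0.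
        by rewrite eqseq_cons eqxx /=; case: eqP => // _; rewrite (lin0 sL) mul0r.
      move=> s ne; rewrite eqseq_cons eq_sym (negPf ne) /=.
      by rewrite (lin0 sL) mul0r.
    move=> j /andP[j2 jw]; case: j j2 jw => [//|j] j2 jw /=.
    rewrite (negPf (drop_lt w w0 j _ _ _)) //.
    by move: lw; rewrite /= -sw !ltnS.
  have H t : exists2 b, U b & sg (cfw l0 (t :: w0) - (aug0 (cfw l0 (t :: w0)))%:A) * g [:: t] = d b.
    apply: g2.
    - apply: submod_B; [exact: inA_submod | exact: stg_cfw |].
      exact: inA_dgr_le_var (inA_const _ _).
    - by rewrite (linB _ _ dL) (dif_dgr0 (inA_const _ _)) cyc_top ?subr0 //= sw.
    - by rewrite (linB _ _ (@aug0L R A)) aug0_const subrr rmorph0.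
  have {H} /choice [b bP] t : exists b, U b /\
      sg (cfw l0 (t :: w0) - (aug0 (cfw l0 (t :: w0)))%:A) * g [:: t] = d b.
    by have [b Ub bE] := H t; exists b.
  apply: (@homology_indep L (fun t => aug0 (cfw l0 (t :: w0)))
     (- (cfw l0 w0 + \sum_(t <- upto v L) b t))) => //.
    apply: submod_N; first exact: inA_submod.
    apply: submod_D; [exact: inA_submod | exact: stg_cfw |].
    by apply: submod_sum => [|t _]; [exact: inA_submod | case: (bP t)].
  rewrite (linN _ dL) (linD _ _ dL) [d (\sum_(t <- _) b t)](lin_sum _ _ _ dL).
  apply/eqP; rewrite -addr_eq0 addrCA -[X in _ == X]E; apply/eqP; congr (_ + _).
  rewrite -big_split; apply: eq_bigr => t _ /=; have [_ <-] := bP t.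
  rewrite (linB _ _ sL) mulrBl (linZ _ _ sL) sg1 -scalerAl mul1r.
  by rewrite addrC subrK.
have top w : exists Lcb : nat * (I -> R) * A, U Lcb.2 /\ (size w = n ->
    cfw l0 w = \sum_(t <- upto v Lcb.1.1) Lcb.1.2 t *: g [:: t] + d Lcb.2).
  case: (eqVneq (size w) n) => [sw|ne]; last first.
    exists (0%N, fun=> 0, 0); split; last by move=> e; rewrite e eqxx in ne.
    by apply: submod0; exact: inA_submod.
  have [L [c [b [Ub E]]]] := homology_span (stg_cfw w sl) (cyc_top w sw) (aug_top w sw).
  by exists (L, c, b).
have /choice [W WP] := top.
pose S := undup [seq x.2 | x <- l0 & size x.2 == n].
have SP w : (w \in S) = (w \in map snd l0) && (size w == n).
  rewrite mem_undup; apply/mapP/andP => [[x + ->]|[/mapP[x xl ->] sx]].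
    by rewrite mem_filter => /andP[-> xl]; rewrite map_f.
  by exists x => //; rewrite mem_filter sx.
(* If the coefficient at a longest word [w] is the sum of the [c t *: g [:: t]] plus [d b], then [b]
   at [w] together with the scalars [c t] at the words [t :: w] has that coefficient at [w] in its
   differential, and otherwise only shorter words. *)
pose l1 := flatten [seq ((W w).2, w) ::
  [seq (((W w).1.2 t)%:A, t :: w) | t <- upto v (W w).1.1] | w <- S].
have U1 (c : R) : U c%:A by apply: inA_dgr_le_var (inA_const _ _).
have sl1 : stg l1.
  move=> x /flattenP[s /mapP[w wS ->]]; rewrite inE => /orP[/eqP -> /=|/mapP[t _ ->] //=].
  by case: (WP w).
have Dl1 w0 : (n <= size w0)%N -> cfw (Dl l1) w0 = cfw l0 w0.
  move=> nw0; rewrite /cfw ev_Dl /l1 ev_flatten -/(cfw l0 w0).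
  transitivity (\sum_(w <- S) if w == w0 then cfw l0 w else 0); last first.
    case: (boolP (w0 \in S)) => wS.
      rewrite (bigD1_seq w0) ?undup_uniq //= eqxx big1 ?addr0 // => w ne.
      by rewrite (negPf ne).
    rewrite big_seq big1.
      apply/esym/eqP; apply: contraNT wS => nz; rewrite SP (cfw_mem nz) /=.
      by rewrite eqn_leq nw0 andbT leqNgt; apply: contraNN nz => /cf_big ->.
    by move=> w wS'; case: eqP => // e; rewrite -e wS' in wS.
  rewrite big_seq [RHS]big_seq; apply: eq_bigr => w; rewrite SP => /andP[_ /eqP sw].
  rewrite ev_cons /= {1}/dual big_nat big1 ?addr0; last first.
    by move=> j /andP[j1 jw]; rewrite (negPf (drop_lt _ _ _ _ j1 jw)) // sw.
  rewrite /ev big_map.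
  transitivity (if w == w0 then d (W w).2 + \sum_(t <- upto v (W w).1.1) (W w).1.2 t *: g [:: t] else 0).
    have E1 t : dual (fun w u => if w == w0 then u else 0) (t :: w) ((W w).1.2 t)%:A =
        if w == w0 then (W w).1.2 t *: g [:: t] else 0.
      rewrite /dual /= (dif_dgr0 (inA_const _ _)) if_same add0r.
      rewrite big_ltn //= drop0 take0 big_nat big1 ?addr0.
        by rewrite (linZ _ _ sL) sg1 -scalerAl mul1r.
      move=> j /andP[j2 jw]; case: j j2 jw => [//|j] j2 jw /=.
      by rewrite (negPf (drop_lt w w0 j _ _ _)) // sw.
    rewrite (eq_bigr _ (fun t _ => E1 t)).
    by case: eqP => // _; rewrite big1 ?addr0.
  by case: eqP => // _; have [_ ->] := WP w; rewrite // addrC.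
(* Discarding the longer words changes no coefficient, since there [l0] and [Dl l1] cancel. *)
pose l2 := [seq x <- l0 ++ fscale (-1) (Dl l1) | (size x.2 < n)%N].
have cf2 w : cfw l2 w = cfw l0 w - cfw (Dl l1) w.
  have E : cfw (l0 ++ fscale (-1) (Dl l1)) w = cfw l0 w - cfw (Dl l1) w.
    by rewrite /cfw ev_cat ev_fscale ?scaleN1r //; exact: cfwL.
  case: (ltnP (size w) n) => sw; last first.
    rewrite Dl1 // subrr; apply/eqP; apply: contraLR sw => /cfw_mem /mapP[x + ->].
    by rewrite mem_filter -ltnNge => /andP[].
  rewrite -E /cfw /ev big_filter big_mkcond; apply: eq_bigr => x _.
  by case: ifP => // H; case: eqP => // e; rewrite e sw in H.
have [||||l3 [sl3 l3E]] := IH l2.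
- by move=> x; rewrite mem_filter => /andP[].
- move=> x; rewrite mem_filter => /andP[_]; apply: stg_cat => //.
  by apply: stg_fscale; apply: stg_Dl.
- move=> w; rewrite (@Dl_eq l2 (l0 ++ fscale (-1) (Dl l1))); last first.
    by move=> w'; rewrite cf2 /cfw ev_cat ev_fscale ?scaleN1r //; exact: cfwL.
  rewrite /cfw ev_Dl ev_cat ev_fscale; last by apply: dualL; exact: cfwL.
  rewrite -!ev_Dl -/(cfw (Dl l0) w) -/(cfw (Dl (Dl l1)) w) Dl0 Dl_Dl.
  by rewrite scaler0 addr0.
- by rewrite cf2 (linB _ _ (@aug0L R A)) rmorphB a0 aug_Dl subrr.
exists (l1 ++ l3); split; first exact: stg_cat.
move=> w; rewrite /cfw ev_Dl ev_cat -!ev_Dl -/(cfw (Dl l1) w) -/(cfw (Dl l3) w) l3E cf2.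
by rewrite addrC subrK.
Qed.

Lemma edeg_eq0 (al : texpo A) : nrm al -> edeg al = 0%N -> al = @e0 R A.
Proof.
move=> na da; have [h _] := dgr_le_var na da.
apply: functional_extensionality_dep => n; apply/funext => i.
case: n i => [|n] i; last by rewrite h.
by exfalso; case: i => j; rewrite nvar0.
Qed.

Definition flist (F : texpo A -> seq (A * seq I)) a :=
  flatten [seq fscale x.1 (F x.2) | x <- rep a].

Lemma ev_flist (V : lmodType R) (psi : seq I -> A -> V) F a :
  (forall w, linear (psi w)) -> ev psi (flist F a) = ext (fun be => ev psi (F be)) a.
Proof.
by move=> pL; rewrite /flist ev_flatten; apply: eq_bigr => x _; rewrite ev_fscale.
Qed.

(* [F] lifts the identity of k to a chain map from the acyclic closure, in degrees
   up to [n], to the complex of formal sums. *)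
Definition lift_upto n (F : texpo A -> seq (A * seq I)) : Prop :=
  (forall al, stg (F al)) /\ forall al, nrm al -> (edeg al <= n)%N ->
    pi (aug0 (cfw (F al) [::])) = (edeg al == 0%N)%:R /\
    forall w, cfw (Dl (F al)) w = ext (fun be => cfw (F be) w) (d (mon al)).

Lemma lift0 : lift_upto 0 (fun al => if al == @e0 R A then [:: (1, [::])] else [::]).
Proof.
split=> [al|al na]; first case: eqP => // _ x.
  by rewrite inE => /eqP -> /=; rewrite -mon0; apply: inA_mon; [exact: nrm0|].
rewrite leqn0 => /eqP dal; rewrite (edeg_eq0 na dal) eqxx edeg0 eqxx mon0 dif1.
split=> [|w]; first by rewrite /cfw ev_cons ev_nil /= addr0 aug0_1 rmorph1.
rewrite (lin0 (@extL _ _ _ _)) /cfw ev_Dl ev_cons ev_nil addr0 /dual /= dif1.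
by rewrite big_geq // addr0; case: eqP.
Qed.

Lemma ext_eq_dgr (V : lmodType R) n (phi psi : texpo A -> V) a :
  (forall al, nrm al -> edeg al = n -> phi al = psi al) -> inA (@dgr R A n) a ->
  ext phi a = ext psi a.
Proof.
move=> e; apply: (lin_eq (@extL _ _ _ phi) (@extL _ _ _ psi)) => al na da.
by rewrite !ext_mon // e.
Qed.

Lemma dif_mon_ext (V : lmodType R) n (phi psi : texpo A -> V) al : nrm al ->
  (edeg al <= n.+1)%N -> (forall be, nrm be -> (edeg be <= n)%N -> phi be = psi be) ->
  ext phi (d (mon al)) = ext psi (d (mon al)).
Proof.
move=> na le e; have : inA (@dgr R A (edeg al)) (mon al) by apply: inA_mon.
case: (edeg al) le => [_ /dif_dgr0 ->|p le /dif_dgr dm]; first by rewrite !(lin0 (@extL _ _ _ _)).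
by apply: ext_eq_dgr dm => be nb db; apply: e; rewrite ?db.
Qed.

(** The comparison theorem for resolutions: the value on a monomial of degree [n.+1] is a primitive
    of the value already chosen on its differential. *)
Lemma lift_step n F : lift_upto n F ->
  exists F', lift_upto n.+1 F' /\ forall al, (edeg al <= n)%N -> F' al = F al.
Proof.
move=> [sF FP].
have /choice [C CP] : forall al, exists l : seq (A * seq I), stg l /\
    (nrm al -> edeg al = n.+1 -> (forall w, cfw (Dl l) w = ext (fun be => cfw (F be) w) (d (mon al)))
      /\ pi (aug0 (cfw l [::])) = 0).
  move=> al.
  case: (pselect (nrm al /\ edeg al = n.+1)) => [[na da]|ne]; last first.
    by exists [::]; split=> // na da; case: ne.
  have dm : inA (@dgr R A n) (d (mon al)) by apply: dif_dgr; apply: inA_mon.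
  have flE a w : cfw (flist F a) w = ext (fun be => cfw (F be) w) a.
    by rewrite /cfw ev_flist //; exact: cfwL.
  have [|||l [sl lE la]] := @Dl_exact (flist F (d (mon al))).
  - move=> x /flattenP[s /mapP[y _ ->]]; by apply: stg_fscale; apply: sF.
  - move=> w; rewrite /cfw ev_Dl ev_flist; last by apply: dualL; exact: cfwL.
    rewrite (@ext_eq_dgr _ n _ (fun be => ext (fun be => cfw (F be) w) (d (mon be)))) //; last first.
      by move=> be nb db; have [_ <-] := FP be nb (eq_leq db); rewrite /cfw ev_Dl.
    transitivity (ext (fun be => cfw (F be) w) (d (d (mon al)))); last first.
      by rewrite difK (lin0 (@extL _ _ _ _)).
    move: dm; apply: (lin_eq (@extL _ _ _ _) (compL dL (@extL _ _ _ (fun be => cfw (F be) w)))).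
    by move=> be nb db; rewrite ext_mon.
  (* The lift preserves augmentations, and a differential has augmentation zero. *)
  - rewrite flE; transitivity (pi (aug0 (d (mon al)))); last exact: (aug_dif residue acl).
    move: dm; apply: (inA_ind (Q := [set a | pi (aug0 (ext (fun be => cfw (F be) [::]) a)) = pi (aug0 a)])).
      split=> [|c x y /= xE yE]; first by rewrite /= (lin0 (@extL _ _ _ _)).
      by rewrite /= extL !aug0L !rmorphD !rmorphM xE yE.
    move=> be nb db /=; rewrite ext_mon //; have [-> _] := FP be nb (eq_leq db).
    rewrite aug0_mon // rmorph_nat; congr (nat_of_bool _)%:R.
    by apply/eqP/eqP => [/(edeg_eq0 nb)|->]; [|exact: edeg0].
  by exists l; split=> // _ _; split=> // w; rewrite lE flE.
exists (fun al => if edeg al == n.+1 then C al else F al).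
have agree al : (edeg al <= n)%N -> (if edeg al == n.+1 then C al else F al) = F al.
  by move=> le; rewrite ltn_eqF.
split=> //; split=> [al|al na]; first by case: eqP => _; [case: (CP al) | exact: sF].
rewrite leq_eqVlt => /orP[/eqP dal|lt].
  have [_ /(_ na dal) [DC aC]] := CP al.
  rewrite dal eqxx /= aC; split=> // w; rewrite DC; apply: (dif_mon_ext (n := n)) => //.
    by rewrite dal.
  by move=> be _ le; rewrite agree.
have [aF DF] := FP al na lt; rewrite agree //; split=> // w; rewrite DF.
by apply: (dif_mon_ext (n := n)) => // [|be _ le]; [exact: ltnW | rewrite agree].
Qed.

(** Later stages leave earlier values unchanged, so taking on each monomial the stage of its own
    degree gives a lift in all degrees. *)
Lemma lift_exists : exists F, (forall n, lift_upto n F) /\ F (@e0 R A) = [:: (1, [::])].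
Proof.
pose S n := {F | lift_upto n F}.
pose nxt n (F : S n) : S n.+1 :=
  let h := cid (lift_step (proj2_sig F)) in exist _ (projT1 h) (projT2 h).1.
pose G := nat_rect S (exist _ _ lift0) nxt.
have GS n al : (edeg al <= n)%N -> sval (G n.+1) al = sval (G n) al.
  by move=> le; apply: (projT2 (cid (lift_step (proj2_sig (G n))))).2.
have GE n al : (edeg al <= n)%N -> sval (G n) al = sval (G (edeg al)) al.
  elim: n => [|n IH]; first by rewrite leqn0 => /eqP ->.
  by rewrite leq_eqVlt => /orP[/eqP <- //|lt]; rewrite GS // IH.
exists (fun al => sval (G (edeg al)) al); split=> [n|]; last by rewrite edeg0 /= eqxx.
split=> [al|al na le]; first by case: (proj2_sig (G (edeg al))).
have [_ /(_ al na le) [aG DG]] := proj2_sig (G n).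
rewrite -(GE n al le); split=> // w; rewrite DG.
by apply: (dif_mon_ext (n := n)) => // [|be _ leb]; rewrite ?GE ?leqW.
Qed.

(* [phi t] is the composite of the lift of R<X> to formal sums with the map
   u (x) w |-> sg u * g (w t). *)
Lemma massey_maps : exists phi : I -> A -> A, forall t,
  [/\ linear (phi t), forall a, d (phi t a) = - phi t (d a),
      forall a, U (phi t a) /\ pi (aug0 (phi t a)) = 0 & phi t 1 = g [:: t]].
Proof.
have [F [FP Fe]] := lift_exists.
pose Phi t w u := sg u * g (rcons w t).
have PhiL t w : linear (Phi t w) by exact: compL sL (@mulrL R A _).
(* This is the Massey relation for [rcons w t]: its cuts are those of [w], the one after all of [w]
   included. *)
have dPhi t w u : d (Phi t w u) = - dual (Phi t) w u.
  rewrite /Phi dif_mul sgK gM ?size_rcons // /dual sg_dif mulNr opprD opprK; congr (_ + _).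
  rewrite mulrN mulr_sumr; congr (- _); rewrite big_nat [RHS]big_nat; apply: eq_bigr.
  move=> j /andP[j1 jn]; rewrite sgM sgK mulrA drop_rcons; last by rewrite -ltnS.
  by rewrite -[X in take j X]cats1 takel_cat // -ltnS.
exists (fun t => ext (fun al => ev (Phi t) (F al))) => t; split.
- exact: extL.
- move=> a; have [sF _] := FP 0%N.
  apply: (lin_eq (compL (@extL _ _ _ _) dL) (oppL (compL dL (@extL _ _ _ _)))) (inAT a) => al na _.
  rewrite /= ext_mon // (ev_lin _ _ dL) -(ev_flist _ _ (PhiL t)).
  have -> : ev (Phi t) (flist F (d (mon al))) = ev (Phi t) (Dl (F al)).
    apply: ev_eq => [|w]; first exact: PhiL.
    have [_ /(_ al na (leqnn _)) [_ ->]] := FP (edeg al).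
    by rewrite /cfw ev_flist //; exact: cfwL.
  rewrite ev_Dl /ev -sumrN; apply: eq_bigr => x _; exact: dPhi.
- move=> a; apply: (inA_ind (P := setT) (Q := [set a | U (ext (fun al => ev (Phi t) (F al)) a) /\
      pi (aug0 (ext (fun al => ev (Phi t) (F al)) a)) = 0])) (inAT a) => [|al na _].
    split=> [|c x y [Ux x0] [Uy y0]].
      rewrite /= (lin0 (@extL _ _ _ _)) (lin0 (@aug0L R A)) rmorph0; split=> //.
      by apply: submod0; exact: inA_submod.
    rewrite /= extL aug0L rmorphD rmorphM x0 y0 mulr0 addr0; split=> //.
    by case: (inA_submod (@le_var R A q)) => _; apply.
  rewrite /= ext_mon //; have [sF _] := FP 0%N; split.
    rewrite /ev big_seq; apply: submod_sum => [|x xl]; first exact: inA_submod.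
    apply: inA_mul_var; first by apply: sg_var; apply: (sF al).
    by have [] := gP (w := rcons x.2 t); rewrite ?size_rcons.
  apply: piaug_sum => x _; rewrite aug0_mul rmorphM.
  by have [|_ ->] := gP (w := rcons x.2 t); rewrite ?size_rcons ?mulr0.
- by rewrite -mon0 ext_mon ?Fe ?ev_cons ?ev_nil ?addr0 /Phi /= ?sg1 ?mul1r //; exact: nrm0.
Qed.

End MasseyMaps.

(** * The augmentation kernel as a sum of shifts of R<X> *)

Section GolodSplitting.
Variables (R : comNzRingType) (m : set R) (k : fieldType) (pi : {rmorphism R -> k}).
Hypothesis residue : residue_map m pi.
Variable A : tate_algebra R.
Hypothesis acl : is_acyclic_closure m A.
Variable q : nat.
Hypothesis q1 : (1 <= q)%N.
Local Notation d := (dif A).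
Local Notation U := (inA (@le_var R A q)).
Let Ut : gcomplex R := tUt residue acl q.
Let TA : gcomplex R := tA A.

Section Splitting.
Variable v : nat -> nat.
Let I := {j : nat & 'I_(v j)}.
Variables (z : I -> A) (phi : I -> A -> A).
Hypothesis zP : forall t, @cyc R Ut (tag t) (z t).
Hypothesis zi : forall j, indep pi (@bdr R Ut j) (fun i => z (existT _ j i)).
Hypothesis zs : forall j a, @cyc R Ut j a ->
  exists c : 'I_(v j) -> R, @bdr R Ut j (a - \sum_i c i *: z (existT _ j i)).
Hypothesis phiL : forall t, linear (phi t).
Hypothesis phid : forall t a, d (phi t a) = - phi t (d a).
Hypothesis phiU : forall t a, U (phi t a) /\ pi (aug0 (phi t a)) = 0.
Hypothesis phi1 : forall t, @bdr R Ut (tag t) (z t - prj (@dgr R A (tag t)) (phi t 1)).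

Let X : gcomplex R := tens (zd R v) TA.

(** [phi t] anticommutes with [d], and the differential of the source has the sign [(-1) ^+ j]; the
    sign chosen here compensates both. The projection is needed because [phi t] need not be
    homogeneous. *)
Definition split_map (n : nat) (x : X) : Ut :=
  \sum_(j < n.+1) \sum_(a < v j)
    (-1) ^+ (j.+1 * n) *: prj (@dgr R A n) (phi (existT _ (j : nat) a) (x (existT _ (j : nat) a))).

Lemma split_map_mor : mor split_map.
Proof.
have prL n := @prjL R A (@dgr R A n).
split.
- move=> n c x y; rewrite /split_map scaler_sumr -big_split; apply: eq_bigr => j _.
  rewrite scaler_sumr -big_split; apply: eq_bigr => a _ /=.
  rewrite (_ : (c *: x + y) (existT _ (j : nat) a) =
     c *: x (existT _ (j : nat) a) + y (existT _ (j : nat) a)) //.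
  by rewrite phiL prL scalerDr !scalerA mulrC.
- move=> n x gx; apply: submod_sum => [|j _]; first exact: grS.
  apply: submod_sum => [|a _]; first exact: grS.
  apply: submod_Z; first exact: grS.
  by case: (phiU (existT _ (j : nat) a) (x (existT _ (j : nat) a))) => Up ap; apply: prj_Ut.
move=> n x gx; rewrite /split_map (lin_sum _ _ _ (@gdL _ Ut)).
rewrite big_ord_recr /= [X in _ + X](_ : _ = 0) ?addr0; last first.
  rewrite (lin_sum _ _ _ (@difL R A)) big1 // => a _.
  rewrite (linZ _ _ (@difL R A)) prj_dgr_dif phid.
  have := gx (existT _ n.+1 a); rewrite leqnn subnn => /subcx_gd0 ->.
  by rewrite (lin0 (phiL _)) oppr0 (lin0 (prL _)) scaler0.
apply: eq_bigr => j _; rewrite (lin_sum _ _ _ (@difL R A)); apply: eq_bigr => a _.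
rewrite (linZ _ _ (@difL R A)) prj_dgr_dif phid.
have -> : tgd x (existT _ (j : nat) a) = (-1) ^+ j *: d (x (existT _ (j : nat) a)).
  exact: zd_gd.
rewrite (linZ _ _ (phiL _)) (linN _ (prL _)) (linZ _ _ (prL _)) scalerN -scaleNr scalerA.
congr (_ *: _); rewrite -exprD mulnS -mulN1r -exprS.
by rewrite -[LHS]signr_odd -[RHS]signr_odd; congr (_ ^+ _); rewrite /= !oddD /= !oddM /=; case: (odd j); case: (odd n).
Qed.

(** Since R<X> resolves k, the homology of the source in degree [n] has dimension [v n], with the
    constants over the generators of degree [n] as representatives. These go to the basis classes of
    Ut. *)
Lemma split_map_qis : qis split_map.
Proof.
have fm := split_map_mor; have fm' := fm; case: fm' => fL fg fd.
have prL n := @prjL R A (@dgr R A n).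
have one1 (r : R) : inA (setT `&` @dgr R A 0) r%:A by apply: inAI (inA_const _ _); exact: inAT.
have cstE n (c : I -> R) :
    let x : X := fun t => if tag t == n then (c t)%:A else 0 in
    [/\ gr n x, gd x = 0 & split_map n x = \sum_(a < v n)
       ((-1) ^+ (n.+1 * n) * c (existT _ n a)) *: prj (@dgr R A n) (phi (existT _ n a) 1)].
  split.
  - move=> t; case: eqP => [e|_]; last by case: ifP => // _; apply: gr0.
    by rewrite e leqnn subnn; apply: one1.
  - apply/funext => t; rewrite zd_gd; case: eqP => _.
      by rewrite /= (dif_dgr0 (inA_const _ _)) scaler0.
    by rewrite (lin0 (@gdL _ _)) scaler0.
  rewrite /split_map big_ord_recr /= big1 ?add0r; last first.
    move=> j _; rewrite big1 // => a _; rewrite ltn_eqF //.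
    by rewrite (lin0 (phiL _)) (lin0 (prL _)) scaler0.
  apply: eq_bigr => a _; rewrite eqxx (linZ _ _ (phiL _)) (linZ _ _ (prL _)).
  by rewrite scalerA.
have surj n y : @cyc R Ut n y -> exists x' y', [/\ @gr R X n x', @gr R Ut n.+1 y',
    gd x' = 0 & y = split_map n x' + gd y'].
  move=> Zy; have [c Bc] := zs Zy.
  (* The match extends [c] by zero from the generators of degree [n] to all generators, and the sign
     cancels that of [split_map]. *)
  have [gx dx xE] := cstE n (fun t => if @eqP _ (tag t) n is ReflectT e
    then (-1) ^+ (n.+1 * n) * c (eq_rect _ (fun j => 'I_(v j)) (tagged t) _ e) else 0).
  set x := (fun t => _) in gx dx xE.
  have : @bdr R Ut n (y - split_map n x).
    rewrite (_ : y - _ = y - \sum_i c i *: z (existT _ n i) +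
      \sum_(i < v n) c i *: (z (existT _ n i) - prj (@dgr R A n) (phi (existT _ n i) 1))).
      apply: submod_D => //; first exact: bdrS.
      apply: submod_sum => [|i _]; first exact: bdrS.
      by apply: submod_Z; [exact: bdrS | exact: (phi1 (existT _ n i))].
    rewrite xE -addrA; congr (_ + _); rewrite -!sumrN -big_split; apply: eq_bigr => i _ /=.
    case: eqP => // e; rewrite (eq_axiomK e) /= mulrA -exprD addnn -mul2n exprM sqrrN !expr1n mul1r.
    by rewrite scalerBr addKr.
  move=> [y' gy' yE]; exists x, y'; split=> //.
  by rewrite [gd y']yE addrC subrK.
move=> n x y gx gy dx xE.
(* Once [x] bounds some [x'], the difference of [y] and the image of [x'] is a cycle, to which
   [surj] applies. *)
suff [x' [gx' dx']] : exists x', @gr R X n x' /\ gd x' = x.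
  have [|x2 [y' [gx2 gy' dx2 yE]]] := surj n (y - split_map n x').
    split; first by apply: (submod_B (@grS R Ut _)) => //; apply: fg.
    by rewrite (linB _ _ (@gdL _ Ut)) -xE (mor_gd fm gx') dx' subrr.
  exists (x' + x2), y'; split=> //.
  - by apply: (submod_D (@grS R X _)).
  - by rewrite (linD _ _ (@gdL _ X)) dx' dx2 addr0.
  - by rewrite (linD _ _ (fL n)) -addrA -yE addrC subrK.
case: n gx gy xE => [/= ->|n /= gx gy xE].
  by move=> _ _; exists 0; split; [exact: (submod0 (@grS R X 0)) | exact: (lin0 (@gdL R X))].
have xE1 : split_map n x = @gd R Ut y by [].
have dxt t : d (x t) = 0.
  have /(congr1 (fun h => (-1) ^+ tag t *: h t)) := dx.
  by rewrite zd_gd signZK => e; apply: etrans e _; exact: scaler0.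
have lift t : exists x' : A, (tag t < n)%N -> inA (setT `&` @dgr R A (n.+1 - tag t)) x' /\ d x' = x t.
  case: (ltnP (tag t) n) => [lt|ge]; last by exists 0.
  have := tgr_le gx (ltnW lt); rewrite subSn ?(ltnW lt) //.
  rewrite -(subnSK lt) => /inAIr gxt.
  have [b [gb db]] := tate_acyclic acl gxt (dxt t).
  by exists b => _; split=> //; apply: inAI gb; exact: inAT.
have {lift} [w wP] := choice lift.
have const t : exists r : R, tag t = n -> x t = r%:A.
  case: (eqVneq (tag t) n) => [e|ne]; last by exists 0 => e; rewrite e eqxx in ne.
  have := gx t; rewrite e leqnn subnn => /inAIr /inA_dgr0 [r rE]; by exists r.
have {const} [r rP] := choice const.
(* Components over generators of degree below [n] have positive degree, hence bound. Up to a
   boundary only the constants [r] over generators of degree [n] remain; their image is a boundary,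
   so independence of the basis gives the claim. *)
have r0 a : pi (r (existT _ n a)) = 0.
  pose xw : X := fun t => if (tag t < n)%N then (-1) ^+ tag t *: w t else 0.
  have gxw : gr n.+1 xw.
    move=> t; rewrite /xw; case: ltnP => [lt|_]; last by case: ifP => // _; apply: gr0.
    rewrite (leqW (ltnW lt)); apply: submod_Z; first exact: grS.
    by case: (wP t lt).
  have [gc dc cE] := cstE n r; set xc := (fun t => _) in gc dc cE.
  have xE' : x = gd xw + xc.
    apply/funext => t; rewrite [RHS](_ : _ = gd xw t + xc t) // zd_gd /xw /xc.
    case: (ltngtP (tag t) n) => [lt|gt|e].
    - have [_ dw] := wP t lt.
      by rewrite (linZ _ _ (@gdL _ TA)) signZK addr0 /= dw.
    - by rewrite (tgr_gt gx gt) (lin0 (@gdL _ TA)) scaler0 addr0.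
    - by rewrite (lin0 (@gdL _ TA)) scaler0 add0r rP.
  have : @bdr R Ut n (split_map n xc).
    exists (y - split_map n.+1 xw).
      by apply: (submod_B (@grS R Ut _)) => //; apply: fg.
    rewrite (linB _ _ (@gdL _ Ut)) fd // -xE1 xE' (linD _ _ (fL n)).
    by rewrite addrC addKr.
  rewrite cE => Bc; have : @bdr R Ut n (\sum_(a < v n) r (existT _ n a) *: z (existT _ n a)).
    rewrite (_ : \sum_(a < v n) _ = (-1) ^+ (n.+1 * n) *: (\sum_(a < v n)
       ((-1) ^+ (n.+1 * n) * r (existT _ n a)) *: prj (@dgr R A n) (phi (existT _ n a) 1)) +
      \sum_(i < v n) r (existT _ n i) *: (z (existT _ n i) - prj (@dgr R A n) (phi (existT _ n i) 1))).
      apply: submod_D; first exact: bdrS.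
        by apply: submod_Z => //; exact: bdrS.
      apply: submod_sum => [|i _]; first exact: bdrS.
      by apply: submod_Z; [exact: bdrS | exact: (phi1 (existT _ n i))].
    rewrite scaler_sumr -big_split; apply: eq_bigr => i _ /=.
    rewrite scalerA mulrA -exprD addnn -mul2n exprM sqrrN !expr1n mul1r.
    by rewrite scalerBr addrC subrK.
  by move=> B; exact: (@zi n (fun a => r (existT _ n a)) B a).
have top t : exists h : A, tag t = n -> inA (@dgr R A 1) h /\ d h = x t.
  case: (eqVneq (tag t) n) => [e|ne]; last by exists 0 => e; rewrite e eqxx in ne.
  have [|h [gh dh]] := kill_const residue acl (r := r t).
    by case: t e => j a /= e; subst j.
  by exists h => _; rewrite rP.
have {top} [h hP] := choice top.
exists (fun t => if (tag t < n)%N then (-1) ^+ tag t *: w t else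
  if tag t == n then (-1) ^+ tag t *: h t else 0); split.
  move=> t; case: ltngtP => [lt|gt|e].
  - rewrite (leqW (ltnW lt)); apply: submod_Z; first exact: grS.
    by case: (wP t lt).
  - by case: ifP => // _; apply: gr0.
  - have -> : (tag t <= n.+1)%N by rewrite e.
    apply: submod_Z; first exact: grS.
    have -> : (n.+1 - tag t)%N = 1%N by rewrite e subSnn.
    by have [h1 _] := hP t e; apply: inAI h1; exact: inAT.
set y' : X := (fun t : bas (zd R v) => _).
suff E t : (-1) ^+ tag t *: @gd R TA (y' t) = x t.
  by apply/funext => t; rewrite -E -zd_gd.
rewrite /y'; case: ltngtP => [lt|gt|e].
- by rewrite (linZ _ _ (@gdL _ TA)) signZK; case: (wP t lt).
- by rewrite (lin0 (@gdL _ TA)) scaler0 (tgr_gt gx gt).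
- by rewrite (linZ _ _ (@gdL _ TA)) signZK; case: (hP t e).
Qed.

End Splitting.

Lemma golod_splitting : noetherian R -> trivial_massey pi A q ->
  exists v, (forall n, hge pi Ut n (v n)) /\ qiso (tens (zd R v) TA) Ut.
Proof.
move=> noethR [ga [ga1 ga2 ga3]].
have fgUt n : fin_gen (@gr R Ut n).
  by apply: (noeth_sub noethR) (@fin_gen_tU R A q n) => [|x []//]; exact: utgrS.
have H n := homology_basis (pi_surj residue) noethR (fgUt n) (null_homotopic_tUt residue acl q1).
pose v n := projT1 (cid (H n)).
pose z (t : {j : nat & 'I_(v j)}) : A := projT1 (cid (projT2 (cid (H (tag t))))) (tagged t).
have zH n := projT2 (cid (projT2 (cid (H n)))).
have zP t : @cyc R Ut (tag t) (z t) by case: t => n i; have [+ _ _] := zH n; apply.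
have zi n : indep pi (@bdr R Ut n) (fun i => z (existT _ n i)) by case: (zH n).
have zs n a : @cyc R Ut n a ->
    exists c : 'I_(v n) -> R, @bdr R Ut n (a - \sum_i c i *: z (existT _ n i)).
  by have [_ _ +] := zH n; apply.
exists v; split.
  move=> n; exists (fun i => z (existT _ n i)); split=> [i|]; last exact: zi.
  exact: (zP (existT _ n i)).
have clsP u : U u -> d u = 0 -> pi (aug0 u) = 0 -> reduced_homology pi q (hclass q u).
  by move=> Uu du u0; exists u => //; split=> //; [exact/stageE | rewrite augE].
have zcls t : reduced_homology pi q (hclass q (z t)).
  by have [[gz z0] dz] := zP t; apply: clsP => //; apply: inAIl gz.
pose cls t : {w : set A | reduced_homology pi q w} := exist _ _ (zcls t).
pose g w : A := ga (map cls w).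
have gP w : (0 < size w)%N -> U (g w) /\ pi (aug0 (g w)) = 0.
  move=> s0; have [|gU g0] := ga1 (map cls w); first by rewrite size_map.
  by split; [exact/stageE | rewrite -augE].
have ga2' c u : sval c = hclass q u -> d (ga [:: c]) = 0 /\
    exists2 b, U b & ga [:: c] = u + d b.
  move=> cE; have [dc] := ga2 c; rewrite cE => -[b /stageE Ub bE].
  by split=> //; exists b.
have g1 t : d (g [:: t]) = 0 /\ exists2 b, U b & g [:: t] = z t + d b.
  exact: (ga2' (cls t)).
have gM w : (0 < size w)%N ->
    d (g w) = - \sum_(1 <= j < size w) sg (g (take j w)) * g (drop j w).
  move=> s0; rewrite /g ga3 size_map // -sumrN; apply: eq_bigr => j _.
  by rewrite -map_take -map_drop barE mulNr.
(* Here [u] is an arbitrary cycle, so the operation is used outside the basis: its value on the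
   classes of [u] and [z t] bounds the product of the chosen representatives, and the term with [b]
   accounts for replacing the first one by [u]. *)
have g2 u t : U u -> d u = 0 -> pi (aug0 u) = 0 ->
    exists2 b, U b & sg u * g [:: t] = d b.
  move=> Uu du u0; pose c : {w : set A | reduced_homology pi q w} := exist _ _ (clsP u Uu du u0).
  have [_ [b Ub cE]] := ga2' c u erefl.
  have [|GU _] := ga1 [:: c; cls t]; first by [].
  have dG := ga3 [:: c; cls t] isT; rewrite /= big_nat1 /= cE barE mulNr in dG.
  have [dg _] := g1 t.
  exists (sg b * g [:: t] - ga [:: c; cls t]).
    apply: submod_B; [exact: inA_submod | | exact/stageE].
    by apply: inA_mul_var; [exact: sg_var | case: (gP [:: t])].
  rewrite (linB _ _ (@difL R A)) dG opprK dif_mul dg mulr0 addr0.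
  by rewrite (linD _ _ (@sgL R A)) mulrDl sg_dif mulNr addrCA subrr addr0.
have [phi phiP] := massey_maps zP zi zs gP g1 gM g2.
exists (split_map phi); split.
  by apply: split_map_mor => t; case: (phiP t).
apply: (split_map_qis (z := z)) => //; try by move=> t; case: (phiP t).
by move=> t; have [_ _ _ ->] := phiP t; apply: (prj_g zP g1).
Qed.

End GolodSplitting.

(** * Polynomial growth *)

Section Growth.
Variables (R : comNzRingType) (A : tate_algebra R).
Local Notation d := (dif A).

Section HighPart.
Variables (c q : nat).
Hypothesis cq : (0 < c <= q.+1)%N.
Implicit Types (al be mu : texpo A).

(** Cutting the variables at degree [c] presents the stage [q] as a free module over the stage
    [c - 1], with the monomials in the higher variables as a basis. *)
Definition lo al : texpo A := fun n i => if (n < c)%N then al n i else 0%N.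
Definition hi al : texpo A := fun n i => if (n < c)%N then 0%N else al n i.

Let c0 : (0 < c)%N. Proof. by case/andP: cq. Qed.

Lemma eadd_lo_hi al : eadd (lo al) (hi al) = al.
Proof.
apply: functional_extensionality_dep => n; apply/funext => i.
by rewrite /eadd /lo /hi; case: ifP => _; rewrite ?addn0 ?add0n.
Qed.

Lemma lo_in al : normal_expo q al -> normal_in 0 c.-1 (lo al).
Proof.
move=> [_ h]; split=> n i H; rewrite /lo; last by case: ifP => // _; apply: h.
case: ltnP => // lt; have {}H : (c.-1 < n)%N by [].
by rewrite -ltnS prednK // ltnNge lt in H.
Qed.

Lemma hi_in al : normal_expo q al -> normal_in c q (hi al).
Proof.
move=> [h0 h]; split=> n i H; rewrite /hi; last by case: ifP => // _; apply: h.
by case: ltnP => // ge; case/orP: H => [|/h0 -> //]; rewrite ltnNge ge.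
Qed.

Lemma normal_lo al : normal_in 0 c.-1 al <-> normal_expo c.-1 al.
Proof. by split=> -[h1 h2]; split=> // n i H; apply: h1; rewrite ?H. Qed.

Lemma normal_hi al : normal_in c q al -> normal_expo q al.
Proof. by move=> [h1 h2]; split=> // n i H; apply: h1; rewrite H orbT. Qed.

Lemma lo_eadd al be : normal_in 0 c.-1 al -> normal_in c q be -> lo (eadd al be) = al.
Proof.
move=> [a1 _] [b1 _]; apply: functional_extensionality_dep => n; apply/funext => i.
rewrite /lo /eadd; case: ltnP => lt; first by rewrite b1 ?lt // addn0.
by rewrite a1 //= prednK.
Qed.

Lemma hi_eadd al be : normal_in 0 c.-1 al -> normal_in c q be -> hi (eadd al be) = be.
Proof.
move=> [a1 _] [b1 _]; apply: functional_extensionality_dep => n; apply/funext => i.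
rewrite /hi /eadd; case: ltnP => lt; first by rewrite b1 ?lt.
by rewrite a1 //= prednK.
Qed.

Lemma mon_lo_hi al : normal_expo q al -> mon al = mon (lo al) * mon (hi al).
Proof.
move=> qal; have [_ ->] := mon_low_high cq (lo_in qal) (hi_in qal).
by rewrite eadd_lo_hi.
Qed.

Definition hideg al := edeg (hi al).

Lemma nrm_lo al : normal_expo q al -> nrm (lo al).
Proof. by move=> /lo_in /normal_lo; exists c.-1. Qed.

Lemma nrm_hi al : normal_expo q al -> nrm (hi al).
Proof. by move=> /hi_in /normal_hi; exists q. Qed.

Lemma edeg_lo_hi al : normal_expo q al -> edeg al = (edeg (lo al) + hideg al)%N.
Proof.
move=> qal; rewrite -edegD ?eadd_lo_hi //; [exact: nrm_lo | exact: nrm_hi | by exists q].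
Qed.

Definition low := inA (@le_var R A c.-1).

Definition hi_eq mu : set (texpo A) := [set al | normal_expo q al /\ hi al = mu].
Definition hi_lt p : set (texpo A) := [set al | normal_expo q al /\ (hideg al < p)%N].

Lemma low_mul_mon (x : A) mu : low x -> normal_in c q mu -> inA (hi_eq mu) (x * mon mu).
Proof.
move=> lx cmu; move: x lx; apply: inA_ind => [|al na lal].
  split=> [|e x y Sx Sy]; first by rewrite /= mul0r; apply: submod0; exact: inA_submod.
  by rewrite /= mulrDl -scalerAl; case: (inA_submod (hi_eq mu)) => _; apply.
have lal' : normal_in 0 c.-1 al by apply/normal_lo.
have [qab ->] := mon_low_high cq lal' cmu.
apply: inA_mon; first by exists q.
by split=> //; apply: hi_eadd.
Qed.

Lemma low_mul_dgr (x y : A) e p : low x -> inA (@le_var R A q `&` @dgr R A e) y -> (e < p)%N ->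
  inA (hi_lt p) (x * y).
Proof.
move=> lx gy ep; move: y gy; apply: inA_ind => [|al na [qal dal]].
  split=> [|a y z Sy Sz]; first by rewrite /= mulr0; apply: submod0; exact: inA_submod.
  by rewrite /= mulrDr -scalerAr; case: (inA_submod (hi_lt p)) => _; apply.
rewrite /= mon_lo_hi // mulrA.
have : inA (hi_eq (hi al)) (x * mon (lo al) * mon (hi al)).
  apply: low_mul_mon (hi_in qal); apply: inA_mul_var => //.
  by apply: inA_mon; [exact: nrm_lo | apply/normal_lo; apply: lo_in].
apply: inA_sub => be [qbe hbe]; split=> //; rewrite /hideg hbe.
by apply: leq_ltn_trans ep; rewrite -dal (edeg_lo_hi qal) leq_addl.
Qed.

(** In Leibniz's rule, the term in which the high monomial is differentiated has high part of
    smaller degree. Hence the degree of the high part defines a filtration by subcomplexes. *)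
Lemma dif_mon_split al : normal_expo q al ->
  inA (hi_lt (hideg al)) (d (mon al) - d (mon (lo al)) * mon (hi al)).
Proof.
move=> qal; rewrite {1}mon_lo_hi // dif_mul addrC addKr.
have gh : inA (@le_var R A q `&` @dgr R A (hideg al)) (mon (hi al)).
  by apply: inA_mon; [exact: nrm_hi | split=> //; apply/normal_hi/hi_in].
case e: (hideg al) => [|p].
  rewrite (subcx_gd0 (P := @le_var R A q)); last by rewrite -e.
  by rewrite mulr0; apply: submod0; exact: inA_submod.
have : low (sg (mon (lo al))).
  apply: sg_var; apply: inA_mon; [exact: nrm_lo | apply/normal_lo; exact: lo_in].
move=> ls; apply: (low_mul_dgr (e := p) ls) => //.
by apply: subcx_gd_gr; [exact: dif_var | rewrite -e].
Qed.

Lemma low_dif_lo al : normal_expo q al -> low (d (mon (lo al))).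
Proof.
by move=> qal; apply: dif_var; apply: inA_mon; [exact: nrm_lo | apply/normal_lo; exact: lo_in].
Qed.

Lemma hi_lt_dif p (a : A) : inA (hi_lt p) a -> inA (hi_lt p) (d a).
Proof.
move: a; apply: (inA_ind (Q := [set a | inA (hi_lt p) (d a)])) => [|al na [qal hal]].
  split=> [|e x y Sx Sy]; first by rewrite /= (lin0 (@difL R A)); apply: submod0; exact: inA_submod.
  by rewrite /= difL; case: (inA_submod (hi_lt p)) => _; apply.
rewrite /= -[d (mon al)](subrK (d (mon (lo al)) * mon (hi al))).
apply: submod_D; first exact: inA_submod.
  apply: inA_sub (dif_mon_split qal) => be [qbe hbe]; split=> //; exact: ltn_trans hal.
apply: inA_sub (low_mul_mon (low_dif_lo qal) (hi_in qal)) => be [qbe hbe].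
by split=> //; rewrite /hideg hbe.
Qed.

Definition filt p : gcomplex R := subcx (@hi_lt_dif p).

(** The coordinate at the high monomial [mu], with values in the lower stage. *)
Definition hcoef mu : A -> A := ext (fun al => if hi al == mu then mon (lo al) else 0).

Lemma hcoefL mu : linear (hcoef mu). Proof. exact: extL. Qed.

Lemma hcoef_mon mu al : nrm al -> hcoef mu (mon al) = if hi al == mu then mon (lo al) else 0.
Proof. by move=> na; rewrite /hcoef ext_mon. Qed.

Lemma hcoef_mul mu mu' (x : A) : low x -> normal_in c q mu' ->
  hcoef mu (x * mon mu') = if mu' == mu then x else 0.
Proof.
move=> lx cmu; move: x lx.
have L2 : linear (fun x : A => if mu' == mu then x else 0).
  by move=> e x y; case: eqP => // _; rewrite scaler0 addr0.
apply: (lin_eq (compL (@mulrL R A (mon mu')) (@hcoefL mu)) L2) => al na /normal_lo lal.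
have [qab ->] := mon_low_high cq lal cmu.
by rewrite hcoef_mon ?hi_eadd ?lo_eadd //; exists q.
Qed.

Lemma hcoef_lt mu p (y : A) : (p <= edeg mu)%N -> inA (hi_lt p) y -> hcoef mu y = 0.
Proof.
move=> le; move: y; apply: (lin_eq (@hcoefL mu) (g := fun=> 0)) => [e x y|al na [qal hal]].
  by rewrite scaler0 addr0.
rewrite hcoef_mon //; case: eqP => // e; move: hal; rewrite /hideg e.
by rewrite ltnNge le.
Qed.

(** On the graded pieces of the filtration only the differential of the coefficients survives. *)
Lemma hcoef_dif mu (y : A) : inA (hi_lt (edeg mu).+1) y ->
  hcoef mu (d y) = d (hcoef mu y).
Proof.
move: y; apply: (lin_eq (compL (@difL R A) (@hcoefL mu)) (compL (@hcoefL mu) (@difL R A))).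
move=> al na [qal hal] /=.
rewrite -[d (mon al)](subrK (d (mon (lo al)) * mon (hi al))) (linD _ _ (@hcoefL mu)).
rewrite (hcoef_lt _ (dif_mon_split qal)) // add0r.
rewrite hcoef_mul ?hcoef_mon //; [|exact: low_dif_lo | exact: hi_in].
by case: eqP => // _; rewrite (lin0 (@difL R A)).
Qed.

Definition mus p : seq (texpo A) :=
  [seq al <- degexpos A q p | `[< normal_in c q al >]].

Lemma musP p mu : mu \in mus p <-> normal_in c q mu /\ edeg mu = p.
Proof.
rewrite mem_filter mem_degexpos; split=> [/andP[/asboolP ? /asboolP[]] //|[cmu dmu]].
by apply/andP; split; apply/asboolP => //; split=> //; apply: normal_hi.
Qed.

Lemma uniq_mus p : uniq (mus p). Proof. by rewrite filter_uniq // undup_uniq. Qed.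

Definition one p n := if n == p then size (mus p) else 0%N.

Definition mu_at p (t : {i : nat & 'I_(one p i)}) : texpo A := nth (@e0 R A) (mus p) (tagged t).

Lemma one_tag p (t : {i : nat & 'I_(one p i)}) : tag t = p /\ (tagged t < size (mus p))%N.
Proof. by case: t => j [a]; rewrite /= /one; case: eqP. Qed.

Lemma mu_atP p t : normal_in c q (@mu_at p t) /\ edeg (@mu_at p t) = p.
Proof. by apply/musP; rewrite mem_nth //; case: (one_tag t). Qed.

Lemma mu_at_surj p mu : mu \in mus p -> exists t, @mu_at p t = mu.
Proof.
move=> h; have lt : (index mu (mus p) < one p p)%N by rewrite /one eqxx index_mem.
by exists (existT _ p (Ordinal lt)); rewrite /mu_at /= nth_index.
Qed.

Lemma hi_lt_decomp p (y : A) : inA (hi_lt p.+1) y ->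
  y = prj (hi_lt p) y + \sum_(mu <- mus p) hcoef mu y * mon mu.
Proof.
move: y; apply: (lin_eq (@idL _ _)) => [|al na [qal hal]].
  apply: addL; first exact: prjL.
  move=> e x y; rewrite scaler_sumr -big_split; apply: eq_bigr => mu _ /=.
  by rewrite hcoefL mulrDl scalerAl.
rewrite prj_mon //; under eq_bigr do rewrite hcoef_mon //.
case: (ltnP (hideg al) p) => lt.
  rewrite asboolT // big_seq big1 ?addr0 // => mu /musP[_ dmu].
  by case: eqP => [e|_]; [rewrite /hideg e dmu ltnn in lt | rewrite mul0r].
have dp : hideg al = p by apply/eqP; rewrite eqn_leq lt andbT -ltnS.
rewrite asboolF ?add0r; last by case=> _; rewrite dp ltnn.
rewrite (bigD1_seq (hi al)) ?uniq_mus //=; last by apply/musP; split=> //; apply: hi_in.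
rewrite eqxx big1 ?addr0 -?mon_lo_hi // => mu ne.
by rewrite eq_sym (negPf ne) mul0r.
Qed.

(** Each graded piece is a sum of shifts by [p] of the lower stage, one for every high monomial of
    degree [p]. The sign [(-1) ^+ (p * n)] in the quotient map absorbs the sign of the shifted
    differential. *)
Lemma filt_ses p : sesq (filt p) (filt p.+1) (tens (zd R (one p)) (tU A c.-1)).
Proof.
pose g (n : nat) (y : filt p.+1) : tens (zd R (one p)) (tU A c.-1) :=
  fun t => (-1) ^+ (p * n) *: hcoef (mu_at t) y.
have gr_le n y t : inA (hi_lt p.+1 `&` @dgr R A n) y ->
    if (tag t <= n)%N then inA (@le_var R A c.-1 `&` @dgr R A (n - tag t)) (hcoef (@mu_at p t) y)
    else hcoef (mu_at t) y = 0.
  have [tp _] := one_tag t; have [cmu dmu] := mu_atP t; rewrite tp => gy.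
  have mE al : nrm al -> (hi_lt p.+1 `&` @dgr R A n) al ->
      (hi al == mu_at t -> (p <= n)%N /\ inA (@le_var R A c.-1 `&` @dgr R A (n - p)) (mon (lo al))).
    move=> na [[qal _] dal] /eqP e; have E := edeg_lo_hi qal.
    rewrite dal /hideg e dmu in E; split; first by rewrite E leq_addl.
    apply: inA_mon; first exact: nrm_lo.
    by split; [apply/normal_lo; exact: lo_in | rewrite /dgr /= E addnK].
  case: leqP => le.
    move: y gy; apply: (inA_ind (Q := [set y | inA (@le_var R A c.-1 `&` @dgr R A (n - p)) (hcoef (mu_at t) y)])).
      split=> [|e x y Sx Sy]; first by rewrite /= (lin0 (@hcoefL _)); apply: submod0; exact: inA_submod.
      by rewrite /= hcoefL; case: (inA_submod (@le_var R A c.-1 `&` @dgr R A (n - p))) => _; apply.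
    move=> al na Pal; rewrite /= hcoef_mon //; case: ifP => [/(mE al na Pal) []//|_].
    by apply: submod0; exact: inA_submod.
  move: y gy; apply: (lin_eq (@hcoefL _) (g := fun=> 0)) => [e x y|al na Pal].
    by rewrite scaler0 addr0.
  rewrite hcoef_mon //; case: ifP => // /(mE al na Pal) [].
  by rewrite leqNgt le.
exists (fun _ y => y), g; split.
- split=> // n x; apply: inA_sub => al [[qal hal] dal]; split=> //; split=> //; exact: ltnW.
- split.
  + move=> n e x y; apply/funext => t; rewrite /g hcoefL.
    rewrite [RHS](_ : _ = e *: ((-1) ^+ (p * n) *: hcoef (mu_at t) x) +
      (-1) ^+ (p * n) *: hcoef (mu_at t) y) //.
    by rewrite scalerDr !scalerA mulrC.
  + move=> n y gy t; have := gr_le n y t gy; rewrite /g; case: ifP => _ H.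
      by apply: submod_Z => //; exact: inA_submod.
    by rewrite H scaler0.
  + move=> n y gy; apply/funext => t; rewrite zd_gd /g (linZ _ _ (@gdL _ _)) scalerA.
    have [tp _] := one_tag t; have [_ dmu] := mu_atP t.
    rewrite [in RHS]/= hcoef_dif; last by rewrite dmu; apply: inAIl gy.
    congr (_ *: _); rewrite -exprD tp mulnS addnA addnn -mul2n exprD exprM sqrrN.
    by rewrite !expr1n mul1r.
- by [].
- move=> n y gy; split=> [y0|[x gx ->]].
    exists y => //.
    have hc mu : mu \in mus p -> hcoef mu y = 0.
      move=> /mu_at_surj [t <-]; have /(congr1 (fun h => (-1) ^+ (p * n) *: h t)) := y0.
      by rewrite /g signZK => ->; rewrite scaler0.
    rewrite (hi_lt_decomp (inAIl gy)) big_seq big1 ?addr0 => [|mu /hc ->]; last by rewrite mul0r.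
    by apply: inA_sub (prj_in (hi_lt p) gy) => al [h1 [_ h2]].
  apply/funext => t; rewrite /g (hcoef_lt _ (inAIl gx)) ?scaler0 //.
  by have [_ ->] := mu_atP t.
move=> n zz gz.
case: (leqP p n) => pn; last first.
  exists 0; first exact: gr0.
  apply/funext => t; rewrite /g (lin0 (@hcoefL _)) scaler0.
  by have [tp _] := one_tag t; rewrite (tgr_gt gz) // tp.
pose zt (j : 'I_(size (mus p))) : A := zz (existT _ p (cast_ord (esym (ifT _ _ (eqxx p))) j)).
have gzt j : inA (@le_var R A c.-1 `&` @dgr R A (n - p)) (zt j).
  exact: (@tgr_le R (zd R (one p)) (tU A c.-1) n zz (existT _ p _) gz pn).
exists ((-1) ^+ (p * n) *: \sum_(j < size (mus p)) zt j * mon (nth (@e0 R A) (mus p) j)).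
  apply: submod_Z; first exact: inA_submod.
  apply: submod_sum => [|j _]; first exact: inA_submod.
  have [cmu dmu] : normal_in c q (nth (@e0 R A) (mus p) j) /\ edeg (nth (@e0 R A) (mus p) j) = p.
    by apply/musP; rewrite mem_nth.
  apply: inAI.
    apply: inA_sub (low_mul_mon (inAIl (gzt j)) cmu) => al [qal hal]; split=> //.
    by rewrite /hideg hal dmu.
  rewrite -(subnK pn); apply: inA_mul_dgr; first exact: inAIr (gzt j).
  by apply: inA_mon => //; exists q; apply: normal_hi.
apply/funext => t; rewrite /g (linZ _ _ (@hcoefL _)) signZK (lin_sum _ _ _ (@hcoefL _)).
have [tp lt] := one_tag t.
rewrite (bigD1 (Ordinal lt)) //= big1 ?addr0.
  rewrite hcoef_mul; [|exact: inAIl (gzt _)|]; last by apply: (mu_atP t).1.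
  rewrite eqxx; rewrite /zt; congr (zz _).
  case: t tp lt => j a /= e lt; subst j; congr existT; exact: val_inj.
move=> j ne; have [cmu dmu] : normal_in c q (nth (@e0 R A) (mus p) j) /\ edeg (nth (@e0 R A) (mus p) j) = p.
  by apply/musP; rewrite mem_nth.
rewrite hcoef_mul //; last exact: inAIl (gzt j).
rewrite nth_uniq ?uniq_mus //; case: eqP => // e.
by case/eqP: ne; apply: val_inj.
Qed.

End HighPart.
End Growth.

(** * From R through the Koszul complex to the stage q *)

Section GrowthBound.
Variables (R : comNzRingType) (m : set R) (k : fieldType) (pi : {rmorphism R -> k}).
Hypothesis residue : residue_map m pi.
Variable A : tate_algebra R.
Hypothesis acl : is_acyclic_closure m A.
Variable Fs : seq (fcomplex R).

Lemma mt_gr0 (X : gcomplex R) : (forall n (x : X), gr n x -> x = 0) ->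
  forall n (x : multitens Fs X), gr n x -> x = 0.
Proof.
move=> X0; elim: Fs => //= F Gs IH n x gx; apply/funext => t.
by have := gx t; case: ifP => // _ /IH.
Qed.

(** The graded pieces add up. Those with [j > n] do not reach degree [n], and [filt n.+2] already
    contains everything of degree at most [n.+1]. *)
Lemma hle_filtration c q n (h : nat -> nat) : (0 < c <= q.+1)%N ->
  (forall j, (j <= n)%N -> (0 < size (mus A c q j))%N ->
     hle pi (multitens Fs (tU A c.-1)) (n - j) (h (n - j)%N)) ->
  hle pi (multitens Fs (tU A q)) n (\sum_(j < n.+1) size (mus A c q j) * h (n - j)).
Proof.
move=> cq H.
have step p : hle pi (multitens Fs (filt A cq p)) n
    (\sum_(j < p) if (j <= n)%N then size (mus A c q j) * h (n - j) else 0)%N.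
  elim: p => [|p IH].
    rewrite big_ord0; apply: dimle0 => x [gx _].
    suff -> : x = 0 by apply: submod0; exact: bdrS.
    apply: (@mt_gr0 (filt A cq 0) _ n x gx) => i y; apply: (lin_eq (@idL _ _) (g := fun=> 0)) => [e u w|al _ [[]]].
      by rewrite scaler0 addr0.
    by [].
  have [f [g fgs]] := sesq_mt Fs (filt_ses A cq p).
  rewrite big_ord_recr /=; apply: (hle_ses fgs IH).
  have -> : (if (p <= n)%N then size (mus A c q p) * h (n - p) else 0)%N =
      (\sum_(j < n.+1) one A c q p j * h (n - j))%N.
    case: leqP => pn; last first.
      rewrite big1 // => j _; rewrite /one ltn_eqF //.
      exact: leq_trans (ltn_ord j) pn.
    have pn' : (p < n.+1)%N by [].
    rewrite (bigD1 (Ordinal pn')) //= /one eqxx big1 ?addn0 // => j ne.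
    by rewrite -val_eqE /= in ne; rewrite (negPf ne).
  apply: hle_mt_zd => j jn; rewrite /one; case: eqP => // e p0.
  by rewrite e in jn *; apply: H.
have -> : (\sum_(j < n.+1) size (mus A c q j) * h (n - j) =
   \sum_(j < n.+2) if (j <= n)%N then size (mus A c q j) * h (n - j) else 0)%N.
  rewrite [RHS]big_ord_recr /= ltnn addn0; apply: eq_bigr => j _.
  by rewrite -ltnS ltn_ord.
apply: (hle_agree _ (ltnSn n) (step n.+2)); apply: agree_mt.
exists (fun _ a => a); split=> //.
- split=> // i x; apply: inA_sub => al [[qal _] dal]; by split.
- move=> i y le gy; exists y => //; apply: inA_sub gy => al [qal dal]; split=> //; split=> //.
  apply: (@leq_ltn_trans (edeg al)); last by rewrite ltnS dal.
  by rewrite (edeg_lo_hi cq qal) leq_addl.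
Qed.

Lemma tU0_qiso : qiso (modcx R^o) (tU A 0).
Proof.
pose f (n : nat) (r : modcx R^o) : tU A 0 := (r : R)%:A.
have fm : mor f.
  split.
  - by move=> n a x y; rewrite /f scalerDl scalerA.
  - move=> n x [->|->]; last by rewrite /f scale0r; exact: gr0.
    by apply: inAI (inA_const _ _); apply: inA_dgr_le_var (inA_const _ _).
  - move=> n x [//|->]; rewrite /f !scale0r; exact: lin0 (@gdL _ _).
exists f; split=> //; apply: bij_qis => // [n x _|n y gy].
  by move=> /(congr1 (@aug0 R A)); rewrite /f aug0_const (lin0 (@aug0L R A)).
case: n gy => [|n] gy.
  by have [r ->] := inA_dgr0 (inAIr gy); exists r => //; left.
exists 0; first by right.
rewrite /f scale0r; apply/esym; move: y gy.
apply: (lin_eq (@idL _ _) (g := fun=> 0)) => [e u w|al na [qal dal]].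
  by rewrite scaler0 addr0.
suff e0al : edeg al = 0%N by rewrite /dgr /= e0al in dal.
rewrite -(edegE qal) /expo_deg big_ord1 big1 // => i _; exact: mul0n.
Qed.

(** The variables of degree 1 are exterior, so the Koszul complex has length at most their
    number. *)
Lemma mus1_size j : (0 < size (mus A 1 1 j))%N -> (j <= nvar A 1)%N.
Proof.
case E: (mus A 1 1 j) => [//|mu s] _.
have /musP [cmu <-] : mu \in mus A 1 1 j by rewrite E inE eqxx.
have qmu := normal_hi cmu.
rewrite -(edegE qmu) /expo_deg big_ord_recl big_ord1 /= big1 ?add0n; last by move=> i _; exact: mul0n.
rewrite -[X in (_ <= X)%N]card_ord -sum1_card; apply: leq_sum => i _.
by rewrite mul1n; apply: qmu.2.
Qed.

(** The cut [c = 1] leads from R to the Koszul complex: its homology vanishes from degree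
    [n0 + nvar A 1] on and is finite-dimensional below, so one constant [C] bounds it. The cut
    [c = 2] leads to the stage [q], at the cost of at most [n.+1 ^ D] monomials in each of the
    [n.+1] degrees up to [n]; hence the exponent [D.+1]. *)
Lemma growth_bound q n0 : noetherian R -> (1 <= q)%N ->
  (forall n, (n0 <= n)%N -> @cyc R (multitens Fs (modcx R^o)) n `<=` @bdr R _ n) ->
  exists C D, forall n, hle pi (multitens Fs (tU A q)) n (C * n.+1 ^ D).
Proof.
move=> noethR q1 H0.
have HR n : (n0 <= n)%N -> hle pi (multitens Fs (tU A 0)) n 0.
  by move=> /H0 /(dimle0 pi) /(hle_qiso pi n 0 (qiso_mt Fs tU0_qiso)).
have HK n : (n0 + nvar A 1 <= n)%N -> hle pi (multitens Fs (tU A 1)) n 0.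
  move=> le; have := @hle_filtration 1 1 n (fun=> 0%N) isT.
  rewrite big1; last by move=> j _; rewrite muln0.
  apply=> j jn /mus1_size jv; apply: HR.
  by rewrite leq_subRL //; apply: leq_trans le; rewrite addnC leq_add2l.
have HKn n : exists h, hle pi (multitens Fs (tU A 1)) n h.
  apply: (hle_exists (pi_surj residue) noethR).
    by apply: fin_gen_mt => i; apply: fin_gen_tU.
  by move=> r r0; apply: null_homotopic_mt; apply: (null_homotopic_tU residue acl).
have [h hP] := choice HKn.
pose C := (\max_(i < n0 + nvar A 1) h i)%N.
have HC n : hle pi (multitens Fs (tU A 1)) n C.
  case: (ltnP n (n0 + nvar A 1)) => lt.
    exact: dimle_mono (leq_bigmax (Ordinal lt)) (hP n).
  exact: dimle_mono (leq0n _) (HK n lt).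
pose D := size (upto (nvar A) q).
exists C, D.+1 => n.
have := @hle_filtration 2 q n (fun=> C) q1 (fun j _ _ => HC _).
apply: dimle_mono; rewrite -big_distrl /= [X in (X <= _)%N]mulnC leq_mul2l; apply/orP; right.
apply: leq_trans (_ : \sum_(j < n.+1) n.+1 ^ D <= _)%N; last first.
  by rewrite sum_nat_const card_ord expnS.
apply: leq_sum => j _.
apply: leq_trans (_ : j.+1 ^ D <= _)%N; last first.
  by elim: (D) => // e IH; rewrite !expnS leq_mul // ltn_ord.
rewrite /mus size_filter; apply: leq_trans (count_size _ _) _.
apply: leq_trans (size_undup _) _; rewrite size_filter.
by apply: leq_trans (count_size _ _) _; rewrite size_expos.
Qed.

End GrowthBound.

(** * Renewal equations *)

Section Numeric.
Variable RT : realType.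
Implicit Types (a b c e g s w : nat -> RT) (x r rho : RT).

Definition conv a b n : RT := \sum_(i < n.+1) a i * b (n - i)%N.

(** Equivalently, the generating series has radius of convergence at least 1. *)
Definition subexp a : Prop := forall r, 1 < r -> exists C : RT, forall n, `|a n| <= C * r ^+ n.

(** Truncations are polynomials, whose ring laws give commutativity and associativity of [conv]. *)
Lemma convE a b n N : (n < N)%N ->
  conv a b n = ((\poly_(i < N) a i) * (\poly_(i < N) b i))`_n.
Proof.
move=> nN; rewrite coefM; apply: eq_bigr => i _; rewrite !coef_poly.
have iN : (i < N)%N by apply: leq_trans nN; rewrite ltn_ord.
by rewrite iN (leq_ltn_trans (leq_subr _ _) nN).
Qed.

Lemma convC a b n : conv a b n = conv b a n.
Proof. by rewrite !(convE _ _ (ltnSn n)) mulrC. Qed.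

Lemma conv_eq a a' b b' n : (forall i, (i <= n)%N -> a i = a' i) ->
  (forall i, (i <= n)%N -> b i = b' i) -> conv a b n = conv a' b' n.
Proof.
move=> ea eb; apply: eq_bigr => i _; rewrite ea ?eb ?leq_subr //.
by rewrite -ltnS.
Qed.

Lemma convA a b c n : conv (conv a b) c n = conv a (conv b c) n.
Proof.
pose P a' : {poly RT} := \poly_(i < n.+1) a' i.
have pE a' b' (p : {poly RT}) : (P (conv a' b') * p)`_n = (P a' * P b' * p)`_n.
  rewrite !coefM; apply: eq_bigr => i _; rewrite [X in X * _]coef_poly ltn_ord.
  by rewrite (convE _ _ (ltn_ord i)).
rewrite !(convE _ _ (ltnSn n)) -!/(P _) pE [in RHS]mulrC pE.
by rewrite -mulrA [P a * _]mulrC.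
Qed.

Lemma geom_le x n : 0 <= x -> x < 1 -> \sum_(i < n) x ^+ i <= (1 - x)^-1.
Proof.
move=> x0 x1; have p : 0 < 1 - x by rewrite subr_gt0.
rewrite -[X in X <= _](mulfK (lt0r_neq0 p)) -[X in _ <= X]mul1r ler_pM2r ?invr_gt0 //.
have -> : (\sum_(i < n) x ^+ i) * (1 - x) = 1 - x ^+ n.
  elim: n => [|n IH]; first by rewrite big_ord0 mul0r expr0 subrr.
  by rewrite big_ord_recr mulrDl IH /= exprS; ring.
by rewrite gerBl exprn_ge0.
Qed.

Lemma geom_tail_le x k n : 0 <= x -> x < 1 ->
  \sum_(k <= i < n) x ^+ i <= x ^+ k / (1 - x).
Proof.
move=> x0 x1; case: (leqP k n) => kn; last first.
  rewrite big_geq; last exact: ltnW.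
  by rewrite mulr_ge0 ?exprn_ge0 // invr_ge0 subr_ge0 ltW.
rewrite -{1}[k]add0n big_addn big_mkord; under eq_bigr do rewrite exprD mulrC.
by rewrite -mulr_sumr ler_wpM2l ?exprn_ge0 ?geom_le.
Qed.

Lemma bernoulli r n : 1 <= r -> 1 + n%:R * (r - 1) <= r ^+ n.
Proof.
move=> r1; elim: n => [|n IH]; first by rewrite expr0 mul0r addr0.
rewrite exprS; apply: le_trans (_ : r * (1 + n%:R * (r - 1)) <= _).
  rewrite -natr1 -subr_ge0 (_ : _ - _ = n%:R * (r - 1) ^+ 2); last by ring.
  by rewrite mulr_ge0 ?sqr_ge0.
by rewrite ler_wpM2l // (le_trans _ r1).
Qed.

Lemma expr_small (C x eps : RT) : 0 <= x -> x < 1 -> 0 < eps -> exists N, C * x ^+ N < eps.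
Proof.
rewrite le_eqVlt => /orP[/eqP <- _ e0|x0 x1 e0].
  by exists 1%N; rewrite expr1 mulr0.
have i1 : 1 < x^-1 by rewrite invf_gt1.
have d0 : 0 < x^-1 - 1 by rewrite subr_gt0.
pose N := Num.Def.archi_bound (`|C| / eps / (x^-1 - 1)); exists N.
have : `|C| / eps / (x^-1 - 1) < N%:R.
  by apply: archi_boundP; rewrite divr_ge0 ?divr_ge0 // ltW.
rewrite ltr_pdivrMr // => lt.
have : `|C| / eps < x ^- N.
  rewrite -exprVn; apply: lt_le_trans (bernoulli N (ltW i1)).
  by apply: lt_trans lt _; rewrite ltrDr.
rewrite ltr_pdivrMr // ltr_pdivlMl ?exprn_gt0 // mulrC; apply: le_lt_trans.
by rewrite ler_wpM2r ?ler_norm // exprn_ge0 // ltW.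
Qed.

Lemma subexp_le a b : (forall n, `|a n| <= `|b n|) -> subexp b -> subexp a.
Proof.
move=> ab sb r r1; have [C CP] := sb r r1; exists C => n.
exact: le_trans (ab n) (CP n).
Qed.

Lemma subexp_cst (C : RT) : subexp (fun=> C).
Proof.
move=> r r1; exists `|C| => n; rewrite ler_peMr //.
by apply: exprn_ege1; apply: ltW.
Qed.

Lemma subexpM a b : subexp a -> subexp b -> subexp (fun n => a n * b n).
Proof.
move=> sa sb r r1; have r0 : 0 <= r by apply: ltW; apply: lt_trans r1.
have s1 : 1 < Num.sqrt r by rewrite -sqrtr1 ltr_sqrt // (lt_trans _ r1).
have [C CP] := sa _ s1; have [D DP] := sb _ s1.
exists (C * D) => n; rewrite normrM.
have -> : C * D * r ^+ n = (C * Num.sqrt r ^+ n) * (D * Num.sqrt r ^+ n).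
  by rewrite -{1}(sqr_sqrtr r0) -exprM mul2n -addnn exprD; ring.
by apply: ler_pM.
Qed.

Lemma subexp_succ : subexp (fun n => n.+1%:R).
Proof.
move=> r r1; have d0 : 0 < r - 1 by rewrite subr_gt0.
exists (1 + (r - 1)^-1) => n; rewrite normr_nat.
have B := bernoulli n (ltW r1).
have r0 : 0 <= r ^+ n by apply: exprn_ge0; apply: ltW; apply: lt_trans r1.
rewrite mulrDl mul1r -natr1 addrC; apply: lerD.
  by apply: le_trans B; rewrite lerDl mulr_ge0 // ltW.
rewrite mulrC ler_pdivlMr //; apply: le_trans B.
by rewrite lerDr.
Qed.

Lemma subexp_pow D : subexp (fun n => n.+1%:R ^+ D).
Proof.
elim: D => [|D IH]; first by apply: subexp_le (subexp_cst 1) => n; rewrite expr0.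
apply: subexp_le (subexpM subexp_succ IH) => n; by rewrite exprS.
Qed.

Lemma subexp_poly (C D : nat) : subexp (fun n => (C * n.+1 ^ D)%:R).
Proof.
apply: subexp_le (subexpM (subexp_cst C%:R) (subexp_pow D)) => n.
by rewrite natrM natrX.
Qed.

Lemma subexp_partial_sum e : subexp e -> subexp (fun n => \sum_(i < n.+1) `|e i|).
Proof.
move=> se r r1; have [C CP] := se r r1; have d0 : 0 < r - 1 by rewrite subr_gt0.
have C0 : 0 <= C by have := CP 0%N; rewrite expr0 mulr1; apply: le_trans.
have r0 : 0 < r by apply: lt_trans r1.
exists (C * (r / (r - 1))) => n; rewrite ger0_norm ?sumr_ge0 // -mulrA.
apply: le_trans (_ : \sum_(i < n.+1) C * r ^+ i <= _); first exact: ler_sum.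
rewrite -mulr_sumr ler_wpM2l // mulrAC ler_pdivlMr //.
have -> : (\sum_(i < n.+1) r ^+ i) * (r - 1) = r ^+ n.+1 - 1.
  elim: n => [|n IH]; first by rewrite big_ord1 expr0 mul1r expr1.
  by rewrite big_ord_recr mulrDl IH /= [r ^+ n.+2]exprS; ring.
by rewrite exprS gerBl.
Qed.

Definition renewal w a : Prop := subexp (fun n => a n - conv w a n).

Section Renewal.
Variable w : nat -> RT.
Hypothesis w0 : w 0%N = 0.
Hypothesis w_ge0 : forall n, 0 <= w n.
Hypothesis w_sub : subexp w.

(** By induction [a n] is at most the n-th partial sum of the absolute defects: a weight of total
    mass at most 1 combines earlier values, strictly earlier since [w 0 = 0], which are bounded by
    smaller partial sums. *)
Lemma renewal_small a : (forall J, \sum_(i < J) w i <= 1) -> (forall n, 0 <= a n) ->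
  renewal w a -> subexp a.
Proof.
move=> w1 a0 /subexp_partial_sum; apply: subexp_le => n.
set e := fun i => `|a i - conv w a i|.
rewrite [X in X <= _]ger0_norm // [X in _ <= X]ger0_norm ?sumr_ge0 //.
suff: a n <= \sum_(i < n.+1) e i by [].
have eS p p' : (p <= p')%N -> \sum_(i < p) e i <= \sum_(i < p') e i.
  move=> le; rewrite -(big_mkord xpredT e) -(big_mkord xpredT e) (@big_cat_nat _ _ _ p 0 p') //=.
  by rewrite lerDl; apply: sumr_ge0 => i _; exact: normr_ge0.
elim/ltn_ind: n => n IH; rewrite big_ord_recr /= -{1}[a n](subrK (conv w a n)) addrC.
apply: lerD; first by rewrite /e ler_norm.
apply: le_trans (_ : \sum_(i < n.+1) w i * \sum_(j < n) e j <= _).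
  apply: ler_sum => -[[|i] lt] _; first by rewrite /= w0 !mul0r.
  rewrite ler_wpM2l //=; apply: le_trans (IH _ _) _.
    by rewrite ltn_subrL /=; apply: leq_ltn_trans (leq0n i) lt.
  by apply: eS; rewrite -subSn // subSS leq_subr.
rewrite -mulr_suml ler_piMl //; apply: sumr_ge0 => i _; exact: normr_ge0.
Qed.

Section Root.
Variable rho : RT.
Hypothesis rho0 : 0 < rho.
Hypothesis rho1 : rho < 1.
Hypothesis rho_le : forall n, \sum_(i < n) w i * rho ^+ i <= 1.
Hypothesis rho_ge : forall eps, 0 < eps -> exists n, 1 - eps < \sum_(i < n) w i * rho ^+ i.

Let sc a : nat -> RT := fun n => a n * rho ^+ n.
(** As W(rho) = 1, this is the tail of the series beyond [n]. *)
Let s n : RT := 1 - \sum_(i < n.+1) w i * rho ^+ i.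

(** Capping [r] by the midpoint of 1 and the inverse of rho keeps the rescaled bound geometrically
    decreasing. *)
Lemma exists_ratio r : 1 < r -> exists r', [/\ 1 < r', r' <= r & r' * rho < 1].
Proof.
move=> r1; pose r' := Num.min r ((1 + rho^-1) / 2); exists r'.
have i1 : 1 < rho^-1 by rewrite invf_gt1.
have E2 : 2 = 1 + 1 :> RT by [].
have h1 : 1 < (1 + rho^-1) / 2 by rewrite ltr_pdivlMr // mul1r E2 ltrD2l.
split; first by rewrite lt_min r1.
  by rewrite ge_min lexx.
apply: le_lt_trans (_ : (1 + rho^-1) / 2 * rho < 1).
  by rewrite ler_pM2r // ge_min lexx orbT.
by rewrite mulrAC mulrDl mul1r mulVf ?gt_eqF // ltr_pdivrMr // mul1r E2 ltrD2r.
Qed.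

Lemma scaled_bound e r : 1 < r -> subexp e -> exists C, 0 <= C /\
  forall n, `|sc e n| <= C * (r * rho) ^+ n.
Proof.
move=> r1 /(_ r r1) [C CP]; exists C; split.
  by have := CP 0%N; rewrite expr0 mulr1; apply: le_trans.
move=> n; rewrite normrM [X in _ * X]ger0_norm ?exprn_ge0 ?(ltW rho0) //.
by rewrite exprMn mulrA ler_wpM2r ?exprn_ge0 ?(ltW rho0).
Qed.

Lemma s_ge0 n : 0 <= s n. Proof. by rewrite subr_ge0. Qed.

Lemma s0 : s 0 = 1. Proof. by rewrite /s big_ord1 w0 mul0r subr0. Qed.

Lemma sS n : s n.+1 = s n - sc w n.+1.
Proof. by rewrite /s big_ord_recr /= opprD addrA. Qed.

Lemma s_bound : exists C x, [/\ 0 <= C, 0 <= x, x < 1 & forall n, s n <= C * x ^+ n].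
Proof.
have [|r [r1 _ rr]] := @exists_ratio 2; first by rewrite ltr1n.
have [C [C0 CP]] := scaled_bound r1 w_sub; set x := r * rho in rr CP.
have x0 : 0 <= x by rewrite mulr_ge0 ?(ltW rho0) // ltW // (lt_trans _ r1).
exists (C / (1 - x)), x; split=> //; first by rewrite divr_ge0 // subr_ge0 ltW.
move=> n; apply/ler_addgt0Pr => eps e0.
have [N NP] := rho_ge e0; rewrite /s lerBlDr.
apply: le_trans (_ : \sum_(i < N) w i * rho ^+ i + eps <= _).
  by rewrite -lerBlDr ltW.
rewrite addrAC lerD2r.
have wx i : w i * rho ^+ i <= C * x ^+ i by apply: le_trans (CP i); exact: ler_norm.
have nn i : 0 <= w i * rho ^+ i by rewrite mulr_ge0 ?exprn_ge0 // ltW.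
case: (leqP N n.+1) => Nn.
  apply: le_trans (_ : \sum_(i < n.+1) w i * rho ^+ i <= _).
    rewrite -(big_mkord xpredT (fun i => w i * rho ^+ i)) -(big_mkord xpredT (fun i => w i * rho ^+ i)).
    by rewrite (@big_cat_nat _ _ _ N 0 n.+1) //= lerDl sumr_ge0.
  by rewrite lerDr mulr_ge0 ?exprn_ge0 // divr_ge0 // subr_ge0 ltW.
rewrite -(big_mkord xpredT (fun i => w i * rho ^+ i)) (@big_cat_nat _ _ _ n.+1) //=; last exact: ltnW.
rewrite big_mkord addrC lerD2r.
apply: le_trans (_ : \sum_(n.+1 <= i < N) C * x ^+ i <= _); first exact: ler_sum.
rewrite -mulr_sumr mulrAC -mulrA ler_wpM2l //.
apply: le_trans (geom_tail_le _ _ x0 rr) _.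
by rewrite ler_wpM2r ?invr_ge0 ?subr_ge0 ?(ltW rr) // exprS ler_piMl ?exprn_ge0 // ltW.
Qed.

Let defect a : nat -> RT := fun n => a n - conv w a n.

(* With S = (1 - W) / (1 - t) for the rescaled series, a S is the sequence of
   partial sums of the defect. *)
Lemma conv_s a n : conv (sc a) s n = \sum_(i < n.+1) sc (defect a) i.
Proof.
have scE i : sc (defect a) i = sc a i - conv (sc a) (sc w) i.
  rewrite /sc /defect mulrBl; congr (_ - _).
  rewrite convC /conv mulr_suml; apply: eq_bigr => j _.
  have -> : rho ^+ i = rho ^+ j * rho ^+ (i - j) by rewrite -exprD subnKC // -ltnS.
  by ring.
elim: n => [|n IH].
  by rewrite /conv !big_ord1 subnn s0 mulr1 scE /conv big_ord1 subnn /sc w0 !mul0r mulr0 subr0.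
have scw0 : sc w 0 = 0 by rewrite /sc w0 mul0r.
rewrite big_ord_recr -IH /= scE /conv !(big_ord_recr n.+1) /= !subnn s0 mulr1.
rewrite scw0 mulr0 addr0 addrCA [LHS]addrC -sumrB; congr (_ + _); apply: eq_bigr => i _.
have le : (i <= n)%N by rewrite -ltnS.
by rewrite subSn // sS mulrBr.
Qed.

Lemma sc_ge0 a : (forall n, 0 <= a n) -> forall n, 0 <= sc a n.
Proof. by move=> a0 n; rewrite mulr_ge0 ?exprn_ge0 // ltW. Qed.

Lemma le_conv_s a n : (forall n, 0 <= a n) -> sc a n <= conv (sc a) s n.
Proof.
move=> a0; rewrite /conv big_ord_recr /= subnn s0 mulr1 lerDr sumr_ge0 // => i _.
by rewrite mulr_ge0 ?sc_ge0 ?s_ge0.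
Qed.

(** The numbers [conv (sc a) s n] are partial sums of a geometrically convergent series and are
    nonnegative. A positive limit gives the second alternative. Otherwise they come arbitrarily
    close to 0, so each is at most a geometric tail, and it dominates [sc a n] because [s 0 = 1]. *)
Lemma renewal_dichotomy a : (forall n, 0 <= a n) -> renewal w a ->
  subexp a \/ exists eta N, 0 < eta /\ forall n, (N <= n)%N -> eta <= conv (sc a) s n.
Proof.
move=> a0 ra; case: (pselect (exists eta N, 0 < eta /\
  forall n, (N <= n)%N -> eta <= conv (sc a) s n)); first by right.
move=> nex; left => r r1.
have [r' [r1' rr' x1]] := exists_ratio r1.
have [C [C0 CP]] := scaled_bound r1' ra; set x := r' * rho in x1 CP.
have r'0 : 0 < r' by apply: lt_trans r1'.
have x0 : 0 <= x by rewrite mulr_ge0 // ltW.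
have x1' : 0 < 1 - x by rewrite subr_gt0.
exists (C / (1 - x)) => n; rewrite ger0_norm //.
suff H : conv (sc a) s n <= C / (1 - x) * x ^+ n.
  have : sc a n <= C / (1 - x) * x ^+ n by apply: le_trans H; apply: le_conv_s.
  rewrite /sc /x exprMn mulrA ler_pM2r ?exprn_gt0 // => /le_trans; apply.
  rewrite ler_wpM2l ?divr_ge0 // ?(ltW x1') //.
  by apply: lerXn2r; rewrite ?nnegrE ?(ltW r'0) // ltW // (lt_le_trans r'0).
apply/ler_addgt0Pr => eps e0.
have [N [nN /ltW LN]] : exists N, (n <= N)%N /\ conv (sc a) s N < eps.
  apply: contrapT => H; apply: nex; exists eps, n; split=> // N nN.
  by rewrite leNgt; apply/negP => lt; apply: H; exists N.
rewrite addrC -lerBlDr; apply: le_trans LN; rewrite !conv_s lerBlDr addrC -lerBlDr.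
rewrite -(big_mkord xpredT (sc (defect a))) -(big_mkord xpredT (sc (defect a))).
rewrite (@big_cat_nat _ _ _ n.+1 0 N.+1) //= opprD addrA subrr add0r.
apply: le_trans (ler_norm _) _; rewrite normrN.
apply: le_trans (ler_norm_sum _ _ _) _.
apply: le_trans (_ : \sum_(n.+1 <= i < N.+1) C * x ^+ i <= _).
  by apply: ler_sum => i _; apply: CP.
rewrite -mulr_sumr -mulrA ler_wpM2l // mulrC.
apply: le_trans (geom_tail_le _ _ x0 x1) _.
by rewrite ler_wpM2r ?invr_ge0 ?(ltW x1') // exprS ler_piMl ?exprn_ge0 // ltW.
Qed.

Lemma sum_conv_le a b M : (forall n, 0 <= a n) -> (forall n, 0 <= b n) ->
  \sum_(n < M) conv a b n <= (\sum_(n < M) a n) * \sum_(n < M) b n.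
Proof.
move=> a0 b0.
have -> : \sum_(n < M) conv a b n = \sum_(i < M) a i * \sum_(j < M - i) b j.
  elim: M => [|M IH]; first by rewrite !big_ord0.
  rewrite big_ord_recr /= IH [RHS]big_ord_recr /= /conv big_ord_recr /= addrA.
  congr (_ + _); last by rewrite subSnn subnn big_ord1.
  rewrite -big_split; apply: eq_bigr => i _ /=.
  by rewrite subSn ?(ltnW (ltn_ord i)) // big_ord_recr mulrDr.
rewrite mulr_suml; apply: ler_sum => i _; rewrite ler_wpM2l //.
rewrite -(big_mkord xpredT b) -(big_mkord xpredT b) (@big_cat_nat _ _ _ (M - i) 0 M) ?leq_subr //=.
by rewrite lerDl sumr_ge0.
Qed.

(** Otherwise [sc b] and [sc c], convolved with [s], both stay above positive constants. The
    convolution of all three is bounded and dominates [eta2] times the partial sums of [sc b], so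
    [sc b] is summable. As [s] is summable too, so is the convolution of [sc b] and [s], against its
    lower bound [eta1]. *)
Lemma renewal_conv_root b c : (forall n, 0 <= b n) -> (forall n, 0 <= c n) ->
  renewal w b -> renewal w c -> renewal w (conv b c) -> subexp b \/ subexp c.
Proof.
move=> b0 c0 rb rc rp.
case: (renewal_dichotomy b0 rb) => [|[eta1 [N1 [eta10 H1]]]]; first by left.
case: (renewal_dichotomy c0 rc) => [|[eta2 [N2 [eta20 H2]]]]; first by right.
exfalso.
have scM n : sc (conv b c) n = conv (sc b) (sc c) n.
  rewrite /sc /conv mulr_suml; apply: eq_bigr => j _.
  have -> : rho ^+ n = rho ^+ j * rho ^+ (n - j) by rewrite -exprD subnKC // -ltnS.
  by ring.
have [K KP] : exists K, forall n, conv (sc (conv b c)) s n <= K.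
  have [|r [r1 _ x1]] := @exists_ratio 2; first by rewrite ltr1n.
  have [C [C0 CP]] := scaled_bound r1 rp; set x := r * rho in x1 CP.
  have x0 : 0 <= x by rewrite mulr_ge0 ?(ltW rho0) // ltW // (lt_trans _ r1).
  exists (C / (1 - x)) => n; rewrite conv_s.
  apply: le_trans (_ : \sum_(i < n.+1) C * x ^+ i <= _).
    by apply: ler_sum => i _; apply: le_trans (CP i); exact: ler_norm.
  by rewrite -mulr_sumr ler_wpM2l // geom_le.
have sb0 := sc_ge0 b0; have sc0 := sc_ge0 c0.
have Sb n : \sum_(i < n) sc b i <= K / eta2.
  rewrite ler_pdivlMr // mulr_suml; apply: le_trans (KP (n + N2)%N).
  rewrite (conv_eq (a' := conv (sc b) (sc c)) (b' := s)) // convA.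
  have nn i : 0 <= sc b i * conv (sc c) s (n + N2 - i)%N.
    rewrite mulr_ge0 // /conv sumr_ge0 // => j _.
    by rewrite mulr_ge0 ?s_ge0.
  rewrite {1}/conv -(big_mkord xpredT (fun i => sc b i * eta2)).
  rewrite -(big_mkord xpredT (fun i => sc b i * conv (sc c) s (n + N2 - i)%N)).
  rewrite (@big_cat_nat _ _ _ n 0 (n + N2).+1) //=; last by rewrite leqW // leq_addr.
  rewrite -[X in X <= _]addr0; apply: lerD; last by rewrite sumr_ge0.
  rewrite big_nat [X in _ <= X]big_nat; apply: ler_sum => i /andP[_ lt].
  by rewrite ler_wpM2l // H2 // leq_subRL; lia.
have [Cs [x [Cs0 x0 x1 sP]]] := s_bound.
have Ss n : \sum_(i < n) s i <= Cs / (1 - x).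
  apply: le_trans (_ : \sum_(i < n) Cs * x ^+ i <= _); first exact: ler_sum.
  by rewrite -mulr_sumr ler_wpM2l // geom_le.
pose B := K / eta2 * (Cs / (1 - x)).
have K0 : 0 <= K / eta2 by apply: le_trans (Sb 0%N); rewrite big_ord0.
have LB T : T%:R * eta1 <= B.
  apply: le_trans (_ : \sum_(n < N1 + T) conv (sc b) s n <= _); last first.
    apply: le_trans (sum_conv_le _ sb0 s_ge0) _.
    by apply: ler_pM => //; apply: sumr_ge0 => i _ //; exact: s_ge0.
  rewrite -(big_mkord xpredT (conv (sc b) s)) (@big_cat_nat _ _ _ N1) ?leq_addr //=.
  rewrite -[X in X <= _]add0r; apply: lerD.
    by rewrite sumr_ge0 // => n _; rewrite sumr_ge0 // => i _; rewrite mulr_ge0 ?s_ge0.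
  apply: le_trans (_ : \sum_(N1 <= n < N1 + T) eta1 <= _).
    by rewrite sumr_const_nat addKn mulr_natl.
  rewrite [X in X <= _]big_nat [X in _ <= X]big_nat; apply: ler_sum => n /andP[? _].
  exact: H1.
have B0 : 0 <= B by have := LB 0%N; rewrite mul0r.
have := LB (Num.Def.archi_bound (B / eta1)).
rewrite -ler_pdivlMr // leNgt => /negP; apply.
by apply: archi_boundP; rewrite divr_ge0 // ltW.
Qed.

End Root.
End Renewal.
End Numeric.

(** * The root of W(t) = 1 *)

Section RenewalRoot.
Variable RT : realType.
Variable w : nat -> RT.
Hypothesis w0 : w 0%N = 0.
Hypothesis w_ge0 : forall n, 0 <= w n.
Hypothesis w_sub : subexp w.
Implicit Types (t u : RT).

Let f n t : RT := \sum_(i < n) w i * t ^+ i.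
Let lip n : RT := \sum_(i < n) w i * i%:R.

Lemma expr_lipschitz t u i : 0 <= t -> t <= u -> u <= 1 ->
  u ^+ i - t ^+ i <= i%:R * (u - t).
Proof.
move=> t0 tu u1; have u0 := le_trans t0 tu.
elim: i => [|i IH]; first by rewrite !expr0 subrr mul0r.
have -> : u ^+ i.+1 - t ^+ i.+1 = u * (u ^+ i - t ^+ i) + (u - t) * t ^+ i.
  by rewrite !exprS; ring.
rewrite -natr1 [X in _ <= X]mulrDl mul1r; apply: lerD.
  by apply: le_trans IH; rewrite ler_piMl // subr_ge0 lerXn2r ?nnegrE.
by rewrite ler_piMr ?subr_ge0 // exprn_ile1 // (le_trans tu).
Qed.

Lemma series_lipschitz n t u : 0 <= t -> t <= u -> u <= 1 ->
  f n u <= f n t + lip n * (u - t).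
Proof.
move=> t0 tu u1; rewrite -lerBlDl -sumrB mulr_suml; apply: ler_sum => i _.
by rewrite -mulrBr -mulrA ler_wpM2l // expr_lipschitz.
Qed.

Lemma lip_ge0 n : 0 <= lip n.
Proof. by apply: sumr_ge0 => i _; rewrite mulr_ge0. Qed.

Lemma f_mono n n' t : 0 <= t -> (n <= n')%N -> f n t <= f n' t.
Proof.
move=> t0 le; rewrite /f -(big_mkord xpredT (fun i => w i * t ^+ i)).
rewrite -(big_mkord xpredT (fun i => w i * t ^+ i)) (@big_cat_nat _ _ _ n 0 n') //=.
by rewrite lerDl sumr_ge0 // => i _; rewrite mulr_ge0 ?exprn_ge0.
Qed.

(** The root is the supremum of the points of [0, 1] at which all partial sums are at most 1. A
    Lipschitz estimate shows that it has this property itself; if the sums stayed below [1 - eps]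
    there, convergence beyond it would admit a larger point. *)
Lemma root_exists J : 1 < \sum_(i < J) w i -> exists rho, [/\ 0 < rho, rho < 1,
  forall n, f n rho <= 1 & forall eps, 0 < eps -> exists n, 1 - eps < f n rho].
Proof.
move=> J1; pose S : set RT := [set t | 0 <= t <= 1 /\ forall n, f n t <= 1].
have E2 : 2 = 1 + 1 :> RT by [].
have [t0 [t00 St0]] : exists t0, 0 < t0 /\ S t0.
  have [|C CP] := w_sub (r := 2); first by rewrite E2 ltrDl.
  have C0 : 0 <= C by have := CP 0%N; rewrite expr0 mulr1; apply: le_trans.
  pose C1 := C + 1; have C1p : 1 <= C1 by rewrite lerDr.
  have C1p' : 0 < C1 by apply: lt_le_trans C1p.
  (* [C1 * y] is one half and [y] is at most one half, so the geometric sum from index 1 is at most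
     1. Evaluating at [y / 2] absorbs the factor [2 ^+ i] in the bound on [w i]. *)
  pose y := (C1 * 2)^-1; have y0 : 0 < y by rewrite invr_gt0 mulr_gt0.
  have y2 : y <= 2^-1 by rewrite lef_pV2 ?posrE ?mulr_gt0 // ler_peMl.
  have half : (2^-1 : RT) < 1 by rewrite invf_lt1 // E2 ltrDl.
  have h2 : (2^-1 : RT) = 1 - 2^-1 by rewrite [X in X - _](splitr 1) div1r addrK.
  have y1 : y < 1 by apply: le_lt_trans half.
  exists (y / 2); split; first by rewrite divr_gt0.
  split=> [|n].
    apply/andP; split; first by rewrite divr_ge0 // ltW.
    by rewrite ler_pdivrMr // mul1r (le_trans (ltW y1)) // E2 lerDl.
  case: n => [|n]; first by rewrite /f big_ord0.
  rewrite /f -(big_mkord xpredT (fun i => w i * (y / 2) ^+ i)) big_ltn // w0 mul0r add0r.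
  apply: le_trans (_ : \sum_(1 <= i < n.+1) C1 * y ^+ i <= _).
    apply: ler_sum => i _; rewrite (exprMn _ y 2^-1) (exprVn 2 i) mulrA ler_pdivrMr ?exprn_gt0 //.
    rewrite mulrAC ler_wpM2r ?exprn_ge0 ?(ltW y0) //.
    apply: le_trans (ler_norm _) _; apply: le_trans (CP i) _.
    by rewrite ler_wpM2r ?exprn_ge0 // lerDl.
  rewrite -mulr_sumr; apply: le_trans (ler_wpM2l (ltW C1p') (geom_tail_le 1 n.+1 (ltW y0) y1)) _.
  rewrite expr1 mulrA ler_pdivrMr ?subr_gt0 // mul1r.
  have -> : C1 * y = 2^-1 by rewrite /y invfM mulrA mulfV ?gt_eqF // mul1r.
  by rewrite [X in X <= _]h2 lerD2l lerN2.
have hS : has_sup S.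
  by split; [exists t0 | exists 1 => t [/andP[_ ?]]].
pose rho := sup S.
have rho0 : 0 < rho by apply: lt_le_trans t00 _; apply: ub_le_sup => //; case: hS.
have rho1 : rho <= 1 by apply: ge_sup => [|t [/andP[_ ?]]] //; exists t0.
have small n eps : 0 < eps -> exists d, 0 < d /\ lip n * d < eps.
  move=> e0; exists (eps / (lip n + 1)).
  have p : 0 < lip n + 1 by rewrite ltr_wpDl ?lip_ge0.
  split; first by rewrite divr_gt0.
  rewrite mulrA ltr_pdivrMr // mulrDr mulr1 mulrC ltrDl //.
have rho_le n : f n rho <= 1.
  rewrite leNgt; apply/negP => lt.
  have [d [d0 dl]] := small n (f n rho - 1) (etrans (subr_gt0 _ _) lt).
  have [t [/andP[tt0 t1] St] td] := sup_adherent d0 hS.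
  have tr : t <= rho by apply: ub_le_sup; [case: hS | split=> //; rewrite tt0].
  have := series_lipschitz n tt0 tr rho1; rewrite leNgt => /negP; apply.
  apply: le_lt_trans (_ : 1 + lip n * d < _); last by rewrite -ltrBrDl.
  apply: lerD => //; rewrite ler_wpM2l ?lip_ge0 // lerBlDl -lerBlDr.
  exact: ltW.
have rho1' : rho < 1.
  rewrite lt_neqAle rho1 andbT; apply/eqP => r1.
  have := rho_le J; rewrite /f r1; under eq_bigr do rewrite expr1n mulr1.
  by rewrite leNgt J1.
exists rho; split=> // eps e0.
apply: contrapT => nex.
have fle n : f n rho <= 1 - eps.
  by rewrite leNgt; apply/negP => lt; apply: nex; exists n.
(* Up to this point beyond [rho] the series still converges geometrically, so one [N] makes all its
   tails less than [eps / 2]; the first [N] terms are controlled by the Lipschitz estimate. *)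
pose t1 := (1 + rho) / 2.
have t1r : rho < t1 by rewrite ltr_pdivlMr // E2 mulrDr mulr1 ltrD2r.
have t11 : t1 < 1 by rewrite ltr_pdivrMr // mul1r E2 ltrD2l.
have t10 : 0 < t1 by apply: lt_trans t1r.
have [|r [r1 _ x1]] := exists_ratio t10 t11 (r := 2); first by rewrite E2 ltrDl.
have [C CP] := w_sub r1; set x := r * t1 in x1.
have C0 : 0 <= C by have := CP 0%N; rewrite expr0 mulr1; apply: le_trans.
have x0 : 0 <= x by rewrite mulr_ge0 ?(ltW t10) // ltW // (lt_trans _ r1).
have e2 : 0 < eps / 2 by rewrite divr_gt0.
have [N NP] := expr_small (C / (1 - x)) x0 x1 e2.
have [d [d0 dl]] := small N (eps / 2) e2.
pose t := Num.min t1 (rho + d).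
have tr : rho < t by rewrite lt_min t1r ltrDl.
have tt1 : t <= t1 by rewrite ge_min lexx.
have t0' : 0 <= t by apply: ltW; apply: lt_trans tr.
have St : S t.
  split; first by rewrite t0' (le_trans tt1) // ltW.
  move=> n; apply: le_trans (_ : f N t + eps / 2 <= _).
    case: (leqP n N) => nN; first by apply: le_trans (f_mono t0' nN) _; rewrite lerDl ltW.
    rewrite /f -(big_mkord xpredT (fun i => w i * t ^+ i)).
    rewrite -(big_mkord xpredT (fun i => w i * t ^+ i)) (@big_cat_nat _ _ _ N 0 n) //=; last exact: ltnW.
    rewrite lerD2l; apply: le_trans (ltW NP).
    apply: le_trans (_ : \sum_(N <= i < n) C * x ^+ i <= _).
      apply: ler_sum => i _; rewrite exprMn mulrA; apply: ler_pM => //.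
      - by rewrite exprn_ge0.
      - by apply: le_trans (CP i); exact: ler_norm.
      - by apply: lerXn2r; rewrite ?nnegrE // ltW.
    rewrite -mulr_sumr mulrAC -mulrA ler_wpM2l //.
    exact: geom_tail_le.
  rewrite [X in _ <= X](_ : 1 = (1 - eps + eps / 2) + eps / 2); last first.
    by rewrite -addrA -splitr subrK.
  rewrite lerD2r; apply: le_trans (series_lipschitz N (ltW rho0) (ltW tr) _) _.
    by rewrite (le_trans tt1) // ltW.
  apply: lerD => //; apply: le_trans (ltW dl); rewrite ler_wpM2l ?lip_ge0 //.
  by rewrite lerBlDl ge_min lexx orbT.
have : t <= rho by apply: ub_le_sup => //; case: hS.
by rewrite leNgt tr.
Qed.

Theorem renewal_conv b c : (forall n, 0 <= b n) -> (forall n, 0 <= c n) ->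
  renewal w b -> renewal w c -> renewal w (conv b c) -> subexp b \/ subexp c.
Proof.
move=> b0 c0 rb rc rp.
case: (pselect (forall J, \sum_(i < J) w i <= 1)) => [w1|/existsNP [J /negP]].
  by left; apply: renewal_small rb.
rewrite -ltNge => /root_exists [rho [rho0 rho1 rle rge]].
exact: (@renewal_conv_root _ w w0 w_ge0 w_sub rho).
Qed.

End RenewalRoot.

(** * Curvature of subexponential sequences *)

Section Curvature.
Variable RT : realType.

Lemma powR_root (x : RT) n : 0 <= x -> (0 < n)%N -> (x ^+ n) `^ (n%:R^-1) = x.
Proof.
move=> x0 n0; rewrite -powR_mulrn // -powRrM mulfV ?powRr1 //.
by rewrite pnatr_eq0 -lt0n.
Qed.

(** A sequence of naturals is eventually zero or infinitely often at least 1; the second case forces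
    the upper limit up to 1. *)
Lemma limsup_root_subexp (b : nat -> nat) : subexp (fun n => (b n)%:R : RT) ->
  [set (0 : RT)%:E; (1 : RT)%:E] (limn_esup (fun n => (((b n)%:R : RT) `^ (n%:R^-1))%:E)).
Proof.
move=> sb; set u := fun n : nat => _.
case: (pselect (exists N, forall n, (N <= n)%N -> b n = 0%N)) => [[N bN]|inf]; [left | right].
  have : u @ \oo --> (0 : RT)%:E.
    (* Index 0 is avoided: its exponent is 0, and the zeroth power of 0 is 1. *)
    apply: cvg_near_cst; exists N.+1 => // n /= lt; rewrite /u bN; last exact: ltnW.
    by rewrite powR0 // invr_eq0 pnatr_eq0 -lt0n (leq_ltn_trans _ lt).
  by move=> /cvg_limn_einf_sup [].
rewrite limn_esup_lim; apply/eqP; rewrite eq_le; apply/andP; split.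
  apply/lee_addgt0Pr => eps e0; rewrite -EFinD.
  pose r := 1 + eps / 2; have r1 : 1 < r by rewrite ltrDl divr_gt0.
  have r0 : 0 < r by apply: lt_trans r1.
  have re : r < 1 + eps by rewrite ltrD2l ltr_pdivrMr // ltr_pMr // ltr1n.
  have p0 : 0 < 1 + eps by apply: lt_trans re.
  have [C CP] := sb r r1.
  have C0 : 0 <= C by have := CP 0%N; rewrite expr0 mulr1; apply: le_trans.
  have x0 : 0 <= r / (1 + eps) by rewrite divr_ge0 // ltW.
  have x1 : r / (1 + eps) < 1 by rewrite ltr_pdivrMr // mul1r.
  have [N NP] := expr_small C x0 x1 ltr01.
  apply: lime_le; first exact: is_cvg_esups.
  exists N.+1 => // n /= lt; apply: ge_ereal_sup => _ [j /= nj <-].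
  have Nj : (N < j)%N by apply: leq_trans nj.
  rewrite lee_fin -[X in _ <= X](@powR_root _ j) ?(ltW p0) //; last exact: leq_ltn_trans Nj.
  apply: ge0_ler_powR; rewrite ?invr_ge0 ?nnegrE ?exprn_ge0 ?(ltW p0) //.
  have := CP j; rewrite normr_nat => /le_trans; apply.
  have : C * (r / (1 + eps)) ^+ j <= 1.
    by apply: le_trans (ltW NP); rewrite ler_wpM2l // ler_wiXn2l ?(ltW x1) // ltnW.
  by rewrite exprMn exprVn mulrA ler_pdivrMr ?exprn_gt0 // mul1r.
apply: lime_ge; first exact: is_cvg_esups.
apply: nearW => n.
have [j [nj bj]] : exists j, (n <= j)%N /\ b j != 0%N.
  apply: contrapT => H; apply: inf; exists n => j nj; apply/eqP.
  by apply: contrapT => /negP bj; apply: H; exists j.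
apply: le_trans (_ : u j <= _)%E; last by apply: ereal_sup_ubound; exists j.
have E1 : (1 : RT) `^ j%:R^-1 = 1 by rewrite powR1.
rewrite lee_fin -[X in X <= _]E1; apply: ge0_ler_powR; rewrite ?invr_ge0 ?nnegrE //.
by rewrite ler1n lt0n.
Qed.

End Curvature.

(** * Resolutions and Betti numbers *)

Section Resolutions.
Variable R : comNzRingType.
Implicit Types (F : fcomplex R) (M N : lmodType R).

Lemma resolutionP M : noetherian R -> finitely_generated M ->
  free_resolution M (resolution M).
Proof.
move=> noethR fgM; rewrite /resolution; case: pselect => [h|[]].
  exact: projT2 (cid h).
exact: free_resolution_exists.
Qed.

Lemma free_resolution_dd M (F : free_complex R) n :
  free_resolution M F -> dmx F n.+1 *m dmx F n = 0.
Proof.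
move=> [e [_ _ ex]]; apply/row_matrixP => i; rewrite row_mul row0.
by apply/ex; exists (delta_mx 0 i); rewrite -rowE.
Qed.

(** [untag] sets the coordinates outside F-degree [n] to 0 without an explicit transport of
    types. *)
Definition degpart F N n (f : 'I_(rk F n) -> N) : tens F (modcx N) := untag 0 f.

Lemma degpartE F N n (f : 'I_(rk F n) -> N) a : degpart f (existT _ n a) = f a.
Proof. by rewrite /degpart (untagE _ _ (erefl : tag (existT _ n a) = n)). Qed.

Lemma degpart_gr F N n (f : 'I_(rk F n) -> N) : gr n (degpart f).
Proof.
move=> t; case: (eqVneq (tag t) n) => [e|ne].
  by rewrite e leqnn; left; rewrite subnn.
by rewrite /degpart untag_dflt //; case: ifP => // _; right.
Qed.

Lemma degpart_eta F N n (x : tens F (modcx N)) :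
  gr n x -> x = degpart (fun a => x (existT _ n a)).
Proof.
move=> gx; apply/funext => -[i a]; case: (eqVneq i n) => [e|ne].
  by subst i; rewrite degpartE.
by rewrite (tens_modcx_gr gx) // /degpart untag_dflt.
Qed.

Lemma tens_modcx_gd F N (x : tens F (modcx N)) i a :
  gd x (existT _ i a) = tensor_map (dmx F i) (fun b => x (existT _ i.+1 b)) a.
Proof.
rewrite [LHS](_ : _ = \sum_b dmx F i b a *: x (existT _ i.+1 b) + (-1) ^+ i *: 0) //.
by rewrite scaler0 addr0.
Qed.

Lemma gd_degpart F N n (f : 'I_(rk F n.+1) -> N) :
  gd (degpart f) = degpart (tensor_map (dmx F n) f).
Proof.
rewrite [LHS](degpart_eta (n := n)); last exact: gd_gr (degpart_gr f).
congr degpart; apply/funext => a; rewrite tens_modcx_gd; congr tensor_map.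
by apply/funext => b; rewrite degpartE.
Qed.

Lemma tens_modcx_exact F N n :
  (forall x : 'I_(rk F n) -> N, tensor_map (out_mx F n) x = (fun=> 0) ->
     exists y, x = tensor_map (dmx F n) y) ->
  @cyc R (tens F (modcx N)) n `<=` @bdr R _ n.
Proof.
move=> ex x [gx dx]; have [|y yE] := ex (fun a => x (existT _ n a)); last first.
  by exists (degpart y); [exact: degpart_gr | rewrite gd_degpart -yE -degpart_eta].
case: n gx {ex} => [|n] gx; apply/funext => a.
  by rewrite /tensor_map big1 // => i _; rewrite mxE scale0r.
by rewrite /= -tens_modcx_gd dx.
Qed.

Lemma tensor_map_row p q (A : 'M[R]_(p, q)) (f : 'I_p -> R^o) :
  \row_j tensor_map A f j = (\row_i f i) *m A.
Proof.
by apply/rowP => j; rewrite !mxE; apply: eq_bigr => i _; rewrite mxE mulrC.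
Qed.

Lemma tensor_map_mx p q (A : 'M[R]_(p, q)) (v : 'rV_p) :
  tensor_map A (fun i => v 0 i : R^o) = fun j => (v *m A) 0 j.
Proof.
apply/funext => j; have /rowP/(_ j) := tensor_map_row A (fun i => v 0 i : R^o).
rewrite mxE => ->; congr ((_ *m A) 0 j); by apply/rowP => i; rewrite mxE.
Qed.

(** Tensored with a second free complex, this replaces a resolution by its module, which is how the
    vanishing of Tor reaches the product of two resolutions. *)
Lemma tens_resolution_qiso M F :
  free_resolution M F -> qiso (tens F (modcx R^o)) (modcx M).
Proof.
move=> [e [es e0 ex]].
pose f (n : nat) (x : tens F (modcx R^o)) : modcx M :=
  if n == 0%N then \sum_(i < rk F 0) (x (existT _ 0%N i) : R) *: e i else 0.
exists f; split.
  split=> [[|n] a x y|[|n] x gx|[|n] x gx]; rewrite /f /=; try by [left|right].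
  - rewrite [RHS](_ : _ = a *: (\sum_(i < rk F 0) (x (existT _ 0%N i) : R) *: e i) +
      \sum_(i < rk F 0) (y (existT _ 0%N i) : R) *: e i) //.
    rewrite scaler_sumr -big_split; apply: eq_bigr => i _.
    by rewrite /= scalerA -scalerDl.
  - by rewrite [RHS](_ : _ = a *: (0 : M) + 0) // scaler0 addr0.
  - apply/esym; have /e0 : exists w, \row_(i < rk F 0) (gd x (existT _ 0%N i) : R) = w *m dmx F 0.
      exists (\row_(i < rk F 1) x (existT _ 1%N i)); rewrite -tensor_map_row.
      by apply/rowP => i; rewrite [LHS]mxE [RHS]mxE tens_modcx_gd.
    by move=> E; rewrite -[RHS]E; apply: eq_bigr => i _; rewrite mxE.
  - by [].
move=> [|[|n]] x y gx gy dx xE.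
- have [v yE] := es y; exists (degpart (fun i => v 0 i : R^o)), 0; split.
  + exact: degpart_gr.
  + by right.
  + by rewrite gx; apply: gd0; apply: degpart_gr.
  + rewrite [RHS](_ : _ = f 0%N (degpart (fun i => v 0 i : R^o)) + 0) // addr0 yE /f /=.
    by apply: eq_bigr => i _; rewrite degpartE.
- have /e0 [w wE] : \sum_(i < rk F 0) (\row_(i < rk F 0) (x (existT _ 0%N i) : R)) 0 i *: e i = 0.
    rewrite -[RHS]xE /f /=; apply: eq_bigr => i _; by rewrite mxE.
  exists (degpart (fun i => w 0 i : R^o)), 0; split.
  + exact: degpart_gr.
  + by right.
  + rewrite gd_degpart [RHS](degpart_eta gx); congr degpart; apply/funext => i.
    by rewrite tensor_map_mx -wE mxE.
  + by case: gy => // ->; rewrite [RHS](_ : _ = 0 + 0) // addr0.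
have /ex [w wE] : (\row_(i < rk F n.+1) (x (existT _ n.+1 i) : R)) *m dmx F n = 0.
  rewrite -tensor_map_row; apply/rowP => i; rewrite [LHS]mxE -tens_modcx_gd dx mxE //.
exists (degpart (fun i => w 0 i : R^o)), 0; split.
- exact: degpart_gr.
- by right.
- rewrite gd_degpart [RHS](degpart_eta gx); congr degpart; apply/funext => i.
  by rewrite tensor_map_mx -wE mxE.
- by case: gy => // ->; rewrite [RHS](_ : _ = 0 + 0) // addr0.
Qed.

Lemma modcx_exact M n : (0 < n)%N -> @cyc R (modcx M) n `<=` @bdr R _ n.
Proof.
by case: n => // n _ x [[//|->] _]; apply: submod0; exact: bdrS.
Qed.

Lemma exact_qiso (X Y : gcomplex R) n : qiso X Y ->
  @cyc R Y n `<=` @bdr R Y n -> @cyc R X n `<=` @bdr R X n.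
Proof.
move=> [f [fm fq]] H x Zx; apply: (qis_inj fq Zx); apply: H.
exact: mor_cyc fm _ _ Zx.
Qed.

End Resolutions.

(** * The renewal equation for Betti numbers *)

Section Renewal.
Variables (RT : realType) (R : comNzRingType) (m : set R).
Variables (k : fieldType) (pi : {rmorphism R -> k}).
Hypothesis noethR : noetherian R.
Hypothesis residue : residue_map m pi.
Variables (A : tate_algebra R) (acl : is_acyclic_closure m A).
Variables (q : nat) (v : nat -> nat).
Hypothesis q1 : (1 <= q)%N.
Hypothesis v_ge : forall n, hge pi (tUt residue acl q) n (v n).
Hypothesis splitting : qiso (tens (zd R v) (tA A)) (tUt residue acl q).

(** The shift by one comes from the connecting map: homology of k in degree [n.+1] meets homology of
    Ut in degree [n]. *)
Let w (n : nat) : RT := if n is n'.+1 then (v n')%:R else 0.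

Lemma poly_bound_mono C D n : (C * n.+1 ^ D <= C * n.+2 ^ D)%N.
Proof.
rewrite leq_mul2l; case: D => [|D]; first by rewrite !expn0 leqnn orbT.
by rewrite leq_exp2r // leqnSn orbT.
Qed.

(** The empty list of factors gives polynomial growth for U itself; and the homology of Ut embeds in
    that of U, since U and Ut coincide in positive degrees and so have the same boundaries. *)
Lemma weight_subexp : subexp w.
Proof.
have [|C [D CD]] := growth_bound residue acl (Fs := [::]) (n0 := 1) noethR q1.
  by move=> n; apply: modcx_exact.
apply: subexp_le (@subexp_poly RT C D) => -[|n]; first by rewrite normr0.
rewrite /w !normr_nat ler_nat.
have : hge pi (tU A q) n (v n).
  have [x [Zx xi]] := v_ge n; exists x; split=> [i|c [y gy yE]].
    by have [[gx _] dx] := Zx i.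
  by apply: xi; exists y => //; apply: tU_tUt.
move=> /dim_leq - /(_ _ (CD n)) /leq_trans; apply.
exact: poly_bound_mono.
Qed.

(** Each estimate plays a lower bound for one term of the long exact sequence against upper bounds
    for its neighbours; hence both kinds of bounds are required of [b]. *)
Lemma exact_renewal Fs n0 (b : nat -> nat) :
  (forall n, hle pi (multitens Fs (kc pi)) n (b n)) ->
  (forall n, hge pi (multitens Fs (kc pi)) n (b n)) ->
  (forall n, (n0 <= n)%N ->
     @cyc R (multitens Fs (modcx R^o)) n `<=` @bdr R _ n) ->
  renewal w (fun n => (b n)%:R).
Proof.
move=> b_le b_ge /(growth_bound residue acl noethR q1) [C [D CD]].
pose e n := (C * n.+1 ^ D)%N.
pose s n := (\sum_(j < n.+1) v j * b (n - j))%N.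
have qA := qiso_mt Fs (tA_kc residue acl).
have s_le n : hle pi (multitens Fs (tUt residue acl q)) n (s n).
  apply/(hle_qiso pi _ _ (qiso_mt Fs splitting)); apply: hle_mt_zd => j _ _.
  exact/(hle_qiso pi _ _ qA).
have s_ge n : hge pi (multitens Fs (tUt residue acl q)) n (s n).
  apply/(hge_qiso pi _ _ (qiso_mt Fs splitting)); apply: hge_mt_zd => i _.
  exact/(hge_qiso pi _ _ qA).
have [f [g fgs]] : sesq (multitens Fs (tUt residue acl q))
    (multitens Fs (tU A q)) (multitens Fs (kc pi)).
  by apply: sesq_mt; do 2 eexists; apply: ses_Ut_U.
have b0 : (b 0 <= e 0)%N := dim_leq (b_ge 0%N) (hle_quotient0 fgs (CD 0%N)).
have bS n : (b n.+1 <= e n.+1 + s n)%N.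
  exact: dim_leq (b_ge n.+1) (hle_quotientS fgs (CD n.+1) (s_le n)).
have sb n : (s n <= e n + b n.+1)%N.
  exact: dim_leq (s_ge n) (hle_sub fgs (CD n) (b_le n.+1)).
rewrite /renewal; apply: subexp_le (@subexp_poly RT (2 * C) D) => n; rewrite [leRHS]normr_nat.
have -> : (2 * C * n.+1 ^ D = e n + e n)%N by rewrite /e -mulnA mul2n addnn.
case: n => [|n].
  by rewrite /conv big_ord1 mul0r subr0 normr_nat ler_nat (leq_trans b0) ?leq_addr.
have -> : conv w (fun n => (b n)%:R) n.+1 = (s n)%:R.
  rewrite /conv big_ord_recl mul0r add0r natr_sum.
  by apply: eq_bigr => i _; rewrite natrM.
have eS : (e n <= e n.+1)%N by apply: poly_bound_mono.
have := bS n; have := sb n; rewrite -!(ler_nat RT) !natrD => h1 h2.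
have := eS; rewrite -(ler_nat RT) => h3.
rewrite ler_norml; apply/andP; split; lra.
Qed.

End Renewal.

Theorem theorem2 (RT : realType) (R : comNzRingType) (m : set R)
    (k : fieldType) (pi : {rmorphism R -> k})
    (noethR : noetherian R) (localR : local_ring m)
    (residue : residue_map m pi)
    (golodR : generalized_golod pi m)
    (M N : lmodType R)
    (fgM : finitely_generated M) (fgN : finitely_generated N)
    (torMN : exists i0 : nat, forall i : nat, (i0 <= i)%N -> Tor_eq0 M N i) :
  [set curv RT pi M; curv RT pi N] `&` [set 0%:E; 1%:E] !=set0.
Proof.
have [q q1 [A [acl TM]]] := golodR; have [i0 tor] := torMN.
have [v [v_ge splitting]] := golod_splitting residue acl q1 noethR TM.
have rM := resolutionP noethR fgM; have rN := resolutionP noethR fgN.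
pose FM := FComplex (fun n => free_resolution_dd n rM).
pose FN := FComplex (fun n => free_resolution_dd n rN).
have qM : qiso (tens FM (modcx R^o)) (modcx M) := tens_resolution_qiso (F := FM) rM.
have qN : qiso (tens FN (modcx R^o)) (modcx N) := tens_resolution_qiso (F := FN) rN.
have kcP G := tens_kc_dim (pi_surj residue) G.
have renM := exact_renewal (RT := RT) (Fs := [:: FM]) noethR q1 splitting
  (fun n => (kcP FM n).1) (fun n => (kcP FM n).2)
  (fun n (n0 : (1 <= n)%N) => exact_qiso qM (modcx_exact (M := M) n0)).
have renN := exact_renewal (RT := RT) (Fs := [:: FN]) noethR q1 splitting
  (fun n => (kcP FN n).1) (fun n => (kcP FN n).2)
  (fun n (n0 : (1 <= n)%N) => exact_qiso qN (modcx_exact (M := N) n0)).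
have kcP2 := tens2_kc_dim (pi_surj residue) FM FN.
(* Replacing the resolution of [N] by [N] turns the exactness required here into the vanishing of
   Tor. *)
have renMN := exact_renewal (RT := RT) (Fs := [:: FM; FN]) noethR q1 splitting
  (fun n => (kcP2 n).1) (fun n => (kcP2 n).2)
  (fun n n0 => exact_qiso (qiso_tens FM qN) (tens_modcx_exact (F := FM) (tor n n0))).
have bettiE (L : lmodType R) (F : fcomplex R) : fcx F = resolution L ->
    betti pi L = hombetti pi F.
  by move=> FE; apply/funext => n; rewrite hombettiE FE.
have curv01 (L : lmodType R) (F : fcomplex R) : fcx F = resolution L ->
    subexp (fun n => (hombetti pi F n)%:R : RT) -> [set 0%:E; 1%:E] (curv RT pi L).
  by move=> /bettiE E /limsup_root_subexp; rewrite /curv E.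
(* [N] comes first because [tens2_kc_dim] sums over the degree in the second factor. *)
have [||||] := renewal_conv _ _ (weight_subexp (RT := RT) noethR q1 v_ge)
  (fun n => ler0n RT (hombetti pi FN n)) (fun n => ler0n RT (hombetti pi FM n)) renN renM.
- by [].
- by case.
- congr (renewal _ _): renMN; apply/funext => n; rewrite /conv natr_sum.
  by apply: eq_bigr => i _; rewrite natrM.
- by move=> /(curv01 N FN erefl) H; exists (curv RT pi N); split=> //; right.
- by move=> /(curv01 M FM erefl) H; exists (curv RT pi M); split=> //; left.
Qed.
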